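(* Let $i,j,k\geq 0$ be integers and let $p=x\pi^{i}(x)\pi^{j}(x)\pi^{k}(x)$. One can effectively determine (i.e., there is an algorithm that, given $i,j,k$, computes) a value $\sigma\in\{1,2,3,\ldots\}\cup\{+\infty\}$ such that $p$ is avoidable in $\Sigma_m$ for every integer $m$ with $2\leq m\leq \sigma-1$, and $p$ is unavoidable in $\Sigma_m$ for every integer $m\geq \sigma+1$.
   Context: For $m\geq 1$, $\Sigma_m=\{0,1,\ldots,m-1\}$. A morphic permutation of $\Sigma_m$ is a morphism $f:\Sigma_m^*\to\Sigma_m^*$ (i.e. $f(xy)=f(x)f(y)$) whose restriction to $\Sigma_m$ is a permutation of $\Sigma_m$; $f^0$ is the identity and $f^{t+1}=f\circ f^t$. In the pattern $p=x\pi^{i}(x)\pi^{j}(x)\pi^{k}(x)$, $x$ is a word variable and $\pi$ a function variable. An instance of $p$ in $\Sigma_m$ is a word $u f^{i}(u)f^{j}(u)f^{k}(u)$ with $u\in\Sigma_m^+$ (nonempty) and $f$ a morphic permutation of $\Sigma_m$. The pattern $p$ is avoidable in $\Sigma_m$ if there exists an infinite word over $\Sigma_m$ none of whose factors is an instance of $p$ in $\Sigma_m$; otherwise it is unavoidable in $\Sigma_m$. *)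

(* Defs.v *)
From mathcomp Require Import all_boot all_fingroup.
Set Implicit Arguments.
Unset Strict Implicit.
Unset Printing Implicit Defensive.

Definition morphism_word m (f : seq 'I_m -> seq 'I_m) : Prop :=
  forall x y, f (x ++ y) = f x ++ f y.

Definition morphic_permutation m (f : seq 'I_m -> seq 'I_m) : Prop :=
  morphism_word f /\ exists s : {perm 'I_m}, forall a, f [:: a] = [:: s a].

Definition is_instance (i j k : nat) m (v : seq 'I_m) : Prop :=
  exists (u : seq 'I_m) (f : seq 'I_m -> seq 'I_m),
    [/\ u <> [::], morphic_permutation f
      & v = u ++ iter i f u ++ iter j f u ++ iter k f u].

Definition factor m (v : seq 'I_m) (w : nat -> 'I_m) : Prop :=
  exists n l : nat, v = [seq w t | t <- iota n l].

Definition avoidable (i j k m : nat) : Prop :=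
  exists w : nat -> 'I_m, forall v, factor v w -> ~ is_instance i j k v.

Definition unavoidable (i j k m : nat) : Prop := ~ avoidable i j k m.

(** An algorithm is a mu-recursive program: [mu_rec n] is the syntax of
    the n-ary partial recursive functions, and [evals e v y] says that [e]
    halts on the input [v] with output [y]. *)
Inductive mu_rec : nat -> Type :=
| Zero : mu_rec 0
| Succ : mu_rec 1
| Proj n (i : 'I_n) : mu_rec n
| Comp m n (f : mu_rec m) (g : 'I_m -> mu_rec n) : mu_rec n
| PRec n (f : mu_rec n) (g : mu_rec n.+2) : mu_rec n.+1
| Mu n (f : mu_rec n.+1) : mu_rec n.

Inductive evals : forall n, mu_rec n -> n.-tuple nat -> nat -> Prop :=
| evals_zero (v : 0.-tuple nat) : evals Zero v 0
| evals_succ x : evals Succ [tuple x] x.+1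
| evals_proj n (i : 'I_n) (v : n.-tuple nat) : evals (Proj i) v (tnth v i)
| evals_comp m n (f : mu_rec m) (g : 'I_m -> mu_rec n)
    (v : n.-tuple nat) (ys : m.-tuple nat) y :
    (forall i, evals (g i) v (tnth ys i)) -> evals f ys y ->
    evals (Comp f g) v y
| evals_prec0 n (f : mu_rec n) g (v : n.-tuple nat) y :
    evals f v y -> evals (PRec f g) [tuple of 0 :: v] y
| evals_precS n (f : mu_rec n) g (v : n.-tuple nat) x z y :
    evals (PRec f g) [tuple of x :: v] z ->
    evals g [tuple of x :: z :: v] y ->
    evals (PRec f g) [tuple of x.+1 :: v] y
(* As usual for minimization, [f] must halt, with a nonzero value [(h z).+1],
   at every [z] below the least zero [y]. *)
| evals_mu n (f : mu_rec n.+1) (v : n.-tuple nat) y (h : nat -> nat) :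
    (forall z, z < y -> evals f [tuple of z :: v] (h z).+1) ->
    evals f [tuple of y :: v] 0 ->
    evals (Mu f) v y.

(** [None] stands for +oo; [encode] is injective. *)
Definition encode (s : option nat) : nat := if s is Some n then n.+1 else 0.

Definition computable3 (sigma : nat -> nat -> nat -> option nat) : Prop :=
  exists e : mu_rec 3,
    forall i j k, evals e [tuple i; j; k] (encode (sigma i j k)).

(* Main.v *)
Require Import Defs.
From mathcomp Require Import all_boot all_fingroup.
From mathcomp Require Import zify.
From Stdlib Require Import Classical.
Set Implicit Arguments.
Unset Strict Implicit.
Unset Printing Implicit Defensive.

(** An instance of length [n] starting at [N] amounts to a permutation [s] with
    [w (N + n + t) = s^i (w (N + t))] and so on for [t < n]; each column of four letters is an orbit
    piece [a, s^i a, s^j a, s^k a], whose equality type is one of the finitely many types [T_m] of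
    [(0, i, j, k)] modulo [l], [1 <= l <= m].  Words avoiding the pattern are mostly images of the
    Thue-Morse word under a uniform morphism: short instances are excluded by inspecting the column
    types (and that the powers of [s] commute), long ones synchronise with the blocks and would
    desubstitute to a fourth power.  Further words come from Toeplitz fillings with a word over one
    letter less, from sums of the Fibonacci word modulo 2, and, when (0, i, j, k) is not a
    progression modulo one of 3, 4, 5, from interleaving each letter with its predecessor.

    Each construction needs a certain set of types to be disjoint from [T_m], which gets harder as
    [m] grows; [m] is bad when none of them applies.  Then, in a word over [m + 1] letters, the
    windows of length 4 that occur infinitely often avoid [T_m] and form a strongly connected graph,
    and a finite search leaves only periodic words and a few rigid shapes.  In these a letter may be
    spared, so that the word of remaining letters has a window type in [T_m]; otherwise the shape
    reproduces itself with fewer letters.  Hence sigma can be the least bad [m], and [T_m] is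
    constant for [m > i + j + k]. *)

(** * Instances as occurrences *)

(** The alphabet of size sigma itself stays undecided, and this gap carries the negative half: a bad
    m is exploited over m + 1 letters, so that one letter may be constant and set aside while the
    others still suffice to realise every type in T_m. Badness depends on m only through T_m, which
    grows with m, so bad alphabets form an up-set; alphabets of at most four letters are settled by
    enumerating i, j, k modulo 12. The type of a single column is too weak to exclude all short
    instances, because the columns share one permutation; commutation of its powers supplies the
    missing constraint. Two residue conditions are exceptional: abab, abca, abcd all lie in T_4, or
    (0, i, j, k) is a progression with invertible difference modulo 3, 4 and 5. There, words without
    equal neighbours, respectively without equal letters at distance at most two, are no help:
    avoiding instances forces such a word to interleave one or two letters with a word of the same
    kind over fewer letters, and descent ends in an instance. Outside these cases the same
    interleavings, run forwards, build avoiding words over larger alphabets. *)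

Section Occurrences.

Variables (i j k m : nat).
Implicit Types (s : {perm 'I_m}) (a : 'I_m) (w : nat -> 'I_m).

(** The number [l] of compared columns is kept apart from the period [n]: instances have [l = n],
    while interleaved words lead to occurrences with [n.+1] columns. *)
Definition occurs w s N n l : Prop :=
  forall t, t < l -> [/\ w (N + n + t) = (s ^+ i)%g (w (N + t)),
    w (N + 2 * n + t) = (s ^+ j)%g (w (N + t)) &
    w (N + 3 * n + t) = (s ^+ k)%g (w (N + t))].

Lemma morphism_map (f : seq 'I_m -> seq 'I_m) s :
  morphism_word f -> (forall a, f [:: a] = [:: s a]) -> f =1 map s.
Proof.
move=> fM fs; elim=> [|a x IHx]; last by rewrite -cat1s fM fs IHx.
(* Two copies of [f [::]] concatenate to [f [::]], so its size is zero. *)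
apply: size0nil; have := congr1 size (fM [::] [::]); rewrite size_cat /=; lia.
Qed.

Lemma iter_map_perm s n : iter n (map s) =1 map (s ^+ n)%g.
Proof.
move=> x; elim: n => [|n IHn] /=.
  by rewrite expg0 -[LHS]map_id; apply: eq_map => a; rewrite perm1.
by rewrite IHn -map_comp; apply: eq_map => a; rewrite /= expgSr permM.
Qed.

Lemma avoidable_occurs :
  avoidable i j k m <-> exists w, forall s N n, 0 < n -> ~ occurs w s N n n.
Proof.
split=> -[w av]; exists w.
  move=> s N n n_gt0 occ; pose u := [seq w t | t <- iota N n].
  apply: (av [seq w t | t <- iota N (n * 4)]); first by exists N, (n * 4).
  exists u, (map s); split; first by case: n n_gt0 @u {occ}.
    by split; [move=> x y; apply: map_cat | exists s].
  have iotaE M (h : 'I_m -> 'I_m) : ([seq w t | t <- iota M n] = [seq (h \o w) t | t <- iota N n])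
    <-> ([seq w (M + t) | t <- iota 0 n] = [seq h (w (N + t)) | t <- iota 0 n]).
    by rewrite -[M]addn0 -[N]addn0 !iotaDl -!map_comp /= !addn0.
  rewrite !iter_map_perm /u -!map_comp.
  have -> : n * 4 = n + (n + (n + n)) by lia.
  rewrite !iotaD !map_cat; congr (_ ++ (_ ++ (_ ++ _))).
  - by apply/iotaE; apply/eq_in_map => t; rewrite mem_iota /= => /occ[].
  - apply/iotaE; apply/eq_in_map => t; rewrite mem_iota /= => /occ[_ <- _].
    by congr w; lia.
  - apply/iotaE; apply/eq_in_map => t; rewrite mem_iota /= => /occ[_ _ <-].
    by congr w; lia.
move=> _ [N [l ->]] [u [f [u0 [fM [s fs]]]]] defv.
have fE := morphism_map fM fs.
have fnE n : iter n f u = map (s ^+ n)%g u.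
  by rewrite -iter_map_perm; elim: n => //= n ->.
pose n := size u; have n_gt0 : 0 < n by case: u u0 @n {defv fnE}.
have := congr1 size defv.
rewrite !fnE !size_cat !size_map size_iota -/n => lE.
apply: (av s N n n_gt0) => t lt_tn.
have wE r : r < l -> w (N + r) = nth (w 0) [seq w t | t <- iota N l] r.
  by move=> ltr; rewrite (nth_map 0) ?size_iota // nth_iota.
have uE : w (N + t) = nth (w 0) u t.
  by rewrite wE ?defv ?nth_cat ?lt_tn //; lia.
rewrite uE -[N + n + t]addnA -[N + 2 * n + t]addnA -[N + 3 * n + t]addnA.
rewrite !wE ?defv ?fnE; try lia.
have nE r p c : r < n -> r = p ->
    nth (w 0) [seq (s ^+ c)%g x | x <- u] r = (s ^+ c)%g (nth (w 0) u p).
  by move=> ltr <-; rewrite (nth_map (w 0)).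
by split; rewrite !nth_cat !size_map -/n; do ? (rewrite ifF; [|lia]);
  rewrite ?ifT; try lia; apply: nE; lia.
Qed.

End Occurrences.

(** The partition of four positions by equality, stored as six bits so that letters, residues and
    numbers in a certificate become comparable. *)
Definition eq_type (T : eqType) (a b c d : T) : seq bool :=
  [:: a == b; a == c; a == d; b == c; b == d; c == d].

Lemma eq_type_inj (T U : eqType) (f : T -> U) a b c d :
  injective f -> eq_type (f a) (f b) (f c) (f d) = eq_type a b c d.
Proof. by move=> f_inj; rewrite /eq_type !(inj_eq f_inj). Qed.

Definition mod_type i j k l := eq_type (0 %% l) (i %% l) (j %% l) (k %% l).

Definition types i j k m : pred (seq bool) :=
  fun tau => has (fun l => mod_type i j k l == tau) (iota 1 m).

Lemma types_mono i j k m m' tau :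
  m <= m' -> types i j k m tau -> types i j k m' tau.
Proof.
move=> le_mm' /hasP[l]; rewrite mem_iota => lm /eqP<-.
by apply/hasP; exists l; rewrite // mem_iota; lia.
Qed.

(** * Types realised by permutations *)

Section Orbits.

Variable (m : nat).
Implicit Types (s : {perm 'I_m}) (a : 'I_m) (A : {set 'I_m}).

Definition orb s a := #|porbit s a|.

Lemma orb_gt0 s a : 0 < orb s a.
Proof. by apply/card_gt0P; exists a; apply: porbit_id. Qed.

Lemma orb_le s a : orb s a <= m.
Proof. by rewrite -[leqRHS]card_ord max_card. Qed.

Lemma perm_mod_orb s a x : (s ^+ x)%g a = (s ^+ (x %% orb s a))%g a.
Proof.
rewrite {1}(divn_eq x (orb s a)) expgD permM; congr (fun_of_perm _ _).
rewrite mulnC expgM; elim: (x %/ orb s a) => [|n IHn]; first by rewrite expg0 perm1.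
by rewrite expgSr permM IHn permX iter_porbit.
Qed.

Lemma eq_perm_mod s a x y :
  ((s ^+ x)%g a == (s ^+ y)%g a) = (x == y %[mod orb s a]).
Proof.
rewrite perm_mod_orb [(s ^+ y)%g a]perm_mod_orb.
have Ho := orb_gt0 s a.
have tE z : (s ^+ (z %% orb s a))%g a = nth a (traject s a (orb s a)) (z %% orb s a).
  by rewrite nth_traject ?ltn_mod // permX.
rewrite !tE nth_uniq ?size_traject ?ltn_mod //.
exact: uniq_traject_porbit.
Qed.

Lemma eq_type_perm s a i j k :
  eq_type a ((s ^+ i)%g a) ((s ^+ j)%g a) ((s ^+ k)%g a) = mod_type i j k (orb s a).
Proof.
have -> : a = (s ^+ 0)%g a by rewrite expg0 perm1.
rewrite /eq_type -!permM -!expgD !eq_perm_mod !add0n.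
by rewrite expg0 perm1.
Qed.

Lemma types_perm s a i j k :
  types i j k m (eq_type a ((s ^+ i)%g a) ((s ^+ j)%g a) ((s ^+ k)%g a)).
Proof.
apply/hasP; exists (orb s a); last by rewrite eq_type_perm.
by rewrite mem_iota orb_gt0 add1n ltnS orb_le.
Qed.

Lemma perm_fix_orbit s a b x :
  b \in porbit s a -> (s ^+ x)%g a = a -> (s ^+ x)%g b = b.
Proof.
case/porbitP=> n ->{b} ax; rewrite -permM -expgD addnC expgD permM.
by rewrite ax.
Qed.

Lemma perm_commute s a x y : (s ^+ x)%g ((s ^+ y)%g a) = (s ^+ y)%g ((s ^+ x)%g a).
Proof. by rewrite -!permM -!expgD addnC. Qed.

(** Induction on [u]: a new letter [x] is sent to [y] by composing with the transposition of [g x]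
    and [y], which does not disturb the letters already placed. *)
Lemma extend_perm A (u v : seq 'I_m) :
  size u = size v -> {subset u <= A} -> {subset v <= A} ->
  (forall x y d, x < size u -> y < size u ->
     (nth d u x == nth d u y) = (nth d v x == nth d v y)) ->
  exists2 g : {perm 'I_m}, perm_on A g & map g u = v.
Proof.
elim: u v => [|x u IHu] [|y v] //=; first by exists 1%g; rewrite ?perm_on1.
case=> sz uA vA H.
have [|||g gA gu] := IHu v sz.
- by move=> z zu; apply: uA; rewrite inE zu orbT.
- by move=> z zu; apply: vA; rewrite inE zu orbT.
- by move=> a b d au bu; have := H a.+1 b.+1 d; apply.
have [xu|xNu] := boolP (x \in u).
  exists g => //; rewrite gu; congr (_ :: _).
  have ix : index x u < size u by rewrite index_mem.
  have := H 0 (index x u).+1 x isT ix; rewrite /= nth_index // eqxx => /esym/eqP->.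
  by rewrite -gu (nth_map x) // nth_index.
have gxv : g x \notin v by rewrite -gu (mem_map perm_inj).
have yv : y \notin v.
  apply/negP=> yv; have iy : index y v < size u by rewrite sz index_mem.
  have := H 0 (index y v).+1 y isT iy; rewrite /= nth_index // eqxx => /eqP xE.
  by case/negP: xNu; rewrite xE mem_nth.
exists (g * tperm (g x) y)%g.
  apply: perm_onM => //; apply/subsetP=> z; rewrite inE.
  case: tpermP => [-> _|-> _|]; rewrite ?eqxx //.
    by rewrite perm_closed // uA ?inE ?eqxx.
  by rewrite vA ?inE ?eqxx.
rewrite permM tpermL; congr (_ :: _).
rewrite -[RHS]map_id -[in RHS]gu -map_comp.
apply/eq_in_map => z zu /=; rewrite permM tpermD //.
  by apply: contraNneq gxv => ->; rewrite -gu map_f.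
by apply: contraNneq yv => ->; rewrite -gu map_f.
Qed.

Lemma cycle_perm (y : seq 'I_m) : uniq y ->
  exists2 s : {perm 'I_m}, perm_on [set x in y] s &
    forall d e t, t < size y ->
      (s ^+ e)%g (nth d y t) = nth d y ((t + e) %% size y).
Proof.
move=> Uy; exists (perm (can_inj (prev_next Uy))).
  apply/subsetP=> x; rewrite !inE permE; apply: contraR => xNy.
  by rewrite next_nth (negPf xNy).
move=> d e t lt_t; have y0 : 0 < size y by lia.
elim: e => [|e IHe]; first by rewrite expg0 perm1 addn0 modn_small.
rewrite expgSr permM IHe permE next_nth mem_nth ?ltn_mod //.
case: y Uy {IHe} lt_t y0 => // a y Uy lt_t y0.
rewrite index_uniq ?ltn_mod //.
have -> : (t + e.+1) %% size (a :: y) = ((t + e) %% size (a :: y)).+1 %% size (a :: y).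
  by rewrite -[in RHS]addn1 modnDml addn1 addnS.
set p := (t + e) %% _; have : p < size (a :: y) by rewrite ltn_mod.
rewrite ltnS leq_eqVlt => /orP[/eqP->|lt_p].
  by rewrite modnn nth_default.
rewrite modn_small //= (set_nth_default d) //.
Qed.

(** Converse of [types_perm]. An [l]-cycle inside [A] has the wanted type; conjugation by a
    permutation of [A] carries its letters at positions 0, i, j, k to [a], [b], [c], [d],
    consistently because the equalities agree. *)
Lemma realize_type A (a b c d : 'I_m) i j k l :
  0 < l <= #|A| -> a \in A -> b \in A -> c \in A -> d \in A ->
  eq_type a b c d = mod_type i j k l ->
  exists2 s : {perm 'I_m}, perm_on A s &
    [/\ (s ^+ i)%g a = b, (s ^+ j)%g a = c & (s ^+ k)%g a = d].
Proof.
case/andP=> l0 lA aA bA cA dA tE; pose y := take l (enum A).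
have sy : size y = l by rewrite size_takel // -cardE.
have Uy : uniq y by rewrite take_uniq // enum_uniq.
have [s0 s0y s0E] := cycle_perm Uy.
have yA x : x \in y -> x \in A by move/mem_take; rewrite mem_enum.
pose p e := nth a y (e %% l).
have pA e : p e \in A by rewrite yA // mem_nth // sy ltn_mod.
have pE e f : (p e == p f) = (e %% l == f %% l).
  by rewrite nth_uniq ?sy ?ltn_mod.
have [||||g gA [ga gb gc gd]] := @extend_perm A [:: p 0; p i; p j; p k] [:: a; b; c; d].
- by [].
- by move=> x; rewrite !inE => /or4P[]/eqP->.
- by move=> x; rewrite !inE => /or4P[]/eqP->.
- have [e1 e2 e3 e4 e5 e6] := tE.
  have E : {in [:: 0; 1; 2; 3] &, forall x y,
     (nth a [:: p 0; p i; p j; p k] x == nth a [:: p 0; p i; p j; p k] y)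
     = (nth a [:: a; b; c; d] x == nth a [:: a; b; c; d] y)}.
    move=> x z; rewrite !inE => /or4P[]/eqP-> /or4P[]/eqP->; rewrite /= ?eqxx // !pE;
      by [rewrite ?e1 ?e2 ?e3 ?e4 ?e5 ?e6
         |rewrite [LHS]eq_sym [RHS]eq_sym ?e1 ?e2 ?e3 ?e4 ?e5 ?e6].
  move=> x z dd xs zs; rewrite ![nth dd _ _](set_nth_default a) //.
  by apply: E; rewrite -[[:: 0; 1; 2; 3]]/(iota 0 4) mem_iota.
exists (s0 ^ g)%g.
  apply/subsetP=> x; rewrite inE; apply: contraR => xA.
  have gx : g x = x by apply: (out_perm gA).
  rewrite -{1}gx permJ (out_perm s0y) ?gx //.
  by rewrite inE; apply: contra xA; apply: yA.
have sE e : ((s0 ^ g) ^+ e)%g a = g (p e).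
  rewrite -conjXg -ga permJ; congr (fun_of_perm _ _).
  by rewrite /p mod0n s0E ?sy // add0n.
by rewrite !sE.
Qed.

End Orbits.

(** * Certificates over the Thue-Morse word *)

Fixpoint thue_morse_rec d n : bool :=
  if d is d'.+1 then odd n (+) thue_morse_rec d' n./2 else false.

Definition thue_morse n := thue_morse_rec n n.

Lemma thue_morse_recE d n : n <= d -> thue_morse_rec d n = thue_morse n.
Proof.
rewrite /thue_morse; have [N] := ubnP d; elim: N d n => // N IHN d n ledN led.
case: n led => [|n] led; first by elim: d {ledN led} => //= d ->.
case: d ledN led => [|d] //= ledN led; congr addb.
by rewrite IHN; [rewrite [RHS]IHN; lia | lia | lia].
Qed.

Lemma thue_morse_half n : thue_morse n = odd n (+) thue_morse n./2.
Proof.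
case: n => // n; rewrite {1}/thue_morse /= thue_morse_recE //; lia.
Qed.

Lemma thue_morse_even n : thue_morse n.*2 = thue_morse n.
Proof. by rewrite thue_morse_half odd_double doubleK. Qed.

Lemma thue_morse_odd n : thue_morse n.*2.+1 = ~~ thue_morse n.
Proof. by rewrite thue_morse_half /= odd_double uphalf_double. Qed.

(** An even period halves on the even positions. An odd period transports the alternation of
    neighbours from even to odd positions; then the letters at 2p and 2p + 2 agree, so the letters p
    and p + 1 agree for p near a/2, which fails for even p. *)
Lemma thue_morse_pow4 a r : 0 < r ->
  ~ (forall x, x < 3 * r -> thue_morse (a + x) = thue_morse (a + x + r)).
Proof.
have [n] := ubnP r; elim: n r a => // n IHn r a lern r0 H.
have [re|ro] := boolP (odd r); last first.
  apply: (IHn r./2 (uphalf a)); [lia | lia|] => x lx.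
  rewrite -thue_morse_even -[RHS]thue_morse_even.
  have := H ((uphalf a + x).*2 - a); rewrite subnKC; last lia.
  have -> : (uphalf a + x).*2 + r = (uphalf a + x + r./2).*2 by lia.
  by apply; lia.
have Heq y : a <= y < a + 3 * r -> thue_morse y = thue_morse (y + r).
  by move=> /andP[ay yr]; have := H (y - a); rewrite subnKC //; apply; lia.
have neqE y : ~~ odd y -> thue_morse y.+1 = ~~ thue_morse y.
  move=> ey; have -> : y = y./2.*2 by lia.
  by rewrite thue_morse_odd thue_morse_even.
have [r1|r3] : r = 1 \/ 2 < r by case: (r) re r0 => [|[|[]]]; auto.
  rewrite r1 in Heq; have := neqE (uphalf a).*2; rewrite odd_double => /(_ isT).
  by rewrite -[in LHS]addn1 -Heq; [case: thue_morse | lia].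
have neqO y : a <= y -> y.+1 < a + 3 * r -> thue_morse y.+1 = ~~ thue_morse y.
  move=> ay yr; have [oy|] := boolP (odd y); last exact: neqE.
  by rewrite (Heq y) ?(Heq y.+1) ?addSn; [apply: neqE; lia | lia | lia].
have eqp p : a <= p.*2.+1 -> p.*2.+2 < a + 3 * r -> thue_morse p.+1 = thue_morse p.
  move=> ap pr; rewrite -thue_morse_even doubleS neqO // thue_morse_odd.
  by rewrite negbK.
have := neqE (uphalf a./2).*2; rewrite odd_double => /(_ isT).
by rewrite eqp; [case: thue_morse | lia | lia].
Qed.

(** A factor of length [(2 ^ d).+1] sits at offset 0 or 1 in the image of a factor one level
    lower. *)
Fixpoint tm_factors d : seq (seq bool) :=
  if d is d'.+1 then
    undup [seq take (2 ^ d).+1 (drop e (flatten [seq [:: x; ~~ x] | x <- f]))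
          | f <- tm_factors d', e <- [:: 0; 1]]
  else [:: [:: false; false]; [:: false; true]; [:: true; false]; [:: true; true]].

Lemma tm_factorsP d p : map thue_morse (iota p (2 ^ d).+1) \in tm_factors d.
Proof.
elim: d p => [|d IHd] p.
  by rewrite /=; case: (thue_morse p) (thue_morse p.+1) => [] [].
rewrite /tm_factors -/tm_factors mem_undup.
apply/allpairsPdep; exists (map thue_morse (iota p./2 (2 ^ d).+1)), (odd p : nat).
split=> //; first by case: odd.
have E a n : flatten [seq [:: x; ~~ x] | x <- map thue_morse (iota a n)]
    = map thue_morse (iota a.*2 n.*2).
  elim: n a => // n IHn a.
  by rewrite doubleS /= thue_morse_odd thue_morse_even IHn doubleS.
rewrite E -map_drop -map_take drop_iota take_iota.
congr (map _ (iota _ _)); first lia.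
by rewrite expnS; case: odd; lia.
Qed.

(** The two windows agree up to a renaming of letters; [pattern] is the canonical form under
    renaming. *)
Definition iso (w : nat -> nat) p p' n := forall s t, s < n -> t < n ->
  (w (p + s) == w (p + t)) = (w (p' + s) == w (p' + t)).

Lemma iso_sub w p p' n d n' : d + n' <= n -> iso w p p' n -> iso w (p + d) (p' + d) n'.
Proof. by move=> dn H s t sn tn; rewrite -!addnA; apply: H; lia. Qed.

Definition pattern (u : seq nat) := [seq index a u | a <- u].

Lemma eq_pattern (u v : seq nat) : size u = size v ->
  (forall s t, s < size u -> t < size u ->
     (nth 0 u s == nth 0 u t) = (nth 0 v s == nth 0 v t)) ->
  pattern u = pattern v.
Proof.
move=> sz H; apply: (@eq_from_nth _ 0); rewrite !size_map // => s ls.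
have ls' : s < size v by rewrite -sz.
rewrite !(nth_map 0) //; apply/eqP; rewrite eqn_leq; apply/andP; split.
  have vi : index (nth 0 v s) v < size u by rewrite sz index_mem mem_nth.
  have := H _ _ vi ls; rewrite nth_index ?mem_nth // eqxx => /eqP <-.
  exact: index_nth.
have ui : index (nth 0 u s) u < size u by rewrite index_mem mem_nth.
have := H _ _ ui ls; rewrite nth_index ?mem_nth // eqxx => /esym/eqP <-.
by rewrite index_nth -?sz.
Qed.

Definition column := (nat * nat * nat * nat)%type.

Definition columns (w : nat -> nat) p n e : seq column :=
  [seq (w (p + t), w (p + n + t), w (p + 2 * n + t), w (p + 3 * n + t))
      | t <- iota 0 (n + e)].

Section Certificate.

Variables (A B : seq nat) (q : nat).

Definition word_image (f : seq bool) : seq nat := flatten [seq if x then B else A | x <- f].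

Definition morphic_word n :=
  nth 0 (if thue_morse (n %/ q) then B else A) (n %% q).

(* Conditionals instead of boolean connectives, since [vm_compute] is strict. *)
Definition no_power_at e (adm : seq column -> bool) w n :=
  let u := pattern (take n w) in
  if u == pattern (take n (drop n w)) then
    if u == pattern (take n (drop (2 * n) w)) then
      if u == pattern (take n (drop (3 * n) w)) then
        ~~ adm (columns (nth 0 w) 0 n e)
      else true
    else true
  else true.

Definition no_short_power d e n0 adm :=
  all (fun f => let w := word_image f in
    all (fun b => let w' := drop b w in
      all (no_power_at e adm w') (iota 1 n0.-1)) (iota 0 q)) (tm_factors d).

(** Windows of length [n0] with the same pattern share their phase modulo [q]. Factors of five
    letters are long enough, as [q + n0 <= q * 5] is part of the certificate. *)
Definition synchronizing n0 :=
  let L := flatten [seq let w := word_image f in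
                        [seq (b, pattern (take n0 (drop b w))) | b <- iota 0 q]
                   | f <- tm_factors 2] in
  all (fun x => all (fun y => if x.1 == y.1 then true else x.2 != y.2) L) L.

(** [A] and [B] are told apart both by their first [h.+1] letters and by their letters from [h] on.
    A window of phase [b] can then read one Thue-Morse letter per [q] letters: from suffixes if
    [b <= h], from prefixes if [h < b]. *)
Definition decodable h :=
  if pattern (take h.+1 A) == pattern (take h.+1 B) then false
  else pattern (drop h A) != pattern (drop h B).

(** [adm] stands for a necessary condition on the columns of an instance, [e] counts columns beyond
    the period, and [n0] separates short periods, which are enumerated, from long ones, which
    synchronise. The length bounds make every inspected window fit into the image of a listed
    factor. *)
Definition certificate d e n0 h adm :=
  [&& 0 < q, size A == q, size B == q, h < q, 0 < n0, q + n0 <= q * 5,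
      q + 4 * n0 + e <= q * (2 ^ d).+1, decodable h, synchronizing n0
    & no_short_power d e n0 adm].

Hypotheses (q_gt0 : 0 < q) (sA : size A = q) (sB : size B = q).

Lemma size_word_image f : size (word_image f) = q * size f.
Proof. by elim: f => [|x f IHf]; rewrite ?muln0 //= size_cat -/(word_image f) IHf mulnS; case: x; rewrite ?sA ?sB. Qed.

Lemma nth_word_image p K x : x < q * K ->
  nth 0 (word_image (map thue_morse (iota p K))) x = morphic_word (q * p + x).
Proof.
elim: K p x => [|K IHK] p x; first by rewrite muln0.
rewrite mulnS /word_image /= nth_cat -/(word_image _) => lx.
have -> : size (if thue_morse p then B else A) = q by case: ifP.
have [ltx|lex] := ltnP x q.
  by rewrite /morphic_word mulnC divnMDl // modnMDl divn_small // modn_small // addn0.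
rewrite IHK; last lia.
by congr morphic_word; lia.
Qed.

Lemma image_window d p b n t : b + n <= q * (2 ^ d).+1 -> t < n ->
  nth 0 (take n (drop b (word_image (map thue_morse (iota p (2 ^ d).+1))))) t
  = morphic_word (q * p + b + t).
Proof. by move=> bn tn; rewrite nth_take // nth_drop nth_word_image ?addnA; lia. Qed.

Lemma size_window d p b n : b + n <= q * (2 ^ d).+1 ->
  size (take n (drop b (word_image (map thue_morse (iota p (2 ^ d).+1))))) = n.
Proof.
by move=> bn; rewrite size_takel // size_drop size_word_image size_map size_iota; lia.
Qed.

Lemma iso_pattern d d' p p' b b' n :
  b + n <= q * (2 ^ d).+1 -> b' + n <= q * (2 ^ d').+1 ->
  iso morphic_word (q * p + b) (q * p' + b') n ->
  pattern (take n (drop b (word_image (map thue_morse (iota p (2 ^ d).+1))))) =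
  pattern (take n (drop b' (word_image (map thue_morse (iota p' (2 ^ d').+1))))).
Proof.
move=> bn bn' H; apply: eq_pattern => [|s t]; rewrite !size_window // => sn tn.
by rewrite !image_window //; apply: H.
Qed.

(** The parameter [h'] selects the available test of [decodable]: the prefix if it is [h.+1], the
    suffix otherwise. *)
Lemma eq_block h h' x y : decodable h -> h < q -> h' <= h.+1 ->
  (h' = h.+1 -> iso morphic_word (q * x) (q * y) h.+1) ->
  (h' <= h -> iso morphic_word (q * x + h) (q * y + h) (q - h)) ->
  thue_morse x = thue_morse y.
Proof.
have mE z t : t < q -> morphic_word (q * z + t) = nth 0 (if thue_morse z then B else A) t.
  by move=> tq; rewrite /morphic_word mulnC divnMDl // modnMDl divn_small // modn_small // addn0.
rewrite /decodable => dec hq hh H1 H2; apply/eqP/negPn/negP => neq.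
move: dec; case: ifP => // /negP C1 /negP C2.
have [E|E] : h' = h.+1 \/ h' <= h by lia.
- apply: C1; apply/eqP; have {}H1 := H1 E.
  have iAB : forall s t, s < h.+1 -> t < h.+1 ->
      (nth 0 A s == nth 0 A t) = (nth 0 B s == nth 0 B t).
    move=> s t ls lt; have := H1 s t ls lt; rewrite !mE; try lia.
  apply: eq_pattern => [|s t]; rewrite !size_takel ?sA ?sB // => ls lt.
  by rewrite !nth_take //; apply: iAB.
- apply: C2; apply/eqP; have {}H2 := H2 E.
  have iAB : forall s t, s < q - h -> t < q - h ->
      (nth 0 A (h + s) == nth 0 A (h + t)) = (nth 0 B (h + s) == nth 0 B (h + t)).
    move=> s t ls lt; have := H2 s t ls lt; rewrite -!addnA !mE; try lia.
  apply: eq_pattern => [|s t]; rewrite !size_drop ?sA ?sB // => ls lt.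
  by rewrite !nth_drop; apply: iAB.
Qed.

End Certificate.

(** Short periods fail by enumeration. For [n >= n0] the equal patterns of the first two blocks
    force [q] to divide [n], and decoding turns the four blocks into a fourth power of period
    [n / q] in the Thue-Morse word. *)
Theorem certificateP A B q d e n0 h adm : certificate A B q d e n0 h adm ->
  forall N n, 0 < n ->
    iso (morphic_word A B q) N (N + n) n ->
    iso (morphic_word A B q) N (N + 2 * n) n ->
    iso (morphic_word A B q) N (N + 3 * n) n ->
    ~~ adm (columns (morphic_word A B q) N n e).
Proof.
case/and5P=> q0 /eqP sA /eqP sB hq /and5P[n00 q5 qd dec /andP[syn nsp]] N n n1 i1 i2 i3.
set w := morphic_word A B q in i1 i2 i3 *.
have NE := divn_eq N q; set p := N %/ q in NE; set b := N %% q in NE.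
have bq : b < q by rewrite ltn_mod.
have {}NE : N = q * p + b by rewrite mulnC.
have [ltn|len] := ltnP n n0.
  have := allP nsp _ (tm_factorsP d p).
  have bi : b \in iota 0 q by rewrite mem_iota.
  have ni : n \in iota 1 n0.-1 by rewrite mem_iota; lia.
  move=> /allP/(_ b bi)/allP/(_ n ni); rewrite /no_power_at.
  set f := map _ _.
  have pE c : c <= 3 -> iso w N (N + c * n) n ->
      pattern (take n (drop b (word_image A B f)))
      = pattern (take n (drop (c * n) (drop b (word_image A B f)))).
    move=> c3 ic; rewrite drop_drop; apply: (iso_pattern q0 sA sB); try nia.
    by rewrite -NE [c * n + b]addnC addnA -NE.
  have E1 := pE 1 isT; rewrite !mul1n in E1.
  rewrite -(E1 i1) eqxx -(pE 2 isT i2) eqxx -(pE 3 isT i3) eqxx.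
  suff -> : columns (nth 0 (drop b (word_image A B f))) 0 n e = columns w N n e by [].
  rewrite /columns; apply/eq_in_map => t; rewrite mem_iota add0n /= => tn.
  rewrite !nth_drop !(nth_word_image q0 sA sB); try nia.
  by rewrite NE !addnA ?add0n !addn0.
exfalso.
have bE : b = (N + n) %% q.
  pose x := (b, pattern (take n0 (drop b (word_image A B (map thue_morse (iota p (2 ^ 2).+1)))))).
  pose b' := (N + n) %% q; pose p' := (N + n) %/ q.
  pose y := (b', pattern (take n0 (drop b' (word_image A B (map thue_morse (iota p' (2 ^ 2).+1)))))).
  have b'q : b' < q by rewrite ltn_mod.
  have inL z c : c < q -> (c, pattern (take n0 (drop c (word_image A B (map thue_morse (iota z (2 ^ 2).+1)))))) \in
     flatten [seq let w := word_image A B f in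
                        [seq (b, pattern (take n0 (drop b w))) | b <- iota 0 q]
                   | f <- tm_factors 2].
    move=> cq; apply/flatten_mapP; exists (map thue_morse (iota z (2 ^ 2).+1)); first exact: tm_factorsP.
    by apply/mapP; exists c; rewrite // mem_iota.
  have Exy : x.2 = y.2.
    apply: (iso_pattern q0 sA sB); try (by rewrite (_ : (2 ^ 2).+1 = 5) //; lia).
    rewrite -NE (_ : q * p' + b' = N + n); last by rewrite /p' /b' [RHS](divn_eq (N + n) q) mulnC.
    by move=> s t sn tn; apply: i1; lia.
  have := allP (allP syn x (inL p b bq)) y (inL p' b' b'q).
  by rewrite Exy eqxx; case: eqP.
have /dvdnP[r nE] : q %| n.
  have := eqn_mod_dvd q (leq_addr n N); rewrite addKn => <-.
  by rewrite -bE.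
have r0 : 0 < r by case: r nE => //; lia.
(* The first decodable block has index [p], or [p.+1] when [h < b]; [c] numbers the three pairs of
   adjacent blocks of the power. *)
have blk c x : c < 3 -> x < r ->
    thue_morse (p + (h < b) + x + c * r) = thue_morse (p + (h < b) + x + c * r + r).
  move=> c3 xr.
  have iso_c : iso w (N + c * n) (N + c * n + n) n.
    have i0 : iso w N (N + 0 * n) n by rewrite addn0.
    move=> s t sn tn.
    have H c' : c' <= 3 -> (w (N + s) == w (N + t)) = (w (N + c' * n + s) == w (N + c' * n + t)).
      by case: c' => [|[|[|[|//]]]] _; rewrite ?mul0n ?addn0 ?mul1n; [|apply: i1|apply: i2|apply: i3].
    by rewrite -(H c) 1?ltnW // (H c.+1) // mulSn [n + _]addnC addnA.
  apply: (@eq_block A B q q0 sA sB h (if h < b then h.+1 else h) _ _ dec hq); first by case: ifP.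
  - case: ifP => [hb _|]; last lia.
    have := @iso_sub w _ _ n (q * x.+1 - b) h.+1 _ iso_c.
    have xq : q * x.+1 <= n by rewrite nE mulnC leq_mul2r xr orbT.
    have -> : N + c * n + (q * x.+1 - b) = q * (p + true + x + c * r) by lia.
    have -> : N + c * n + n + (q * x.+1 - b) = q * (p + true + x + c * r + r) by lia.
    by apply; lia.
  - case: ifP => [hb|/negbT hb _]; first lia.
    have := @iso_sub w _ _ n (q * x + (h - b)) (q - h) _ iso_c.
    have xq : q * x.+1 <= n by rewrite nE mulnC leq_mul2r xr orbT.
    have -> : N + c * n + (q * x + (h - b)) = q * (p + false + x + c * r) + h by lia.
    have -> : N + c * n + n + (q * x + (h - b)) = q * (p + false + x + c * r + r) + h by lia.
    by apply; lia.
apply: (@thue_morse_pow4 (p + (h < b)) r r0) => x x3.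
have -> : p + (h < b) + x = p + (h < b) + x %% r + x %/ r * r by have := divn_eq x r; lia.
by apply: blk; rewrite ?ltn_mod // ltn_divLR.
Qed.

(** * Columns of an occurrence *)

Definition entry (c : column) r :=
  match r with 0 => c.1.1.1 | 1 => c.1.1.2 | 2 => c.1.2 | _ => c.2 end.

Definition column_type (c : column) :=
  eq_type (entry c 0) (entry c 1) (entry c 2) (entry c 3).

(* The powers of one permutation commute: where the columns determine both
   F (G a) and G (F a), for F mapping entry r to entry s of a column and
   G mapping entry r' to entry s', the two values must agree. *)
Definition commuting (cols : seq column) :=
  let cs := undup cols in
  all (fun c => all (fun r => all (fun s => all (fun d => all (fun r' =>
    if entry d r' == entry c r then
      all (fun e => if entry e r' == entry c s then
        all (fun f => all (fun s' => if entry f r == entry d s' then entry e s' == entry f s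
                                     else true) (iota 0 4)) cs
        else true) cs
    else true) (iota 0 4)) cs) (iota 0 4)) (iota 0 4)) cs.

Section Columns.

Variables (i j k m : nat).
Implicit Types (s : {perm 'I_m}) (w : nat -> 'I_m).

Definition vals w : nat -> nat := fun t => w t.

Lemma occurs_iso w s N n l : occurs i j k w s N n l ->
  [/\ iso (vals w) N (N + n) l, iso (vals w) N (N + 2 * n) l &
      iso (vals w) N (N + 3 * n) l].
Proof.
move=> occ; split=> x y xl yl; have [x1 x2 x3] := occ x xl; have [y1 y2 y3] := occ y yl.
- by rewrite /vals x1 y1 !(inj_eq val_inj) (inj_eq perm_inj).
- by rewrite /vals x2 y2 !(inj_eq val_inj) (inj_eq perm_inj).
- by rewrite /vals x3 y3 !(inj_eq val_inj) (inj_eq perm_inj).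
Qed.

Definition exponent r := match r with 0 => 0 | 1 => i | 2 => j | _ => k end.

Lemma occurs_column w s N n e c : occurs i j k w s N n (n + e) ->
  c \in columns (vals w) N n e ->
  exists2 t, t < n + e & forall r, r < 4 -> entry c r = (s ^+ exponent r)%g (w (N + t)) :> nat.
Proof.
move=> occ /mapP[t]; rewrite mem_iota add0n /= => tl ->; exists t => //.
have [x1 x2 x3] := occ t tl.
by case=> [|[|[|[|//]]]] _ /=; rewrite ?expg0 ?perm1 -?x1 -?x2 -?x3.
Qed.

Lemma occurs_column_type w s N n e c : occurs i j k w s N n (n + e) ->
  c \in columns (vals w) N n e -> types i j k m (column_type c).
Proof.
move=> occ cc; have [t tl cE] := occurs_column occ cc.
rewrite /column_type !cE //= expg0 perm1.
by rewrite (eq_type_inj _ _ _ _ val_inj); apply: types_perm.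
Qed.

Lemma occurs_commuting w s N n e : occurs i j k w s N n (n + e) ->
  commuting (columns (vals w) N n e).
Proof.
move=> occ; rewrite /commuting; apply/allP => c; rewrite mem_undup => cc.
have [tc _ cE] := occurs_column occ cc.
apply/allP => r; rewrite mem_iota => /andP[_ r4].
apply/allP => x; rewrite mem_iota => /andP[_ x4].
apply/allP => d; rewrite mem_undup => dd.
have [td _ dE] := occurs_column occ dd.
apply/allP => r'; rewrite mem_iota => /andP[_ r4'].
case: eqP => // e1; apply/allP => e'; rewrite mem_undup => ee.
have [te _ eE] := occurs_column occ ee.
case: eqP => // e2; apply/allP => f; rewrite mem_undup => ff.
have [tf _ fE] := occurs_column occ ff.
apply/allP => x'; rewrite mem_iota => /andP[_ x4'].
case: eqP => // e3; apply/eqP.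
move: e1 e2 e3; rewrite !cE // !dE // !eE // !fE // => /val_inj e1 /val_inj e2 /val_inj e3.
(* The map from entry [r] to entry [x] is a power of [s] with a possibly negative exponent; applying
   the powers of rows [r] and [r'] to both sides leaves natural exponents only. *)
congr nat_of_ord; apply: (@perm_inj _ (s ^+ exponent r)%g); apply: (@perm_inj _ (s ^+ exponent r')%g).
move: (exponent r) (exponent x) (exponent r') (exponent x') e1 e2 e3 => a b a' b' e1 e2 e3.
have P y z v : (s ^+ y)%g ((s ^+ z)%g v) = (s ^+ (z + y))%g v by rewrite -permM -expgD.
rewrite !P (_ : b' + (a + a') = a' + (b' + a)) 1?(_ : b + (a + a') = a + (b + a')); try lia.
rewrite -(P _ a' (w (N + te))) e2 -(P _ a (w (N + tf))) e3 !P.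
rewrite (_ : b' + (b + a') = a' + (b + b')); last lia.
rewrite -(P _ a' (w (N + td))) e1 !P; congr (fun_of_perm (s ^+ _)%g _); lia.
Qed.

End Columns.

(** * Avoiding words from certificates *)

Definition letters_lt c (A B : seq nat) := all (fun a => a < c) (A ++ B).

Lemma morphic_word_lt c A B q n : 0 < q -> size A = q -> size B = q ->
  letters_lt c A B -> morphic_word A B q n < c.
Proof.
move=> q0 sA sB /allP lt; apply: lt; rewrite /morphic_word mem_cat.
by case: ifP => _; rewrite mem_nth ?orbT // ?sA ?sB ltn_mod.
Qed.

Definition ord_word m0 (w : nat -> nat) : nat -> 'I_m0.+1 := fun t => inord (w t).

Definition avoids_types (G : seq (seq bool)) (cols : seq column) :=
  if all (fun c => column_type c \notin G) cols then commuting cols else false.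

(** [cG]: representatives of the types that must be missing; [cc]: alphabet size; [cA], [cB]: images
    of the two Thue-Morse letters; [cd]: level of the factors inspected; [cn]: bound below which
    periods are enumerated; [ch]: cut for decoding. *)
Record cert := Cert
  { cG : seq (seq nat); cc : nat; cA : seq nat; cB : seq nat; cd : nat; cn : nat; ch : nat }.

Definition type_of (x : seq nat) := if x is [:: a; b; c; d] then eq_type a b c d else [::].

Definition cert_types c := map type_of (cG c).

Definition cert_ok c :=
  letters_lt (cc c) (cA c) (cB c) &&
  certificate (cA c) (cB c) (size (cA c)) (cd c) 0 (cn c) (ch c) (avoids_types (cert_types c)).

Lemma vals_ord_word m0 (w : nat -> nat) : (forall t, w t < m0.+1) -> vals (ord_word m0 w) =1 w.
Proof. by move=> wm t; rewrite /vals /ord_word inordK. Qed.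

Lemma cert_word_avoids i j k m c : cert_ok c -> cc c <= m.+1 ->
  (forall tau, tau \in cert_types c -> ~~ types i j k m.+1 tau) ->
  forall s N n, 0 < n -> ~ occurs i j k
     (ord_word m (morphic_word (cA c) (cB c) (size (cA c)))) s N n n.
Proof.
case/andP=> ltc crt cm Gm s N n n0 occ.
have /and4P[q0 sA sB _] := crt.
have wc := morphic_word_lt _ q0 (eqP sA) (eqP sB) ltc.
set w := morphic_word _ _ _ in wc occ.
have wE : vals (ord_word m w) =1 w by apply: vals_ord_word => t; apply: leq_trans cm.
have [i1 i2 i3] := occurs_iso occ.
have isoE p p' : iso (vals (ord_word m w)) p p' n -> iso w p p' n.
  by move=> H x y xn yn; have := H x y xn yn; rewrite !wE.
have := certificateP crt n0 (isoE _ _ i1) (isoE _ _ i2) (isoE _ _ i3).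
rewrite -[n in occurs _ _ _ _ _ _ _ n]addn0 in occ.
have -> : columns w N n 0 = columns (vals (ord_word m w)) N n 0.
  by apply: eq_map => t; rewrite !wE.
rewrite /avoids_types (occurs_commuting occ). case: allP => // H _; apply: H => x xc.
by apply: contraL (occurs_column_type occ xc) => /Gm.
Qed.

Lemma cert_gt0 c : cert_ok c -> 0 < cc c.
Proof.
case/and3P=> ltc q0 /and3P[/eqP sA /eqP sB _].
by apply: leq_ltn_trans (morphic_word_lt 0 q0 sA sB ltc).
Qed.

Lemma cert_avoidable i j k m c : cert_ok c -> cc c <= m ->
  (forall tau, tau \in cert_types c -> ~~ types i j k m tau) -> avoidable i j k m.
Proof.
move=> crt cm Gm; have m0 := leq_trans (cert_gt0 crt) cm.
case: m m0 cm Gm => // m _ cm Gm; apply/avoidable_occurs.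
by exists (ord_word m (morphic_word (cA c) (cB c) (size (cA c)))); apply: cert_word_avoids.
Qed.

(** * Certificate data, verified by evaluation *)

Definition cert0 := Cert [:: [:: 0; 0; 1; 0]; [:: 0; 1; 0; 0]; [:: 0; 1; 0; 2]; [:: 0; 1; 1; 2]; [:: 0; 1; 2; 1]] 4
    [:: 0; 1; 0; 2; 0; 0; 3; 0; 0; 2]
    [:: 0; 1; 0; 3; 0; 1; 0; 0; 2; 0] 4 22 6.
Lemma cert0_ok : cert_ok cert0.
Proof. by vm_compute. Qed.

Definition cert1 := Cert [:: [:: 0; 0; 0; 1]; [:: 0; 0; 1; 1]; [:: 0; 1; 1; 0]; [:: 0; 1; 1; 1]] 4
    [:: 0; 0; 1; 1; 1; 2; 2; 2; 0; 0; 0; 3; 3; 0; 0; 0; 3; 3; 0; 0; 0; 1; 1; 1]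
    [:: 0; 0; 0; 3; 3; 0; 0; 0; 2; 2; 2; 3; 3; 2; 2; 2; 0; 0; 2; 2; 2; 1; 1; 1] 2 21 3.
Lemma cert1_ok : cert_ok cert1.
Proof. by vm_compute. Qed.

Definition cert2 := Cert [:: [:: 0; 0; 0; 1]; [:: 0; 0; 1; 1]; [:: 0; 1; 1; 1]; [:: 0; 1; 1; 2]] 3
    [:: 0; 1; 1; 2; 2; 2; 1; 1; 0; 0; 0; 2; 2; 2; 0; 0]
    [:: 0; 1; 1; 2; 2; 2; 0; 0; 0; 2; 2; 2; 1; 1; 0; 0] 4 36 7.
Lemma cert2_ok : cert_ok cert2.
Proof. by vm_compute. Qed.

Definition cert3 := Cert [:: [:: 0; 0; 1; 1]; [:: 0; 0; 1; 2]; [:: 0; 1; 1; 0]; [:: 0; 1; 2; 2]] 4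
    [:: 0; 0; 1; 1; 0; 2; 2; 0; 0; 2; 1; 1; 2; 0; 0; 2; 2; 0; 3; 3; 0; 1; 1; 0; 0; 1; 2; 2; 1]
    [:: 1; 2; 0; 0; 2; 1; 1; 2; 2; 1; 3; 3; 1; 0; 0; 1; 1; 0; 3; 3; 0; 1; 1; 0; 0; 1; 2; 2; 1] 2 28 2.
Lemma cert3_ok : cert_ok cert3.
Proof. by vm_compute. Qed.

Definition cert4 := Cert [:: [:: 0; 0; 1; 0]; [:: 0; 1; 0; 0]; [:: 0; 1; 0; 2]; [:: 0; 1; 1; 0]; [:: 0; 1; 2; 1]] 3
    [:: 0; 1; 0; 2; 0; 1; 0; 0; 1; 0]
    [:: 2; 0; 0; 2; 0; 0; 2; 0; 1; 0] 3 19 3.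
Lemma cert4_ok : cert_ok cert4.
Proof. by vm_compute. Qed.

Definition cert5 := Cert [:: [:: 0; 1; 0; 2]; [:: 0; 1; 2; 0]; [:: 0; 1; 2; 1]] 3
    [:: 0; 1; 2; 0; 2; 1; 2]
    [:: 0; 1; 2; 1; 0; 1; 2] 4 19 4.
Lemma cert5_ok : cert_ok cert5.
Proof. by vm_compute. Qed.

Definition cert6 := Cert [:: [:: 0; 0; 1; 2]; [:: 0; 1; 1; 0]; [:: 0; 1; 2; 0]; [:: 0; 1; 2; 2]] 3
    [:: 0; 1; 1; 0; 2; 2; 0; 1; 2; 0; 0; 2; 1; 0; 2; 1; 0; 0; 1; 2]
    [:: 0; 1; 1; 0; 2; 1; 1; 2; 0; 1; 2; 2; 1; 0; 2; 1; 0; 0; 1; 2] 2 15 6.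
Lemma cert6_ok : cert_ok cert6.
Proof. by vm_compute. Qed.

Definition cert7 := Cert [:: [:: 0; 0; 1; 2]; [:: 0; 1; 0; 2]; [:: 0; 1; 1; 0]; [:: 0; 1; 2; 1]; [:: 0; 1; 2; 2]] 4
    [:: 0; 1; 0; 2; 2; 0; 3; 3; 0; 2; 2; 0; 3; 0; 2; 2]
    [:: 0; 3; 3; 0; 2; 0; 1; 1; 0; 2; 0; 1; 1; 0; 2; 2] 2 16 3.
Lemma cert7_ok : cert_ok cert7.
Proof. by vm_compute. Qed.

Definition cert8 := Cert [:: [:: 0; 0; 0; 1]; [:: 0; 0; 1; 0]; [:: 0; 1; 0; 2]; [:: 0; 1; 1; 1]; [:: 0; 1; 2; 2]] 4
    [:: 0; 1; 1; 1; 2; 1; 3; 3; 3; 1; 3; 0; 0; 0; 2; 0; 3; 3; 3; 2; 3; 0; 0; 0; 2]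
    [:: 0; 3; 3; 3; 0; 3; 1; 1; 1; 0; 1; 3; 3; 3; 2; 3; 1; 1; 1; 3; 1; 0; 0; 0; 2] 2 21 5.
Lemma cert8_ok : cert_ok cert8.
Proof. by vm_compute. Qed.

Definition cert9 := Cert [:: [:: 0; 0; 1; 2]; [:: 0; 1; 0; 0]; [:: 0; 1; 1; 2]; [:: 0; 1; 2; 1]] 4
    [:: 0; 1; 1; 2; 3; 2; 2; 0; 3; 0; 0; 2; 1; 2; 2; 3; 0; 3; 3; 1]
    [:: 0; 1; 1; 2; 0; 2; 2; 1; 3; 1; 1; 0; 2; 0; 0; 3; 2; 3; 3; 1] 4 44 5.
Lemma cert9_ok : cert_ok cert9.
Proof. by vm_compute. Qed.

Definition cert10 := Cert [:: [:: 0; 0; 1; 0]; [:: 0; 1; 0; 0]; [:: 0; 1; 0; 1]; [:: 0; 1; 1; 2]] 4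
    [:: 0; 0; 1; 0; 1; 0; 0; 2; 0; 0; 1; 0; 1; 1; 3; 1; 1; 2; 1; 2; 2; 3; 2; 2; 0; 2; 0; 0; 3]
    [:: 0; 0; 2; 0; 2; 0; 0; 1; 0; 0; 3; 0; 3; 3; 2; 3; 3; 1; 3; 1; 1; 2; 1; 1; 0; 1; 0; 0; 3] 2 20 11.
Lemma cert10_ok : cert_ok cert10.
Proof. by vm_compute. Qed.

Definition cert11 := Cert [:: [:: 0; 0; 0; 1]; [:: 0; 0; 1; 2]; [:: 0; 1; 1; 1]; [:: 0; 1; 2; 2]] 4
    [:: 0; 1; 1; 1; 2; 0; 0; 0; 2; 3; 3; 3; 2; 1; 1; 1; 3; 2; 2; 2]
    [:: 1; 3; 3; 3; 0; 2; 2; 2; 3; 1; 1; 1; 3; 0; 0; 0; 3; 2; 2; 2] 2 17 6.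
Lemma cert11_ok : cert_ok cert11.
Proof. by vm_compute. Qed.

Definition cert12 := Cert [:: [:: 0; 0; 1; 0]; [:: 0; 0; 1; 1]; [:: 0; 1; 0; 0]; [:: 0; 1; 1; 2]] 4
    [:: 0; 0; 1; 0; 0; 2; 2; 3; 2; 2; 1; 1; 3; 1; 1; 0; 0; 2]
    [:: 0; 0; 1; 1; 2; 1; 1; 3; 3; 2; 3; 3; 1; 3; 3; 0; 0; 2] 2 18 4.
Lemma cert12_ok : cert_ok cert12.
Proof. by vm_compute. Qed.

Definition cert13 := Cert [:: [:: 0; 0; 1; 0]; [:: 0; 1; 0; 0]; [:: 0; 1; 0; 1]; [:: 0; 1; 1; 0]] 2
    [:: 0; 1; 0; 1; 0; 0; 1; 0; 0; 1; 0; 1; 1; 0; 1; 1; 0; 1; 0; 0; 1; 0]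
    [:: 0; 1; 0; 1; 1; 0; 1; 1; 0; 1; 0; 1; 1; 0; 1; 1; 0; 1; 0; 0; 1; 0] 4 56 5.
Lemma cert13_ok : cert_ok cert13.
Proof. by vm_compute. Qed.

Definition cert14 := Cert [:: [:: 0; 0; 0; 1]; [:: 0; 0; 1; 2]; [:: 0; 1; 0; 0]; [:: 0; 1; 1; 1]; [:: 0; 1; 2; 1]] 4
    [:: 0; 0; 1; 2; 1; 1; 1; 3; 2; 3; 3; 3; 1; 0; 1; 1; 1; 2; 3; 2; 2; 2; 0; 3; 0]
    [:: 0; 0; 1; 2; 1; 1; 1; 0; 2; 0; 0; 0; 3; 1; 3; 3; 3; 2; 1; 2; 2; 2; 0; 3; 0] 2 25 8.
Lemma cert14_ok : cert_ok cert14.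
Proof. by vm_compute. Qed.

Definition cert15 := Cert [:: [:: 0; 0; 1; 0]; [:: 0; 1; 0; 2]; [:: 0; 1; 1; 2]; [:: 0; 1; 2; 2]] 4
    [:: 0; 1; 2; 2; 3; 2; 0; 0; 1; 0; 3; 3; 1; 3; 2; 2; 1; 2; 0; 0; 3; 0; 2; 2; 3; 2; 1; 1]
    [:: 3; 1; 2; 2; 0; 2; 3; 3; 0; 3; 1; 1; 0; 1; 2; 2; 3; 2; 0; 0; 3; 0; 2; 2; 3; 2; 1; 1] 2 21 9.
Lemma cert15_ok : cert_ok cert15.
Proof. by vm_compute. Qed.

Definition cert16 := Cert [:: [:: 0; 0; 1; 2]; [:: 0; 1; 1; 2]; [:: 0; 1; 2; 2]] 4
    [:: 0; 0; 1; 2; 2; 3; 0; 0; 2; 1; 1; 3; 2; 2; 1; 3; 3; 2; 0; 0; 1; 2; 2; 3; 0; 0; 2; 3; 3; 1; 0; 0; 3; 1; 1; 0; 3; 3; 2; 1; 1; 3; 0; 0; 2; 3; 3; 1; 0; 0; 3; 1; 1; 2]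
    [:: 0; 0; 1; 2; 2; 0; 1; 1; 3; 0; 0; 2; 1; 1; 0; 3; 3; 1; 0; 0; 3; 1; 1; 2; 0; 0; 1; 2; 2; 3; 0; 0; 2; 3; 3; 0; 2; 2; 1; 3; 3; 2; 1; 1; 0; 3; 3; 1; 0; 0; 3; 1; 1; 2] 2 38 6.
Lemma cert16_ok : cert_ok cert16.
Proof. by vm_compute. Qed.

Definition cert17 := Cert [:: [:: 0; 0; 1; 0]; [:: 0; 0; 1; 2]; [:: 0; 1; 0; 2]; [:: 0; 1; 1; 0]; [:: 0; 1; 2; 2]] 4
    [:: 0; 1; 1; 0; 2; 2; 0; 2; 1; 1; 2; 0; 0; 2; 0; 1; 1; 0; 3; 3]
    [:: 0; 2; 2; 0; 2; 1; 1; 2; 3; 3; 2; 1; 1; 2; 0; 0; 2; 0; 3; 3] 2 19 4.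
Lemma cert17_ok : cert_ok cert17.
Proof. by vm_compute. Qed.

Definition cert18 := Cert [:: [:: 0; 0; 0; 1]; [:: 0; 0; 1; 1]; [:: 0; 0; 1; 2]; [:: 0; 1; 0; 0]; [:: 0; 1; 0; 1]; [:: 0; 1; 0; 2]; [:: 0; 1; 1; 0]; [:: 0; 1; 1; 1]; [:: 0; 1; 1; 2]; [:: 0; 1; 2; 0]; [:: 0; 1; 2; 1]; [:: 0; 1; 2; 2]; [:: 0; 1; 2; 3]] 2
    [:: 0; 1; 1; 0; 0; 0; 1; 1; 0; 0; 1; 1; 0; 0; 0; 1; 1; 0; 0; 1; 1; 0]
    [:: 0; 1; 1; 0; 0; 0; 1; 1; 1; 0; 0; 0; 1; 1; 1; 0; 0; 1; 1; 1; 0; 0] 2 20 8.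
Lemma cert18_ok : cert_ok cert18.
Proof. by vm_compute. Qed.

Definition cert19 := Cert [:: [:: 0; 0; 1; 0]; [:: 0; 1; 0; 2]; [:: 0; 1; 1; 0]; [:: 0; 1; 2; 1]; [:: 0; 1; 2; 2]] 5
    [:: 0; 0; 1; 0; 2; 0; 3; 0; 2; 0; 1; 0; 2; 2; 0; 2; 4; 4; 2; 4; 1; 4; 0; 4; 1; 1; 4; 1]
    [:: 0; 1; 3; 1; 0; 1; 2; 1; 0; 0; 1; 0; 4; 4; 0; 4; 3; 4; 0; 0; 4; 0; 1; 1; 0; 1; 2; 1] 2 20 1.
Lemma cert19_ok : cert_ok cert19.
Proof. by vm_compute. Qed.

Definition cert20 := Cert [:: [:: 0; 0; 1; 0]; [:: 0; 0; 1; 2]; [:: 0; 1; 0; 0]; [:: 0; 1; 1; 0]; [:: 0; 1; 2; 1]] 4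
    [:: 0; 1; 1; 0; 1; 1; 0; 2; 0; 0; 2; 0; 0; 2; 3; 2; 2; 3; 2; 2; 3; 2; 2; 3; 1; 3; 3; 1; 0; 1; 1]
    [:: 0; 1; 1; 0; 1; 1; 0; 3; 0; 0; 3; 2; 3; 3; 2; 3; 3; 2; 3; 3; 2; 1; 2; 2; 1; 2; 2; 1; 0; 1; 1] 3 60 11.
Lemma cert20_ok : cert_ok cert20.
Proof. by vm_compute. Qed.

Definition cert21 := Cert [:: [:: 0; 0; 1; 0]; [:: 0; 0; 1; 1]; [:: 0; 1; 0; 2]; [:: 0; 1; 1; 0]; [:: 0; 1; 2; 2]] 5
    [:: 0; 1; 1; 0; 1; 2; 2; 1; 1; 2; 1; 3; 3; 1; 3; 0; 0; 3; 3; 0; 3; 2; 2; 3; 3; 2; 3; 1; 1; 3; 1; 2; 2; 1; 1; 2; 1; 0]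
    [:: 0; 1; 0; 2; 2; 0; 0; 2; 0; 1; 1; 0; 0; 1; 0; 3; 3; 0; 3; 4; 4; 3; 4; 0; 0; 4; 0; 1; 1; 0; 1; 4; 4; 1; 1; 4; 1; 0] 2 25 2.
Lemma cert21_ok : cert_ok cert21.
Proof. by vm_compute. Qed.

Definition cert22 := Cert [:: [:: 0; 0; 0; 1]; [:: 0; 0; 1; 0]; [:: 0; 0; 1; 1]; [:: 0; 0; 1; 2]; [:: 0; 1; 0; 0]; [:: 0; 1; 0; 1]; [:: 0; 1; 0; 2]; [:: 0; 1; 1; 1]; [:: 0; 1; 1; 2]; [:: 0; 1; 2; 0]; [:: 0; 1; 2; 1]; [:: 0; 1; 2; 2]; [:: 0; 1; 2; 3]] 2
    [:: 0; 1; 1; 1; 0; 0; 0; 1; 0; 1; 1; 1; 0; 1; 1; 1; 0; 1; 1; 1; 0; 0]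
    [:: 0; 1; 0; 0; 0; 1; 1; 1; 0; 0; 0; 1; 0; 1; 1; 1; 0; 0; 0; 1; 1; 1] 3 36 2.
Lemma cert22_ok : cert_ok cert22.
Proof. by vm_compute. Qed.

Definition cert23 := Cert [:: [:: 0; 0; 0; 1]; [:: 0; 0; 1; 0]; [:: 0; 0; 1; 1]; [:: 0; 0; 1; 2]; [:: 0; 1; 0; 1]; [:: 0; 1; 0; 2]; [:: 0; 1; 1; 0]; [:: 0; 1; 1; 1]; [:: 0; 1; 1; 2]; [:: 0; 1; 2; 0]; [:: 0; 1; 2; 1]; [:: 0; 1; 2; 2]; [:: 0; 1; 2; 3]] 2
    [:: 0; 1; 1; 1; 0; 0; 0; 1; 1; 1; 0; 0; 1; 1; 0; 0; 0; 1; 1; 0; 0]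
    [:: 0; 1; 1; 0; 0; 1; 1; 1; 0; 0; 0; 1; 1; 0; 0; 0; 1; 1; 1; 0; 0] 3 22 3.
Lemma cert23_ok : cert_ok cert23.
Proof. by vm_compute. Qed.

Definition cert24 := Cert [:: [:: 0; 0; 1; 2]; [:: 0; 1; 0; 0]; [:: 0; 1; 1; 0]; [:: 0; 1; 2; 1]; [:: 0; 1; 2; 2]] 5
    [:: 0; 0; 1; 2; 1; 1; 2; 3; 3; 2; 4; 4; 2; 1; 2; 2; 1; 0; 0; 1; 3; 3; 1]
    [:: 4; 1; 1; 4; 0; 4; 4; 0; 2; 2; 0; 4; 0; 0; 4; 2; 4; 4; 2; 1; 2; 2; 1] 3 24 1.
Lemma cert24_ok : cert_ok cert24.
Proof. by vm_compute. Qed.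

Definition cert25 := Cert [:: [:: 0; 0; 1; 0]; [:: 0; 1; 0; 0]; [:: 0; 1; 0; 2]; [:: 0; 1; 1; 0]; [:: 0; 1; 2; 2]] 5
    [:: 0; 1; 1; 0; 1; 1; 0; 1; 1; 0; 1; 2; 2; 1; 2; 2; 1; 2; 3; 3; 2; 3; 4; 4; 3; 4; 4; 3; 4; 4; 3; 4; 0; 0; 4; 0; 0; 4]
    [:: 0; 2; 2; 0; 2; 4; 4; 2; 4; 1; 1; 4; 1; 2; 2; 1; 2; 3; 3; 2; 3; 1; 1; 3; 1; 4; 4; 1; 4; 4; 1; 4; 4; 1; 4; 0; 0; 4] 2 27 5.
Lemma cert25_ok : cert_ok cert25.
Proof. by vm_compute. Qed.

Definition cert26 := Cert [:: [:: 0; 0; 1; 2]; [:: 0; 1; 0; 0]; [:: 0; 1; 0; 2]; [:: 0; 1; 1; 0]; [:: 0; 1; 2; 1]] 4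
    [:: 0; 1; 1; 0; 2; 0; 0; 2; 1; 2; 0; 2; 3; 2; 0; 2; 1; 2; 2; 1; 3; 1; 2; 1]
    [:: 1; 2; 3; 2; 2; 3; 1; 3; 2; 3; 3; 2; 1; 2; 0; 2; 1; 2; 2; 1; 3; 1; 2; 1] 2 16 2.
Lemma cert26_ok : cert_ok cert26.
Proof. by vm_compute. Qed.

Definition cert27 := Cert [:: [:: 0; 1; 0; 2]; [:: 0; 1; 2; 1]; [:: 0; 1; 2; 3]] 4
    [:: 0; 1; 0; 2; 0; 3; 0; 2; 0; 1; 3; 2; 3; 0; 1; 0; 2; 0; 3; 1; 2; 1; 0; 3; 0; 2; 0; 3; 0; 1; 2; 1; 3; 0; 2]
    [:: 0; 1; 0; 3; 2; 1; 2; 0; 3; 1; 3; 2; 3; 1; 3; 0; 3; 1; 3; 2; 0; 2; 1; 2; 0; 2; 3; 1; 0; 1; 2; 1; 3; 0; 2] 2 20 4.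
Lemma cert27_ok : cert_ok cert27.
Proof. by vm_compute. Qed.

Definition cert28 := Cert [:: [:: 0; 0; 1; 1]; [:: 0; 0; 1; 2]; [:: 0; 1; 0; 0]; [:: 0; 1; 1; 0]; [:: 0; 1; 2; 1]] 4
    [:: 0; 0; 1; 2; 1; 1; 2; 3; 2; 2; 3; 3; 2; 0; 2; 2; 0; 0; 2; 3; 2; 2; 3; 3; 2; 1; 2; 2; 1; 0; 1; 1]
    [:: 0; 2; 0; 0; 2; 2; 0; 1; 0; 0; 1; 3; 1; 1; 3; 3; 1; 0; 1; 1; 0; 0; 1; 2; 1; 1; 2; 2; 1; 0; 1; 1] 2 23 1.
Lemma cert28_ok : cert_ok cert28.
Proof. by vm_compute. Qed.

Definition cert29 := Cert [:: [:: 0; 1; 2; 3]] 5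
    [:: 0; 1; 2; 3; 0; 4; 1; 2; 3; 0; 4; 1; 2; 0; 3; 4; 1; 0; 2; 3; 4]
    [:: 0; 1; 2; 3; 0; 4; 1; 2; 0; 3; 4; 1; 2; 0; 3; 4; 1; 0; 2; 3; 4] 4 58 8.
Lemma cert29_ok : cert_ok cert29.
Proof. by vm_compute. Qed.

(** * Toeplitz words *)

Section Occurrence_types.

Variables (i j k m : nat).

Lemma occurs_type (s : {perm 'I_m}) w N n l t : occurs i j k w s N n l -> t < l ->
  types i j k m (eq_type (w (N + t)) (w (N + n + t)) (w (N + 2 * n + t)) (w (N + 3 * n + t))).
Proof. by move=> occ /occ[-> -> ->]; apply: types_perm. Qed.

Lemma occurs_eq (s : {perm 'I_m}) w N n l c c' t1 t2 : occurs i j k w s N n l ->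
  c < 4 -> c' < 4 -> t1 < l -> t2 < l ->
  (w (N + c * n + t1) == w (N + c * n + t2)) = (w (N + c' * n + t1) == w (N + c' * n + t2)).
Proof.
move=> occ c4 c4' l1 l2; have [x1 x2 x3] := occ t1 l1; have [y1 y2 y3] := occ t2 l2.
have E d : d < 4 -> (w (N + d * n + t1) == w (N + d * n + t2)) = (w (N + t1) == w (N + t2)).
  case: d => [|[|[|[|//]]]] _; first by rewrite mul0n addn0.
  - by rewrite mul1n x1 y1 (inj_eq perm_inj).
  - by rewrite x2 y2 (inj_eq perm_inj).
  - by rewrite x3 y3 (inj_eq perm_inj).
by rewrite !E.
Qed.

End Occurrence_types.

(** [s1] fixes the orbit of [a] pointwise and acts as [s] elsewhere. A power of [s] that fixes [a]
    fixes its whole orbit, hence agrees with the power of [s1]. *)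
Lemma skip_orbit m (s : {perm 'I_m}) a : exists2 s1 : {perm 'I_m},
  s1 a = a & forall e x, (s ^+ e)%g a = a -> (s1 ^+ e)%g x = (s ^+ e)%g x.
Proof.
have stab z : (s z \in porbit s a) = (z \in porbit s a).
  by rewrite ![_ \in porbit s a]porbit_sym -!eq_porbit_mem (porbit_perm s 1).
have inj : injective (fun x => if x \in porbit s a then x else s x).
  move=> x y /=; case: ifP; case: ifP => // ya xa; last by move/perm_inj.
  - by move=> xy; rewrite xy stab ya in xa.
  - by move=> xy; rewrite -xy stab xa in ya.
exists (perm inj) => [|e x ea]; first by rewrite permE porbit_id.
have [xa|xNa] := boolP (x \in porbit s a).
  rewrite (perm_fix_orbit xa ea); elim: e {ea} => [|e IHe]; first by rewrite expg0 perm1.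
  by rewrite expgSr permM IHe permE xa.
elim: e {ea} => [|e IHe]; first by rewrite !expg0 !perm1.
rewrite !expgSr !permM IHe permE; case: ifP => // sxa; case/negP: xNa.
by move: sxa; rewrite ![_ \in porbit s a]porbit_sym -!eq_porbit_mem porbit_perm.
Qed.

(** Freezing the orbit of the last letter lets [s] act on the remaining ones; exponents that fix the
    last letter keep their effect. *)
Lemma restrict_perm m (s : {perm 'I_m.+1}) : exists s' : {perm 'I_m},
  forall e x, (s ^+ e)%g ord_max = ord_max ->
    lift ord_max ((s' ^+ e)%g x) = (s ^+ e)%g (lift ord_max x).
Proof.
have [s1 s1a s1E] := skip_orbit s ord_max.
have nm x : ord_max != s1 (lift ord_max x).
  by rewrite -{1}s1a (inj_eq perm_inj) neq_lift.
have inj : injective (fun x : 'I_m => s2val (unlift_some (nm x))).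
  move=> x y /= xy; apply: (@lift_inj _ ord_max); apply: (@perm_inj _ s1).
  by case: (unlift_some (nm x)) (unlift_some (nm y)) xy => u /= -> _ [v /= -> _] ->.
exists (perm inj) => e x ea; rewrite -s1E //.
elim: e {ea} => [|e IHe]; first by rewrite !expg0 !perm1.
rewrite !expgSr !permM -IHe permE.
by case: (unlift_some _) => u /= -> _.
Qed.

(** All free positions of one block repeat the same letter of [x], unlike in the usual filling of
    holes one by one. *)
Definition toeplitz m (pat : seq bool) (x : nat -> 'I_m) : nat -> 'I_m.+1 :=
  fun t => if nth true pat (t %% size pat) then ord_max
           else lift ord_max (x (t %/ size pat)).

Section Toeplitz.

Variables (i j k m : nat) (pat : seq bool) (x : nat -> 'I_m).
Hypothesis x_avoids : forall s N n, 0 < n -> ~ occurs i j k x s N n n.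
Let p := size pat.
Let w := toeplitz pat x.

Lemma toeplitzE t r : r < p ->
  w (t * p + r) = if nth true pat r then ord_max else lift ord_max (x t).
Proof.
by move=> rp; rewrite /w /toeplitz -/p modnMDl modn_small // divnMDl ?divn_small ?addn0 //; lia.
Qed.

(** A shift by a multiple of the block length carries the new letter to itself, so the three powers
    fix it. Restricting [s] to the other letters turns the columns at a free position into an
    occurrence in [x] of period [n / p]. *)
Lemma toeplitz_aligned s N n : true \in pat -> false \in pat -> p %| n -> 0 < n ->
  ~ occurs i j k w s N n n.
Proof.
move=> Tp Fp /dvdnP[n' nE] n0 occ; have n'0 : 0 < n' by case: n' nE => //; lia.
have p0 : 0 < p by rewrite /p; case: (pat) Tp.
have occ1 t : t < n -> [/\ w (N + 1 * n + t) = (s ^+ i)%g (w (N + t)),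
    w (N + 2 * n + t) = (s ^+ j)%g (w (N + t)) & w (N + 3 * n + t) = (s ^+ k)%g (w (N + t))].
  by rewrite mul1n; apply: occ.
have [ra ra_lt raE] : exists2 r, r < p & nth true pat r = true.
  by exists (index true pat); rewrite ?index_mem ?nth_index.
have [rx rx_lt rxE] : exists2 r, r < p & nth true pat r = false.
  by exists (index false pat); rewrite ?index_mem ?nth_index.
have fit r : r < p -> exists2 c, N <= c * p + r & c * p + r < N + p.
  move=> rp; have := divn_eq N p; have := ltn_pmod N p0.
  move: (N %/ p) (N %% p) => a b bp NE; have [br|rb] := leqP b r.
    by exists a; lia.
  by exists a.+1; rewrite mulSn; lia.
have pn : p <= n by rewrite nE leq_pmull.
have [ca Nca cap] := fit ra ra_lt.
have [o1 o2 o3] : [/\ (s ^+ i)%g ord_max = ord_max, (s ^+ j)%g ord_max = ord_max &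
   (s ^+ k)%g ord_max = ord_max].
  have := occ1 (ca * p + ra - N); rewrite subnKC //.
  have E c : N + c * n + (ca * p + ra - N) = (ca + c * n') * p + ra by rewrite nE; lia.
  by rewrite !E !toeplitzE // raE => -[|<- <- <-] //; lia.
have [s' s'E] := restrict_perm s.
have [cx Ncx cxp] := fit rx rx_lt.
apply: (x_avoids (s := s') (N := cx) n'0) => t tn.
have tp : t.+1 * p <= n by rewrite nE leq_mul2r tn orbT.
have Nt : N <= (cx + t) * p + rx by rewrite mulnDl; lia.
have := occ1 ((cx + t) * p + rx - N); rewrite subnKC //.
have E c : N + c * n + ((cx + t) * p + rx - N) = (cx + c * n' + t) * p + rx.
  by rewrite nE; lia.
rewrite !E !toeplitzE // rxE -!s'E // mul1n => -[|/lift_inj-> /lift_inj-> /lift_inj->//].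
by rewrite mulnDl; rewrite mulSn in tp; lia.
Qed.

(* [Some true]: surely equal letters; [Some false]: surely distinct;
   [None]: two letters of [x] at different positions. *)
Definition toeplitz_eq u v : option bool :=
  let b := nth true pat (u %% p) in let b' := nth true pat (v %% p) in
  if b (+) b' then Some false
  else if b then Some true
  else if u %/ p == v %/ p then Some true else None.

Lemma toeplitz_eqP u v : if toeplitz_eq u v is Some b then (w u == w v) = b else True.
Proof.
rewrite /toeplitz_eq /w /toeplitz -/p; do 2 case: (nth _ _ _) => //=.
- by rewrite eqxx.
- by rewrite (negPf (neq_lift _ _)).
- by rewrite eq_sym (negPf (neq_lift _ _)).
by case: eqP => // ->; rewrite eqxx.
Qed.

(** Witness that offset [r] and period [v] are impossible: two positions carry equal letters in one
    block of the instance and distinct letters in another, against injectivity of [s]. *)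
Definition misaligned r v :=
  has (fun c => has (fun c' => has (fun t1 => has (fun t2 =>
    (toeplitz_eq (r + c * v + t1) (r + c * v + t2) == Some true) &&
    (toeplitz_eq (r + c' * v + t1) (r + c' * v + t2) == Some false))
  (iota 0 (minn v p))) (iota 0 (minn v p))) (iota 0 4)) (iota 0 4).

Lemma toeplitz_eq_shift a u v : 0 < p -> toeplitz_eq (a * p + u) (a * p + v) = toeplitz_eq u v.
Proof. by move=> p0; rewrite /toeplitz_eq !modnMDl !divnMDl // eqn_add2l. Qed.

(** From one block length on only the period modulo [p] matters, so the periods below [2 * p]
    represent all. *)
Lemma misaligned_occurs s N n v : 0 < p -> misaligned (N %% p) v ->
  n = v \/ p <= n /\ p <= v /\ n = v %[mod p] -> ~ occurs i j k w s N n n.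
Proof.
move=> p0 /hasP[c c4 /hasP[c' c4' /hasP[t1 t1p /hasP[t2 t2p /andP[/eqP H1 /eqP H2]]]]] nv occ.
move: c4 c4' t1p t2p; rewrite !mem_iota !add0n /= => c4 c4' t1p t2p.
have vn : minn v p <= n by move: nv; lia.
have E d : toeplitz_eq (N + d * n + t1) (N + d * n + t2) =
           toeplitz_eq (N %% p + d * v + t1) (N %% p + d * v + t2).
  have nvp : n = v %[mod p] by case: nv => [->|[_ []]].
  pose y := (N %/ p) + d * (n %/ p); pose z := d * (v %/ p).
  have e1 : N + d * n = y * p + (N %% p + d * (n %% p)).
    by rewrite {1}(divn_eq N p) {1}(divn_eq n p) /y; lia.
  have e2 : N %% p + d * v = z * p + (N %% p + d * (n %% p)).
    by rewrite {1}(divn_eq v p) nvp /z; lia.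
  by rewrite e1 e2 -!addnA !toeplitz_eq_shift.
have t1n := leq_trans t1p vn; have t2n := leq_trans t2p vn.
have := toeplitz_eqP (N + c * n + t1) (N + c * n + t2); rewrite E H1.
have := toeplitz_eqP (N + c' * n + t1) (N + c' * n + t2); rewrite E H2.
by rewrite (occurs_eq occ c4' c4 t1n t2n) => ->.
Qed.

End Toeplitz.

(** A window of offset [r] up to renaming: 0 is the new letter, 1 the letter of the current block,
    and [e] that of the next block, which is 1 or 2 according as the two letters of [x] agree or
    not. *)
Definition toeplitz_code (pat : seq bool) r e t :=
  if nth true pat ((r + t) %% size pat) then 0
  else if (r + t) %/ size pat == 0 then 1 else e.

Definition toeplitz_types pat :=
  [seq let f := toeplitz_code pat r e in eq_type (f 0) (f 1) (f 2) (f 3)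
  | r <- iota 0 (size pat), e <- [:: 1; 2]].

(** Blocks of at least three letters ensure that four consecutive letters meet at most two
    blocks. *)
Lemma toeplitz_typesP m pat (x : nat -> 'I_m) N : 2 < size pat ->
  let w := toeplitz pat x in
  eq_type (w N) (w N.+1) (w N.+2) (w N.+3) \in toeplitz_types pat.
Proof.
set p := size pat => p3; set w := toeplitz pat x; have p0 : 0 < p by lia.
pose r := N %% p; pose q := N %/ p; pose e := if x q == x q.+1 then 1 else 2.
apply/allpairsPdep; exists r, e; split; first by rewrite mem_iota ltn_mod.
  by rewrite /e; case: ifP.
have rp : r < p by rewrite ltn_mod.
have quo t : t < 4 -> (r + t) %/ p = (p <= r + t).
  move=> t4; have [le|lt] := leqP p (r + t); last by rewrite divn_small.
  by rewrite -[r + t](subnK le) divnDr ?divnn ?p0 ?dvdnn // divn_small ?subnK ?le //; lia.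
have wE t : t < 4 -> w (N + t) = if nth true pat ((r + t) %% p) then ord_max
    else lift ord_max (x (q + (p <= r + t))).
  move=> t4; have -> : N + t = q * p + (r + t) by rewrite addnA -divn_eq.
  by rewrite /w /toeplitz -/p modnMDl divnMDl // quo.
have E t1 t2 : t1 < 4 -> t2 < 4 ->
   (w (N + t1) == w (N + t2)) = (toeplitz_code pat r e t1 == toeplitz_code pat r e t2).
  move=> l1 l2; rewrite !wE // /toeplitz_code -/p !quo // /e.
  have nl y : (ord_max == lift ord_max y :> 'I_m.+1) = false := negPf (neq_lift _ y).
  have ln y : (lift ord_max y == ord_max :> 'I_m.+1) = false by rewrite eq_sym nl.
  do 2 case: (nth _ _ _) => //=; rewrite ?nl ?ln ?eqxx ?(inj_eq lift_inj) //.
  - by case: (p <= _); case: ifP.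
  - by case: (p <= _); case: ifP.
  - do 2 case: (p <= _); rewrite ?addn0 ?addn1 ?eqxx //=; last rewrite eq_sym.
    + by rewrite eq_sym; case: ifP.
    + by rewrite eq_sym; case: ifP.
by rewrite /eq_type -!E // addn0 addn1 addn2 addn3.
Qed.

Definition toeplitz_ok pat :=
  (2 < size pat) && [&& true \in pat, false \in pat &
   all (fun r => all (fun v => if v %% size pat == 0 then true else misaligned pat r v)
     (iota 2 (2 * size pat - 2))) (iota 0 (size pat))].

Lemma toeplitz_avoidable i j k m pat : toeplitz_ok pat -> 
  (forall tau, tau \in toeplitz_types pat -> ~~ types i j k m.+1 tau) ->
  avoidable i j k m -> avoidable i j k m.+1.
Proof.
move=> /andP[p3 /and3P[Tp Fp /allP mis]] tyN /avoidable_occurs[x x_av].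
apply/avoidable_occurs; exists (toeplitz pat x) => s N n n0 occ.
have p0 : 0 < size pat by lia.
have rP : N %% size pat \in iota 0 (size pat) by rewrite mem_iota ltn_mod.
have [pn|pNn] := boolP (size pat %| n).
  exact: (toeplitz_aligned x_av Tp Fp pn n0 occ).
have [n1|n1] : n = 1 \/ 1 < n by lia.
  have := occurs_type occ (t := 0); rewrite n0 !addn0 n1 !addn1 => /(_ isT); apply/negP.
  by rewrite addn2 addn3; apply: tyN; apply: toeplitz_typesP.
have [v vI nv] : exists2 v, v \in iota 2 (2 * size pat - 2) &
    n = v \/ size pat <= n /\ size pat <= v /\ n = v %[mod size pat].
  have [np|pn] := ltnP n (2 * size pat).
    by exists n; [rewrite mem_iota; lia | left].
  exists (size pat + n %% size pat); last by right; rewrite modnDl modn_mod; lia.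
  by rewrite mem_iota; have := ltn_pmod n p0; lia.
have := allP (mis _ rP) v vI; case: eqP => [v0|_ M]; last exact: (misaligned_occurs p0 M nv occ).
case/negP: pNn; rewrite /dvdn; case: nv => [->|[_ [_ ->]]]; exact/eqP.
Qed.

Lemma toeplitz_ok_aab : toeplitz_ok [:: true; true; false]. Proof. by vm_compute. Qed.
Lemma toeplitz_ok_bba : toeplitz_ok [:: false; false; true]. Proof. by vm_compute. Qed.
Lemma toeplitz_ok_aaab : toeplitz_ok [:: true; true; true; false]. Proof. by vm_compute. Qed.

Notation ty_aaaa := (eq_type 0 0 0 0).
Notation ty_aaab := (eq_type 0 0 0 1).
Notation ty_aaba := (eq_type 0 0 1 0).
Notation ty_aabb := (eq_type 0 0 1 1).
Notation ty_aabc := (eq_type 0 0 1 2).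
Notation ty_abaa := (eq_type 0 1 0 0).
Notation ty_abab := (eq_type 0 1 0 1).
Notation ty_abac := (eq_type 0 1 0 2).
Notation ty_abba := (eq_type 0 1 1 0).
Notation ty_abbb := (eq_type 0 1 1 1).
Notation ty_abbc := (eq_type 0 1 1 2).
Notation ty_abca := (eq_type 0 1 2 0).
Notation ty_abcb := (eq_type 0 1 2 1).
Notation ty_abcc := (eq_type 0 1 2 2).
Notation ty_abcd := (eq_type 0 1 2 3).

(** * Words without equal neighbours *)

Definition loopless_avoidable i j k m := exists w : nat -> 'I_m,
  (forall t, w t != w t.+1) /\ forall s N n, 0 < n -> ~ occurs i j k w s N n n.

Lemma loopless_avoidableW i j k m : loopless_avoidable i j k m -> avoidable i j k m.
Proof. by case=> w [_ av]; apply/avoidable_occurs; exists w. Qed.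

Notation alternating := (toeplitz [:: true; false]).

Lemma alternatingE m (x : nat -> 'I_m) t :
  alternating x t = if odd t then lift ord_max (x t./2) else ord_max.
Proof. by rewrite /toeplitz /= modn2 divn2; case: odd. Qed.

Lemma alternating_neq m (x : nat -> 'I_m) t : alternating x t != alternating x t.+1.
Proof.
rewrite !alternatingE /=; case: odd => /=; last exact: neq_lift.
by rewrite eq_sym neq_lift.
Qed.

Lemma eq_type_alternating m (x : nat -> 'I_m) N n : odd n -> ~~ odd N ->
  eq_type (alternating x N) (alternating x (N + n)) (alternating x (N + 2 * n))
    (alternating x (N + 3 * n)) \in [:: ty_abab; ty_abac].
Proof.
move=> no Ne; rewrite !alternatingE !oddD no (negPf Ne) /= /eq_type !eqxx.
have nl y : (ord_max == lift ord_max y :> 'I_m.+1) = false := negPf (neq_lift _ y).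
have ln y : (lift ord_max y == ord_max :> 'I_m.+1) = false by rewrite eq_sym nl.
by rewrite !nl !ln; case: eqP.
Qed.

(** An odd period produces a column of type abab or abac at an even position; the only occurrence
    without one has [n = 1] at an odd position, with type abab or abcb. Even periods restrict to
    [x]. *)
Lemma loopless_of_avoidable i j k m :
  (forall tau, tau \in [:: ty_abab; ty_abac; ty_abcb] -> ~~ types i j k m.+1 tau) ->
  avoidable i j k m -> loopless_avoidable i j k m.+1.
Proof.
move=> tyN /avoidable_occurs[x x_av]; exists (alternating x); split.
  exact: alternating_neq.
move=> s N n n0 occ; have [no|ne] := boolP (odd n); last first.
  by apply: (toeplitz_aligned (pat := [:: true; false]) x_av _ _ _ n0 occ) => //; rewrite dvdn2.
have [No|Ne] := boolP (odd N); last first.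
  have := occurs_type occ n0; rewrite !addn0; apply/negP; apply: tyN.
  by have := eq_type_alternating x no Ne; rewrite !inE; lia.
have [n1|n1] : n = 1 \/ 1 < n by lia.
  have := occurs_type occ n0; rewrite !addn0 n1; apply/negP; apply: tyN.
  rewrite !alternatingE !oddD No /= /eq_type !eqxx.
  have nl y : (ord_max == lift ord_max y :> 'I_m.+1) = false := negPf (neq_lift _ y).
  have ln y : (lift ord_max y == ord_max :> 'I_m.+1) = false by rewrite eq_sym nl.
  by rewrite !nl !ln; case: eqP.
have := occurs_type occ n1; rewrite ![N + _ + 1]addnAC; apply/negP; apply: tyN.
have No1 : ~~ odd (N + 1) by rewrite addn1 /= No.
by have := eq_type_alternating x no No1; rewrite !inE; lia.
Qed.

(** When neighbours in [x] differ, equality at distance two reveals the parity of a position. This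
    excludes odd periods above 2 and reduces the types for period 1 to abac and abcb. *)
Lemma loopless_step i j k m :
  (forall tau, tau \in [:: ty_abac; ty_abcb] -> ~~ types i j k m.+1 tau) ->
  loopless_avoidable i j k m -> loopless_avoidable i j k m.+1.
Proof.
move=> tyN [x [xx x_av]]; exists (alternating x); split; first exact: alternating_neq.
move=> s N n n0 occ; have [no|ne] := boolP (odd n); last first.
  by apply: (toeplitz_aligned (pat := [:: true; false]) x_av _ _ _ n0 occ) => //; rewrite dvdn2.
have eqE t : (alternating x t == alternating x t.+2) = ~~ odd t.
  rewrite !alternatingE /= negbK; case: odd; rewrite ?eqxx //.
  by rewrite (inj_eq lift_inj) (negPf (xx _)).
have [n1|n1] : n = 1 \/ 2 < n by case: (n) no n0 => [|[|[]]]; auto.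
  have := occurs_type occ n0; rewrite !addn0 n1 addn1 addn2 addn3; apply/negP; apply: tyN.
  rewrite /eq_type !eqE (negPf (alternating_neq x N)) (negPf (alternating_neq x N.+1)).
  rewrite (negPf (alternating_neq x N.+2)) /= negbK.
  suff -> : (alternating x N == alternating x N.+3) = false by case: odd.
  apply/negbTE; have [No|Ne] := boolP (odd N).
    have /eqP <- : alternating x N.+1 == alternating x N.+3 by rewrite eqE /= No.
    exact: alternating_neq.
  have /eqP -> : alternating x N == alternating x N.+2 by rewrite eqE.
  exact: alternating_neq.
have n02 : 2 < n by [].
have := @occurs_eq i j k m.+1 s _ N n n 0 1 0 2 occ isT isT n0 n02.
by rewrite mul0n mul1n !addn0 !addn2 !eqE oddD no; case: odd.
Qed.

Definition cert_loopless c :=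
  let q := size (cA c) in
  all (fun f => let w := word_image (cA c) (cB c) f in
    all (fun b => nth 0 w b != nth 0 w b.+1) (iota 0 q)) (tm_factors 0).

Lemma cert_loopless_avoidable i j k m c : cert_ok c -> cert_loopless c -> cc c <= m ->
  (forall tau, tau \in cert_types c -> ~~ types i j k m tau) -> loopless_avoidable i j k m.
Proof.
move=> crt ll cm Gm; have /and5P[ltc q0 /eqP sA /eqP sB _] := crt.
have wc := morphic_word_lt _ q0 sA sB ltc.
have m0 : 0 < m by apply: leq_trans cm; apply: leq_ltn_trans (wc 0).
case: m m0 cm Gm => // m _ cm Gm.
exists (ord_word m (morphic_word (cA c) (cB c) (size (cA c)))); split=> [t|]; last first.
  exact: cert_word_avoids.
have wlt t' := leq_trans (wc t') cm.
apply: contraTneq ll => /(congr1 val); rewrite /= !inordK // => E.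
apply/allPn; exists (map thue_morse (iota (t %/ size (cA c)) (2 ^ 0).+1)); first exact: tm_factorsP.
apply/allPn; exists (t %% size (cA c)); first by rewrite mem_iota ltn_mod.
have rq := ltn_pmod t q0.
rewrite negbK !(nth_word_image q0 sA sB) ?expn0; try lia.
by rewrite addnS [_ * (_ %/ _)]mulnC -divn_eq E.
Qed.

(** * Arithmetic progressions of exponents *)

Definition spaced m (x : nat -> 'I_m) := forall t, x t != x t.+1 /\ x t != x t.+2.

Section Spaced.

Variables (i j k m : nat).
Implicit Types (s : {perm 'I_m}) (a : 'I_m) (x w : nat -> 'I_m).

(* On the orbit of [a] the exponents are an arithmetic progression
   0, i, 2i, 3i whose difference has order [d]. *)
Definition progression d s a :=
  [/\ (s ^+ i)%g a != a, (s ^+ j)%g a = (s ^+ (2 * i))%g a,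
      (s ^+ k)%g a = (s ^+ (3 * i))%g a, (s ^+ (d * i))%g a = a
    & d = 4 -> (s ^+ (2 * i))%g a != a].

(** [A] confines the orbit that carries the progression. Shrinking it to six letters bounds the
    orbit length, and the progression becomes a condition on i, j, k alone. *)
Definition only_progressions d (A : {set 'I_m}) x :=
  forall s N n, 0 < n -> occurs i j k x s N n n.+1 ->
    exists2 a, progression d s a & porbit s a \subset A.

Lemma occurs_at x s N n l c t : occurs i j k x s N n l -> c < 4 -> t < l ->
  x (N + c * n + t) = (s ^+ exponent i j k c)%g (x (N + t)).
Proof.
move=> occ c4 /occ[o1 o2 o3]; case: c c4 => [|[|[|[|//]]]] _ /=.
- by rewrite expg0 perm1 mul0n addn0.
- by rewrite mul1n.
- by [].
- by [].
Qed.

(** * Interleaving a word with two separators *)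

Section Lift.

Variables (p q : 'I_m) (w : nat -> 'I_m).
Hypotheses (neq_pq : p != q) (w_sp : spaced w).
Hypothesis wpq : forall t, (w t != p) && (w t != q).

Let P r := if odd r then q else p.

(** Block r is P w_r w_{r+1} P, with separator P alternately [p] and [q]. Letters of [w] appear in
    two adjacent blocks, which lets [n.+1] columns here show [n'.+1] columns of [w]. *)
Definition spread t :=
  let r := t %/ 4 in
  match t %% 4 with 1 => w r | 2 => w r.+1 | _ => P r end.

Lemma spreadE r c : c < 4 ->
  spread (4 * r + c) = match c with 1 => w r | 2 => w r.+1 | _ => P r end.
Proof.
by move=> c4; rewrite /spread mulnC modnMDl divnMDl // modn_small // divn_small // addn0.
Qed.

Lemma spread_ind (Q : nat -> Prop) :
  (forall r, [/\ Q (4 * r + 0), Q (4 * r + 1), Q (4 * r + 2) & Q (4 * r + 3)]) ->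
  forall t, Q t.
Proof.
move=> H t; rewrite (divn_eq t 4) mulnC; have := ltn_pmod t (isT : 0 < 4).
by have [] := H (t %/ 4); case: (t %% 4) => [|[|[|[|]]]].
Qed.

Let wS r : w r == w r.+1 = false. Proof. by apply/negbTE; case: (w_sp r). Qed.
Let wSS r : w r == w r.+2 = false. Proof. by apply/negbTE; case: (w_sp r). Qed.
Let wP r r' : w r == P r' = false.
Proof. by have /andP[/negPf wp /negPf wq] := wpq r; rewrite /P; case: ifP. Qed.
Let Pw r r' : P r' == w r = false. Proof. by rewrite eq_sym wP. Qed.
Let PS r : P r == P r.+1 = false.
Proof. by apply/negbTE; rewrite /P /=; case: odd => //=; rewrite eq_sym. Qed.
Let PSS r : P r.+2 = P r. Proof. by rewrite /P /= negbK. Qed.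

Let e1 r : 4 * r + 4 = 4 * r.+1 + 0. Proof. lia. Qed.
Let e2 r : 4 * r + 5 = 4 * r.+1 + 1. Proof. lia. Qed.
Let e3 r : 4 * r + 6 = 4 * r.+1 + 2. Proof. lia. Qed.
Let e4 r : 4 * r + 7 = 4 * r.+1 + 3. Proof. lia. Qed.
Let e5 r : 4 * r + 8 = 4 * r.+2 + 0. Proof. lia. Qed.
Let e6 r : 4 * r + 9 = 4 * r.+2 + 1. Proof. lia. Qed.
Let e7 r : 4 * r + 10 = 4 * r.+2 + 2. Proof. lia. Qed.
Let e8 r : 4 * r + 11 = 4 * r.+2 + 3. Proof. lia. Qed.
Let eE := (e1, e2, e3, e4, e5, e6, e7, e8).
Let x0 r : spread (4 * r + 0) = P r. Proof. exact: spreadE. Qed.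
Let x1 r : spread (4 * r + 1) = w r. Proof. exact: spreadE. Qed.
Let x2 r : spread (4 * r + 2) = w r.+1. Proof. exact: spreadE. Qed.
Let x3 r : spread (4 * r + 3) = P r. Proof. exact: spreadE. Qed.
Let xE := (x0, x1, x2, x3, PSS, wS, wSS, wP, Pw, PS, eqxx).
Let oE c r : odd (4 * r + c) = odd c. Proof. by rewrite oddD oddM. Qed.

Lemma spread_spaced : spaced spread.
Proof.
suff H t : (spread t == spread (t + 1)) = false /\ (spread t == spread (t + 2)) = false.
  by move=> t; have [] := H t; rewrite addn1 addn2 => -> ->.
by move: t; apply: spread_ind => r; split; split; cbv beta; rewrite -(addnA (4 * r)) ?eE !xE.
Qed.

Lemma spread3 t : (spread t == spread (t + 3)) = ~~ odd t.
Proof. by move: t; apply: spread_ind => r; split; cbv beta; rewrite -?(addnA (4 * r)) oE ?eE !xE. Qed.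

Lemma spread5 t : odd t -> (spread t == spread (t + 5)) = (t %% 4 == 3).
Proof.
move: t; apply: spread_ind => r; split; cbv beta; rewrite -?(addnA (4 * r)) oE //= ?eE !xE => _;
  by rewrite mulnC modnMDl.
Qed.

Lemma spread8 t :
  (spread t == spread (t + 8)) = if odd t then spread (t + 2) != spread (t + 7)
                                 else spread (t + 1) != spread (t + 6).
Proof.
by move: t; apply: spread_ind => r; split; cbv beta; rewrite -?(addnA (4 * r)) oE /= ?eE !xE.
Qed.

Section Occurrence.

Variables (s : {perm 'I_m}) (N n : nat).
Hypotheses (n_gt0 : 0 < n) (occ : occurs i j k spread s N n n.+1).
Let f := (s ^+ i)%g.
Let g := (s ^+ j)%g.
Let h := (s ^+ k)%g.

Let y t := spread (N + t).
Let yE t c : spread (N + t + c) = y (t + c). Proof. by rewrite /y addnA. Qed.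

Let fy t : t <= n -> y (n + t) = f (y t).
Proof. by move=> tn; rewrite /y addnA -[n in LHS]mul1n (occurs_at occ). Qed.
Let hy t : t <= n -> y (3 * n + t) = h (y t).
Proof. by move=> tn; rewrite /y addnA (occurs_at occ). Qed.

Let hf v u : f v = u -> (v == h v) = (u == h u).
Proof. by move=> <-; rewrite /h /f perm_commute (inj_eq perm_inj). Qed.

Let y3 t : (y t == y (t + 3)) = ~~ (odd N (+) odd t).
Proof. by rewrite -yE spread3 oddD. Qed.

(** As [f] and [h] commute, [h] fixes [y 0] exactly when it fixes [y 1]; but only one of these two
    letters returns at distance three. *)
Lemma spread_not1 : n != 1.
Proof.
apply/eqP => n1; have y1E : f (y 0) = y 1 by rewrite -fy // n1.
have h0 : y (0 + 3) = h (y 0) by rewrite -hy // n1.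
have h1 : y (1 + 3) = h (y 1) by rewrite -hy // n1.
by have := hf y1E; rewrite -h0 -h1 !y3; case: odd.
Qed.

Lemma spread_odd : 2 < n -> ~~ odd n.
Proof.
move=> n2; have f0 : f (y 0) = y (n + 0) by rewrite fy.
have f3 : f (y 3) = y (n + 3) by rewrite fy.
have := y3 0; rewrite -(inj_eq (@perm_inj _ f)) f0 f3 addn0 y3 /= addbF.
by case: (odd N); case: (odd n).
Qed.

Lemma spread_not2 : n != 2.
Proof.
apply/eqP => n2; have f0 : f (y 0) = y 2 by rewrite -fy // n2.
have f1 : f (y 1) = y 3 by rewrite -fy ?n2.
have f2 : f (y 2) = y 4 by rewrite -fy ?n2.
have h0 : h (y 0) = y 6 by rewrite -hy // n2.
have h1 : h (y 1) = y 7 by rewrite -hy ?n2.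
have h2 : h (y 2) = y 8 by rewrite -hy ?n2.
have E v u : f v = u -> (v == h (f v)) = (u == h (f u)).
  by move=> <-; rewrite -(inj_eq (@perm_inj _ f)) /h /f [in LHS]perm_commute.
have : (y 0 == y 8) = if odd N then y 2 != y 7 else y 1 != y 6 by rewrite /y addn0 spread8.
have := y3 0; have := y3 1; rewrite addbT addbF !add0n.
case: (odd N) => /= [/eqP y14 _|_ /eqP y03].
  by have := E _ _ f0; rewrite f0 f2 -y14 h1 h2 => ->; case: eqP.
by have := E _ _ (etrans f1 (esym y03)); rewrite f1 -y03 f0 h0 h2 => ->; case: eqP.
Qed.

Lemma spread_not2mod4 : 5 < n -> n %% 4 != 2.
Proof.
move=> n5; apply/eqP => n4; pose t : nat := ~~ odd N.
have tn : t + 5 <= n by rewrite /t; case: odd; lia.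
have f0 : f (y t) = y (n + t) by rewrite fy //; lia.
have f5 : f (y (t + 5)) = y (n + (t + 5)) by rewrite fy.
have ot : odd (N + t) by rewrite oddD /t; case: odd.
have ont : odd (N + (n + t)) by rewrite addnCA oddD ot; lia.
have eN : spread (N + (n + t) + 5) = y (n + (t + 5)) by rewrite /y !addnA.
have := spread5 ont; rewrite eN -[spread _]/(y (n + t)) -f0 -f5 (inj_eq perm_inj).
by rewrite /y addnA spread5 //; lia.
Qed.

Lemma spread_dvd4 : 4 %| n.
Proof.
have n1 := spread_not1; have n2 := spread_not2.
have n3 : 2 < n -> ~~ odd n := spread_odd; have n4 := spread_not2mod4.
have := ltn_pmod n (isT : 0 < 4); rewrite /dvdn; lia.
Qed.

(** The power [j] shifts by an even number of blocks and so fixes a visible separator. The other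
    separator is visible too if [n'] is even, and otherwise is the image of the first under
    [s ^+ i], which commutes with [s ^+ j]. *)
Lemma spread_fix_separators : (s ^+ j)%g p = p /\ (s ^+ j)%g q = q.
Proof.
have /dvdnP[n' nE] := spread_dvd4; pose R := (N + 3) %/ 4.
have NR : N <= 4 * R <= N + 3 by rewrite /R; lia.
have PE c : spread (4 * c) = P c by rewrite -[4 * c]addn0 x0.
have sP c r : c < 4 -> N <= 4 * r -> 4 * r <= N + n ->
    (s ^+ exponent i j k c)%g (P r) = P (r + c * n').
  move=> c4 Nr rN; have := occurs_at (t := 4 * r - N) occ c4; rewrite subnKC // PE => <-; last lia.
  by rewrite -PE; congr spread; rewrite nE; lia.
have PSS2 c r : P (r + 2 * c) = P r.
  by elim: c => [|c IHc]; rewrite ?addn0 // mulnS addnCA PSS.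
have fR : (s ^+ j)%g (P R) = P R by rewrite (sP 2) ?PSS2 //; lia.
suff fR1 : (s ^+ j)%g (P R.+1) = P R.+1.
  by move: fR fR1; rewrite /P /=; case: odd.
have [n'o|n'e] := boolP (odd n'); last first.
  rewrite (sP 2) ?PSS2 //; first lia.
  by move: n_gt0; rewrite nE; lia.
have <- : (s ^+ i)%g (P R) = P R.+1.
  rewrite (sP 1) //; try lia.
  have -> : R + 1 * n' = R.+1 + 2 * n'./2 by lia.
  by rewrite PSS2.
by rewrite perm_commute fR.
Qed.

Lemma spread_occurs : exists r n', 0 < n' /\ occurs i j k w s r n' n'.+1.
Proof.
have /dvdnP[n' nE] := spread_dvd4; have n'0 : 0 < n' by case: n' nE n_gt0 => // ->.
pose r0 := N %/ 4; have := divn_eq N 4; have := ltn_pmod N (isT : 0 < 4).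
rewrite -/r0; move: (N %% 4) => b b4 NE.
have [r rP] : exists r, forall t, t <= n' -> exists2 u, u <= n &
    forall c, spread (N + c * n + u) = w (r + t + c * n').
  have pos1 u t c : N + u = 4 * t + 1 -> spread (N + c * n + u) = w (t + c * n').
    by move=> E; rewrite -x1; congr spread; rewrite nE; lia.
  have pos2 u t c : N + u = 4 * t + 2 -> spread (N + c * n + u) = w (t.+1 + c * n').
    by move=> E; rewrite addSn -x2; congr spread; rewrite nE; lia.
  case: b NE b4 => [|[|[|[|//]]]] NE _.
  - exists r0 => t tn; have [tn'|tn'] := ltnP t n'.
      by exists (4 * t + 1) => [|c]; [lia | apply: pos1; lia].
    exists (4 * n' - 2) => [|c]; first lia.
    by rewrite (pos2 _ (r0 + t).-1); [congr w; lia | lia].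
  - by exists r0 => t tn; exists (4 * t) => [|c]; [lia | apply: pos1; lia].
  - exists r0.+1 => t tn; exists (4 * t) => [|c]; first lia.
    by rewrite addSn (pos2 _ (r0 + t)) //; lia.
  - exists r0.+1 => t tn; have [tn'|tn'] := ltnP t n'.
      by exists (4 * t + 2) => [|c]; [lia | apply: pos1; lia].
    exists (4 * n' - 1) => [|c]; first lia.
    by rewrite addSn (pos2 _ (r0 + t)) //; lia.
exists r, n'; split=> // t tn; have [u un uE] := rP t tn.
have E c : c < 4 -> w (r + t + c * n') = (s ^+ exponent i j k c)%g (w (r + t)).
  by move=> c4; rewrite -uE (occurs_at occ) // -[N]addn0 -(mul0n n) uE mul0n addn0.
have E1 := E 1 isT; have E2 := E 2 isT; have E3 := E 3 isT.
by rewrite mul1n in E1; split; rewrite addnAC.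
Qed.

End Occurrence.

(** [s ^+ j] fixes both separators but no letter in the orbit of a progression of order [d], so this
    orbit avoids the separators. *)
Lemma spread_only_progressions d A : d \in [:: 3; 4; 5] ->
  only_progressions d A w -> only_progressions d (A :\ p :\ q) spread.
Proof.
move=> d345 wA s N n n0 occ; have [r [n' [n'0 /(wA _ _ _ n'0)[a apr aA]]]] := spread_occurs n0 occ.
exists a => //; have [fp fq] := spread_fix_separators n0 occ.
suff H z : (s ^+ j)%g z = z -> z \notin porbit s a.
  apply/subsetP=> z za; rewrite !inE (subsetP aA) // andbT.
  by apply/andP; split; apply: contraTneq za => ->; apply: H.
move=> jz; apply/negP => za; have {jz} ja : (s ^+ j)%g a = a.
  by apply: perm_fix_orbit jz; rewrite porbit_sym.
case: apr => /eqP ia E1 _ Ed E2; rewrite ja in E1; symmetry in E1.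
move: d345 Ed E2; rewrite !inE => /or3P[]/eqP-> Ed E2.
- by apply: ia; move: Ed; rewrite mulSn expgD permM perm_commute E1.
- by have /eqP := E2 erefl.
- apply: ia; rewrite -[RHS]Ed (_ : 5 * i = 2 * i + (2 * i + i)); last lia.
  by rewrite expgD permM E1 expgD permM E1.
Qed.

End Lift.
End Spaced.

(* Column [c] gives f, g, h at [a]; column [e] gives them at f a. *)
Definition shows_progression d (cols : seq column) :=
  has (fun c => let: (a, fa, ga, ha) := c in
    if fa == a then false else
    has (fun e => let: (b, fb, gb, hb) := e in
      if (b == fa) && (fb == ga) && (gb == ha) then
        match d with
        | 3 => ha == a
        | 4 => if ga == a then false else hb == a
        | _ => has (fun u => (entry u 0 == ga) && (entry u 3 == a)) cols
        end
      else false) cols) cols.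

(** Serves as [adm] and is read backwards: columns of an occurrence always commute, so its failure
    exhibits a progression. *)
Definition hides_progression d cols :=
  if commuting cols then ~~ shows_progression d cols else false.

Definition spaced_image c :=
  let q := size (cA c) in
  all (fun f => let w := word_image (cA c) (cB c) f in
    all (fun b => (nth 0 w b != nth 0 w b.+1) && (nth 0 w b != nth 0 w b.+2)) (iota 0 q))
    (tm_factors 1).

Definition progression_cert_ok d c :=
  letters_lt (cc c) (cA c) (cB c) &&
  (certificate (cA c) (cB c) (size (cA c)) (cd c) 1 (cn c) (ch c) (hides_progression d)
  && spaced_image c).

Definition progression_cert3 := Cert [::] 5
    [:: 0; 1; 2; 3; 1; 4; 3; 1; 2; 3; 1; 4; 3; 2; 4; 0; 2; 3; 0; 2; 3; 4; 2; 3; 4; 0; 3; 2]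
    [:: 0; 1; 2; 3; 1; 4; 3; 1; 0; 3; 4; 0; 2; 4; 3; 2; 1; 3; 2; 4; 3; 2; 0; 3; 4; 0; 3; 2] 2 20 8.
Lemma progression_cert3_ok : progression_cert_ok 3 progression_cert3.
Proof. by vm_compute. Qed.

Definition progression_cert4 := Cert [::] 5
    [:: 0; 1; 2; 0; 3; 1; 0; 2; 1; 4; 0; 2; 4; 1; 2; 0; 4; 1; 0; 2; 1; 3; 2; 0; 3; 1; 2; 3]
    [:: 4; 2; 1; 4; 3; 2; 4; 0; 3; 2; 0; 1; 2; 3; 0; 1; 2; 3; 1; 0; 3; 4; 1; 3; 0; 4; 1; 3] 2 14 7.
Lemma progression_cert4_ok : progression_cert_ok 4 progression_cert4.
Proof. by vm_compute. Qed.

Definition progression_cert5 := Cert [::] 5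
    [:: 0; 1; 2; 3; 1; 0; 3; 4; 0; 1; 4; 2; 1; 3; 2; 4; 3; 0; 4; 2; 0; 1; 2; 3; 1; 4; 3; 0; 4; 2; 0; 1; 2; 3; 1; 4; 3; 0; 4; 2]
    [:: 0; 1; 2; 3; 1; 4; 3; 2; 4; 0; 2; 3; 0; 1; 3; 4; 1; 2; 4; 0; 2; 1; 0; 3; 1; 4; 3; 0; 4; 2; 0; 1; 2; 3; 1; 4; 3; 0; 4; 2] 3 41 5.
Lemma progression_cert5_ok : progression_cert_ok 5 progression_cert5.
Proof. by vm_compute. Qed.

Lemma shows_progressionP i j k m (s : {perm 'I_m}) w N n d : d \in [:: 3; 4; 5] ->
  occurs i j k w s N n (n + 1) -> shows_progression d (columns (vals w) N n 1) ->
  exists a, progression i j k d s a.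
Proof.
move=> d345 occ /hasP[[[[a fa] ga] ha] cc].
have [tc _ cE] := occurs_column occ cc.
have := cE 0 isT; have := cE 1 isT; have := cE 2 isT; have := cE 3 isT => /=.
rewrite expg0 perm1; set A := w (N + tc) => haE gaE faE aE.
case: eqP => // fa_a /hasP[[[[b fb] gb] hb] ee].
have [te _ eE] := occurs_column occ ee.
have := eE 0 isT; have := eE 1 isT; have := eE 2 isT; have := eE 3 isT => /=.
rewrite expg0 perm1; set B := w (N + te) => hbE gbE fbE bE.
case: ifP => // /andP[/andP[/eqP e1 /eqP e2] /eqP e3] H.
have P y z v : (s ^+ y)%g ((s ^+ z)%g v) = (s ^+ (z + y))%g v by rewrite -permM -expgD.
have BE : B = (s ^+ i)%g A by apply: val_inj; rewrite /= -bE e1.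
have jE : (s ^+ j)%g A = (s ^+ (2 * i))%g A.
  by rewrite mul2n -addnn -P -BE; apply: val_inj; rewrite /= -gaE -e2 fbE.
have kE : (s ^+ k)%g A = (s ^+ (3 * i))%g A.
  by rewrite mulSn addnC -P -jE perm_commute -BE; apply: val_inj; rewrite /= -haE -e3 gbE.
exists A; split=> //.
- by apply/eqP => E; apply: fa_a; rewrite aE faE E.
- move: d345 H; rewrite !inE => /or3P[]/eqP->.
  + by move=> /eqP H; rewrite -kE; apply: val_inj; rewrite /= -haE H aE.
  + case: ifP => // _ /eqP H; rewrite mulSn addnC -P -kE perm_commute -BE.
    by apply: val_inj; rewrite /= -hbE H aE.
  + case/hasP=> u uu /andP[/eqP u0 /eqP u3].
    have [tu _ uE] := occurs_column occ uu.
    have := uE 0 isT; have := uE 3 isT => /=; rewrite expg0 perm1 u0 u3 => hE gE.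
    have UE : w (N + tu) = (s ^+ j)%g A by apply: val_inj; rewrite /= -gE gaE.
    rewrite (_ : 5 * i = 3 * i + 2 * i); last lia.
    by rewrite -P -kE perm_commute -jE -UE; apply: val_inj; rewrite /= -hE aE.
- move=> d4; move: H; rewrite d4; case: eqP => // ga_a _.
  by rewrite -jE; apply/eqP => E; apply: ga_a; rewrite gaE E aE.
Qed.

Lemma progression_cert_word i j k m d c : d \in [:: 3; 4; 5] -> progression_cert_ok d c ->
  cc c <= m.+1 -> exists x : nat -> 'I_m.+1,
    [/\ spaced x, forall t, x t < cc c & only_progressions i j k d setT x].
Proof.
move=> d345 /and3P[ltc crt /allP sp] cm.
have /and4P[q0 /eqP sA /eqP sB _] := crt.
have wc := morphic_word_lt _ q0 sA sB ltc.
set w := morphic_word _ _ _ in wc.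
have wE : vals (ord_word m w) =1 w by apply: vals_ord_word => t; apply: leq_trans cm.
have wEt t : ord_word m w t = w t :> nat by apply: wE.
exists (ord_word m w); split=> [t|t|s N n n0 occ].
- have /allP/(_ (t %% size (cA c))) := sp _ (tm_factorsP 1 (t %/ size (cA c))).
  rewrite mem_iota ltn_mod q0 => /(_ isT).
  have rq := ltn_pmod t q0.
  rewrite !(nth_word_image q0 sA sB); try (by rewrite (_ : (2 ^ 1).+1 = 3) //; lia).
  by rewrite !addnS [_ * (_ %/ _)]mulnC -divn_eq -/w -!wEt => /andP[]; rewrite !val_eqE.
- by rewrite wEt.
rewrite -[n.+1]addn1 in occ; have [i1 i2 i3] := occurs_iso occ.
have isoE p p' : iso (vals (ord_word m w)) p p' (n + 1) -> iso w p p' n.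
  by move=> H x y xn yn; have := H x y; rewrite !wE; apply; rewrite addn1 ltnS ltnW.
have := certificateP crt n0 (isoE _ _ i1) (isoE _ _ i2) (isoE _ _ i3).
have -> : columns (morphic_word (cA c) (cB c) (size (cA c))) N n 1
        = columns (vals (ord_word m w)) N n 1 by apply: eq_map => t; rewrite !wE.
rewrite /hides_progression (occurs_commuting occ) negbK => /(shows_progressionP d345 occ)[a apr].
by exists a => //; apply: subsetT.
Qed.

Lemma progression_word i j k m d : 4 < m -> d \in [:: 3; 4; 5] ->
  exists (x : nat -> 'I_m) (A : {set 'I_m}),
    [/\ spaced x, #|A| <= 6 & only_progressions i j k d A x].
Proof.
case: m => // m m4 d345.
have [x [xsp x5 xpr]] : exists x : nat -> 'I_m.+1,
    [/\ spaced x, forall t, x t < 5 & only_progressions i j k d setT x].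
  by move: d345; rewrite !inE => /or3P[]/eqP->;
    [apply: (progression_cert_word _ _ _ _ progression_cert3_ok)
    |apply: (progression_cert_word _ _ _ _ progression_cert4_ok)
    |apply: (progression_cert_word _ _ _ _ progression_cert5_ok)].
pose A0 := [set a : 'I_m.+1 | a < 5].
have A05 : #|A0| = 5.
  rewrite cardsE -sum1_card (eq_bigl (fun a : 'I_m.+1 => a < 5)) //.
  by rewrite -(big_ord_widen m.+1 (fun=> 1)) // sum1_card card_ord.
have [A sA0 xA] : exists2 A : {set 'I_m.+1}, A0 \subset A &
    only_progressions i j k d A x /\ forall t, x t \notin A :\: A0.
  by exists setT; rewrite ?subsetT //; split=> // t; rewrite !inE x5.
have [n] := ubnP #|A|; elim: n A x xsp xA sA0 {x5 xpr} => // n IHn A x xsp [xA xN] sA0 ltA.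
have [A6|A7] := leqP #|A| 6; first by exists x, A.
have D2 : 1 < #|A :\: A0| by rewrite cardsD (setIidPr sA0) A05; lia.
have /card_gt1P[p [q [pD qD neq_pq]]] := D2.
have xpq t : (x t != p) && (x t != q).
  by apply/andP; split; apply: contraNneq (xN t) => ->.
move: (pD) (qD); rewrite !inE => /andP[pA0 pA] /andP[qA0 qA].
have cA : #|A :\ p :\ q| < n.
  by have := cardsD1 p A; have := cardsD1 q (A :\ p); rewrite !inE pA qA eq_sym neq_pq; lia.
apply: (IHn (A :\ p :\ q) (spread p q x)) => //.
- exact: spread_spaced.
- split=> [|t]; first exact: spread_only_progressions.
  have xN' r : x r \notin A :\ p :\ q :\: A0.
    by apply: contra (xN r); rewrite !inE => /and4P[-> _ _ ->].
  have PN (b : bool) : (if b then q else p) \notin A :\ p :\ q :\: A0.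
    by case: b; rewrite !inE eqxx ?andbF.
  by rewrite /spread; case: (t %% 4) => [|[|[|r]]].
- apply/subsetP=> a aA0; rewrite !inE (subsetP sA0) // andbT.
  by apply/andP; split; [apply: contraNneq qA0 => <-|apply: contraNneq pA0 => <-]; move: aA0; rewrite inE.
Qed.

Definition progression_mod i j k d :=
  [&& j == 2 * i %[mod d], k == 3 * i %[mod d] & coprime d i].

(** Modulo the orbit length [l] the exponent [i] has order exactly [d]. With [l <= 6] this leaves
    [l] equal to 3 or 6, to 4, or to 5, a multiple of [d] in each case. *)
Lemma progression_modP i j k m d (s : {perm 'I_m}) a : d \in [:: 3; 4; 5] ->
  progression i j k d s a -> #|porbit s a| <= 6 -> progression_mod i j k d.
Proof.
move=> d345 [H1 /eqP H2 /eqP H3 /eqP H4 H5] le6.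
have E e : ((s ^+ e)%g a == a) = (e == 0 %[mod orb s a]).
  by rewrite -eq_perm_mod expg0 perm1.
have {}H5 : d == 4 -> 2 * i != 0 %[mod orb s a] by move/eqP=> /H5; rewrite E.
move: H1 H2 H3 H4 H5 le6 (orb_gt0 s a); rewrite -/(orb s a) !E !eq_perm_mod.
move: (orb s a) => l H1 H2 H3 H4 H5 le6 l0.
rewrite /progression_mod -coprime_modr.
move: d345; rewrite !inE => /or3P[]/eqP dE;
  move: H4 H5; rewrite dE => H4 H5 /=.
- have l36 : l = 3 \/ l = 6.
    by clear -le6 l0 H1 H4; case: l le6 l0 H1 H4 => [|[|[|[|[|[|[|?]]]]]]] //; lia.
  have i3 : i %% 3 = 1 \/ i %% 3 = 2.
    by clear -H1 H4 l36; case: l36 => lE; rewrite lE in H1 H4; lia.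
  have l3 : 3 %| l by case: l36 => ->.
  have H23 x y : x = y %[mod l] -> x == y %[mod 3].
    by move=> xy; rewrite -(modn_dvdm x l3) xy modn_dvdm.
  by apply/and3P; split; [exact: H23 (eqP H2) | exact: H23 (eqP H3) | case: i3 => ->].
- have l4 : l = 4.
    have {}H5 := H5 isT; clear -le6 l0 H1 H4 H5; case: l le6 l0 H1 H4 H5 => [|[|[|[|[|[|[|?]]]]]]] //; lia.
  rewrite l4 in H1 H2 H3 H4 H5; have {}H5 := H5 isT.
  have i4 : i %% 4 = 1 \/ i %% 4 = 3 by lia.
  by apply/and3P; split=> //; case: i4 => ->.
- have l5 : l = 5.
    by clear -le6 l0 H1 H4; case: l le6 l0 H1 H4 => [|[|[|[|[|[|[|?]]]]]]] //; lia.
  rewrite l5 in H1 H2 H3 H4; apply/and3P; split=> //.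
  have : (i %% 5) \in [:: 1; 2; 3; 4] by rewrite !inE; lia.
  by rewrite !inE => /or4P[]/eqP->.
Qed.

Lemma unbraided_word i j k m d : 4 < m -> d \in [:: 3; 4; 5] -> ~~ progression_mod i j k d ->
  exists x : nat -> 'I_m, spaced x /\ forall s N n, 0 < n -> ~ occurs i j k x s N n n.+1.
Proof.
move=> m4 d345 np; have [x [A [xsp A6 xA]]] := progression_word i j k m4 d345.
exists x; split=> // s N n n0 /(xA _ _ _ n0)[a /(progression_modP d345) apr aA].
by case/negP: np; apply: apr; apply: leq_trans A6; apply: subset_leq_card.
Qed.

(** * Braiding each letter with its predecessor *)

Section Braid.

Variables (i j k m : nat) (x : nat -> 'I_m).
Hypothesis x_sp : spaced x.
Hypothesis x_av : forall s N n, 0 < n -> ~ occurs i j k x s N n n.+1.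

(* The blocks of four letters are synchronised by their only pair of equal neighbours. *)
Lemma blocks_avoid (W : nat -> 'I_m) r0 : r0 < 4 ->
  (forall p, (W p == W p.+1) = (p %% 4 == r0)) ->
  (forall s N, odd N != odd r0 -> ~ occurs i j k W s N 2 2) ->
  (forall N, ~~ types i j k m (eq_type (W N) (W N.+1) (W N.+2) (W N.+3))) ->
  (forall N, exists r, forall n t, 0 < n -> t <= n ->
     exists2 u, u < 4 * n & forall c, W (N + u + 4 * c) = x (r + t + c)) ->
  forall s N n, 0 < n -> ~ occurs i j k W s N n n.
Proof.
move=> r4 adj W2 Wty pos s N n n0 occ.
have adjE c c' t : c < 4 -> c' < 4 -> t.+1 < n ->
    ((N + c * n + t) %% 4 == r0) = ((N + c' * n + t) %% 4 == r0).
  move=> c4 c4' tn; rewrite -!adj -!addnS.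
  by apply: (occurs_eq occ c4 c4' _ tn); apply: ltnW.
have [n1|n1] : n = 1 \/ 1 < n by lia.
  by have := occurs_type occ n0; rewrite n1 !addn0 addn1 addn2 addn3; apply/negP.
(* For period 2 the equal neighbours appear in just one of the first two blocks if the start has the
   parity of [r0]; the other parity is the hypothesis [W2]. *)
have [n2|n2] : n = 2 \/ 2 < n by lia.
  have [No|Ne] := boolP (odd N == odd r0); last by rewrite n2 in occ; apply: (W2 s N Ne).
  by have := adjE 0 1 0 isT isT n1; rewrite n2; lia.
have [n3|n3] : n = 3 \/ 3 < n by lia.
  have := adjE 0 1 0 isT isT n1; have := adjE 0 2 0 isT isT n1; have := adjE 0 3 0 isT isT n1.
  by rewrite n3; lia.
have n4 : n %% 4 = 0.
  have [n4|n4] : n = 4 \/ 4 < n by lia.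
    by rewrite n4.
  pose t := (r0 + 4 - N %% 4) %% 4; have tn : t.+1 < n by rewrite /t; lia.
  by have := adjE 0 1 t isT isT tn; rewrite /t; lia.
have /dvdnP[n' nE] : 4 %| n by rewrite /dvdn n4.
have n'0 : 0 < n' by case: n' nE n0 => // ->.
have [r rP] := pos N; apply: (x_av (s := s) (N := r) n'0) => t tn.
have [u u4 uE] := rP n' t n'0 tn.
have un : u < n by rewrite nE mulnC.
have E c : c < 4 -> x (r + c * n' + t) = (s ^+ exponent i j k c)%g (x (r + t)).
  move=> c4; rewrite addnAC -uE -[in RHS](addn0 (r + t)) -uE muln0 addn0.
  by rewrite -(occurs_at occ) //; congr W; rewrite nE; lia.
have E1 := E 1 isT; have E2 := E 2 isT; have E3 := E 3 isT.
by rewrite mul1n in E1.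
Qed.

Let xS t : x t == x t.+1 = false. Proof. by apply/negbTE; case: (x_sp t). Qed.
Let xSS t : x t == x t.+2 = false. Proof. by apply/negbTE; case: (x_sp t). Qed.
Let Sx t : x t.+1 == x t = false. Proof. by rewrite eq_sym xS. Qed.
Let SSx t : x t.+2 == x t = false. Proof. by rewrite eq_sym xSS. Qed.
Let xE := (xS, xSS, Sx, SSx, eqxx).

Lemma four_blocks (Q : nat -> Prop) :
  (forall r, [/\ Q (4 * r), Q (4 * r + 1), Q (4 * r + 2) & Q (4 * r + 3)]) ->
  forall t, Q t.
Proof.
move=> H t; rewrite (divn_eq t 4) mulnC; have := ltn_pmod t (isT : 0 < 4).
have [] := H (t %/ 4); case: (t %% 4) => [|[|[|[|]]]] //.
by rewrite addn0.
Qed.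

(** Blocks x_{r+1} x_{r+1} x_r x_{r+1}. Each shows two successive letters of [x], so [4 * n] columns
    of the braid show [n.+1] columns of [x]. *)
Definition braid t :=
  let r := t %/ 4 in if t %% 4 == 2 then x r else x r.+1.

Definition braid_rev t :=
  let r := t %/ 4 in if t %% 4 == 1 then x r.+1 else x r.

Lemma braid_at r c : c < 4 -> braid (4 * r + c) = if c == 2 then x r else x r.+1.
Proof.
by move=> c4; rewrite /braid mulnC modnMDl divnMDl // modn_small // divn_small // addn0.
Qed.

Lemma braid_rev_at r c : c < 4 -> braid_rev (4 * r + c) = if c == 1 then x r.+1 else x r.
Proof.
by move=> c4; rewrite /braid_rev mulnC modnMDl divnMDl // modn_small // divn_small // addn0.
Qed.

Let b0 r : braid (4 * r) = x r.+1. Proof. by rewrite -[4 * r]addn0 braid_at. Qed.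
Let b1 r : braid (4 * r + 1) = x r.+1. Proof. by rewrite braid_at. Qed.
Let b2 r : braid (4 * r + 2) = x r. Proof. by rewrite braid_at. Qed.
Let b3 r : braid (4 * r + 3) = x r.+1. Proof. by rewrite braid_at. Qed.
Let d0 r : braid_rev (4 * r) = x r. Proof. by rewrite -[4 * r]addn0 braid_rev_at. Qed.
Let d1 r : braid_rev (4 * r + 1) = x r.+1. Proof. by rewrite braid_rev_at. Qed.
Let d2 r : braid_rev (4 * r + 2) = x r. Proof. by rewrite braid_rev_at. Qed.
Let d3 r : braid_rev (4 * r + 3) = x r. Proof. by rewrite braid_rev_at. Qed.
Let s0 r : (4 * r).+1 = 4 * r + 1. Proof. lia. Qed.
Let s1 r : (4 * r + 1).+1 = 4 * r + 2. Proof. lia. Qed.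
Let s2 r : (4 * r + 2).+1 = 4 * r + 3. Proof. lia. Qed.
Let s3 r : (4 * r + 3).+1 = 4 * r.+1. Proof. lia. Qed.
Let sE := (s0, s1, s2, s3).
Let bE := (b0, b1, b2, b3, d0, d1, d2, d3, xE).

(** The listed types are those of its four windows, which settles period 1; for period 2 at odd
    starts the powers i and j would not commute. *)
Lemma braid_avoids :
  (forall tau, tau \in [:: ty_aaba; ty_abac; ty_abba; ty_abcc] -> ~~ types i j k m tau) ->
  forall s N n, 0 < n -> ~ occurs i j k braid s N n n.
Proof.
move=> tyN; apply: (@blocks_avoid braid 0) => //.
- by apply: four_blocks => r; split; rewrite ?sE !bE; lia.
- move=> s N; rewrite /= => No occ.
  have o t c u v : t < 2 -> c < 4 -> braid (N + t) = x u -> braid (N + c * 2 + t) = x v ->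
      (s ^+ exponent i j k c)%g (x u) = x v.
    by move=> t2 c4 <- <-; rewrite (occurs_at occ).
  have [r [NE|NE]] : exists r, N = 4 * r + 1 \/ N = 4 * r + 3.
    by exists (N %/ 4); move: No; lia.
  + have f0 : (s ^+ i)%g (x r.+1) = x r.+1.
      by apply: (o 0 1) => //; [rewrite -b1|rewrite -b3]; congr braid; lia.
    have f1 : (s ^+ i)%g (x r) = x r.+2.
      by apply: (o 1 1) => //; [rewrite -b2|rewrite -b0]; congr braid; lia.
    have g1 : (s ^+ j)%g (x r) = x r.+1.
      by apply: (o 1 2) => //; [rewrite -(b2 r)|rewrite -(b2 r.+1)]; congr braid; lia.
    move: f0; rewrite -{1}g1 perm_commute f1 -g1 => /perm_inj/eqP.
    by rewrite SSx.
  + have f0 : (s ^+ i)%g (x r.+1) = x r.+2.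
      by apply: (o 0 1) => //; [rewrite -b3|rewrite -(b1 r.+1)]; congr braid; lia.
    have f1 : (s ^+ i)%g (x r.+2) = x r.+1.
      by apply: (o 1 1) => //; [rewrite -(b0 r.+1)|rewrite -(b2 r.+1)]; congr braid; lia.
    have g0 : (s ^+ j)%g (x r.+1) = x r.+2.
      by apply: (o 0 2) => //; [rewrite -b3|rewrite -(b3 r.+1)]; congr braid; lia.
    have g1 : (s ^+ j)%g (x r.+2) = x r.+3.
      by apply: (o 1 2) => //; [rewrite -(b0 r.+1)|rewrite -(b0 r.+2)]; congr braid; lia.
    have := perm_commute s (x r.+1) i j; rewrite g0 f0 f1 g1 => /eqP.
    by rewrite xSS.
- by apply: four_blocks => r; split; apply: tyN; rewrite ?sE /eq_type !bE.
- apply: four_blocks => r.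
  have at2 u v c : u = 4 * v + 2 -> braid (u + 4 * c) = x (v + c).
    by move=> ->; rewrite -b2; congr braid; lia.
  have at0 u v c : u = 4 * v -> braid (u + 4 * c) = x (v.+1 + c).
    by move=> ->; rewrite addSn -b0; congr braid; lia.
  have at3 u v c : u = 4 * v + 3 -> braid (u + 4 * c) = x (v.+1 + c).
    by move=> ->; rewrite addSn -b3; congr braid; lia.
  split.
  + exists r => n t n0 tn; have [tn'|tn'] := ltnP t n.
      by exists (4 * t + 2) => [|c]; [lia | apply: at2; lia].
    exists (4 * n - 4) => [|c]; first lia.
    by rewrite (at0 _ (r + t).-1); [congr x; lia | lia].
  + exists r => n t n0 tn; have [tn'|tn'] := ltnP t n.
      by exists (4 * t + 1) => [|c]; [lia | apply: at2; lia].
    exists (4 * n - 2) => [|c]; first lia.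
    by rewrite (at3 _ (r + t).-1); [congr x; lia | lia].
  + exists r => n t n0 tn; have [tn'|tn'] := ltnP t n.
      by exists (4 * t) => [|c]; [lia | apply: at2; lia].
    exists (4 * n - 3) => [|c]; first lia.
    by rewrite (at3 _ (r + t).-1); [congr x; lia | lia].
  + exists r.+1 => n t n0 tn; have [tn'|tn'] := ltnP t n.
      by exists (4 * t) => [|c]; [lia | rewrite (at3 _ (r + t)); [congr x; lia | lia]].
    exists (4 * n - 3) => [|c]; first lia.
    by rewrite (at0 _ (r + t)); [congr x; lia | lia].
Qed.

Lemma braid_rev_avoids :
  (forall tau, tau \in [:: ty_aabc; ty_abaa; ty_abba; ty_abcb] -> ~~ types i j k m tau) ->
  forall s N n, 0 < n -> ~ occurs i j k braid_rev s N n n.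
Proof.
move=> tyN; apply: (@blocks_avoid braid_rev 2) => //.
- by apply: four_blocks => r; split; rewrite ?sE !bE; lia.
- move=> s N; rewrite /= => No occ.
  have o t c u v : t < 2 -> c < 4 -> braid_rev (N + t) = x u -> braid_rev (N + c * 2 + t) = x v ->
      (s ^+ exponent i j k c)%g (x u) = x v.
    by move=> t2 c4 <- <-; rewrite (occurs_at occ).
  have [r [NE|NE]] : exists r, N = 4 * r + 1 \/ N = 4 * r + 3.
    by exists (N %/ 4); move: No; lia.
  + have f1 : (s ^+ i)%g (x r) = x r.+1.
      by apply: (o 1 1) => //; [rewrite -(d2 r)|rewrite -(d0 r.+1)]; congr braid_rev; lia.
    have f0 : (s ^+ i)%g (x r.+1) = x r.
      by apply: (o 0 1) => //; [rewrite -(d1 r)|rewrite -(d3 r)]; congr braid_rev; lia.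
    have g0 : (s ^+ j)%g (x r.+1) = x r.+2.
      by apply: (o 0 2) => //; [rewrite -(d1 r)|rewrite -(d1 r.+1)]; congr braid_rev; lia.
    have g1 : (s ^+ j)%g (x r) = x r.+1.
      by apply: (o 1 2) => //; [rewrite -(d2 r)|rewrite -(d2 r.+1)]; congr braid_rev; lia.
    have := perm_commute s (x r.+1) i j; rewrite g0 f0 g1 -f1 => /perm_inj/eqP.
    by rewrite SSx.
  + have f0 : (s ^+ i)%g (x r) = x r.+2.
      by apply: (o 0 1) => //; [rewrite -(d3 r)|rewrite -(d1 r.+1)]; congr braid_rev; lia.
    have f1 : (s ^+ i)%g (x r.+1) = x r.+1.
      by apply: (o 1 1) => //; [rewrite -(d0 r.+1)|rewrite -(d2 r.+1)]; congr braid_rev; lia.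
    have g0 : (s ^+ j)%g (x r) = x r.+1.
      by apply: (o 0 2) => //; [rewrite -(d3 r)|rewrite -(d3 r.+1)]; congr braid_rev; lia.
    move: f1; rewrite -{1}g0 perm_commute f0 -g0 => /perm_inj/eqP.
    by rewrite SSx.
- by apply: four_blocks => r; split; apply: tyN; rewrite ?sE /eq_type !bE.
- apply: four_blocks => r.
  have at0 u v c : u = 4 * v -> braid_rev (u + 4 * c) = x (v + c).
    by move=> ->; rewrite -d0; congr braid_rev; lia.
  have at2 u v c : u = 4 * v + 2 -> braid_rev (u + 4 * c) = x (v + c).
    by move=> ->; rewrite -d2; congr braid_rev; lia.
  have at3 u v c : u = 4 * v + 3 -> braid_rev (u + 4 * c) = x (v + c).
    by move=> ->; rewrite -d3; congr braid_rev; lia.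
  have at1 u v c : u = 4 * v + 1 -> braid_rev (u + 4 * c) = x (v.+1 + c).
    by move=> ->; rewrite addSn -d1; congr braid_rev; lia.
  split.
  + exists r => n t n0 tn; have [tn'|tn'] := ltnP t n.
      by exists (4 * t) => [|c]; [lia | apply: at0; lia].
    exists (4 * n - 3) => [|c]; first lia.
    by rewrite (at1 _ (r + t).-1); [congr x; lia | lia].
  + exists r => n t n0 tn; have [tn'|tn'] := ltnP t n.
      by exists (4 * t + 1) => [|c]; [lia | apply: at2; lia].
    by exists (4 * n - 1) => [|c]; [lia | apply: at0; lia].
  + exists r => n t n0 tn; have [tn'|tn'] := ltnP t n.
      by exists (4 * t) => [|c]; [lia | apply: at2; lia].
    by exists (4 * n - 2) => [|c]; [lia | apply: at0; lia].
  + exists r => n t n0 tn; have [tn'|tn'] := ltnP t n.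
      by exists (4 * t) => [|c]; [lia | apply: at3; lia].
    by exists (4 * n - 3) => [|c]; [lia | apply: at0; lia].
Qed.

End Braid.

(** * The Fibonacci word *)

Definition fib_block (b : bool) := if b then [:: true; false] else [:: true].
Definition fib_subst (u : seq bool) := flatten (map fib_block u).
Definition fib_prefix n := iter n fib_subst [:: true].
Definition fibonacci_word n := nth true (fib_prefix n) n.

Lemma fib_subst_cat u v : fib_subst (u ++ v) = fib_subst u ++ fib_subst v.
Proof. by rewrite /fib_subst map_cat flatten_cat. Qed.

Lemma fib_prefixS n : exists v, fib_prefix n.+1 = fib_prefix n ++ v.
Proof.
elim: n => [|n [v IHn]]; first by exists [:: false].
by exists (fib_subst v); rewrite -[fib_prefix n.+2]/(fib_subst (fib_prefix n.+1)) {1}IHn fib_subst_cat.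
Qed.

Lemma fib_prefix_le n n' : n <= n' -> exists v, fib_prefix n' = fib_prefix n ++ v.
Proof.
move/subnK<-; elim: (n' - n) => [|c [v IHc]]; first by exists [::]; rewrite cats0.
have [v' ->] := fib_prefixS (c + n).
by exists (v ++ v'); rewrite IHc catA.
Qed.

Lemma size_fib_prefix n : n < size (fib_prefix n).
Proof.
elim: n => // n IHn.
have sz u : size (fib_subst u) = size u + count id u.
  by elim: u => //= b u IHu; rewrite size_cat IHu; case: b => /=; lia.
rewrite /fib_prefix iterS sz -/(fib_prefix n); suff : 0 < count id (fib_prefix n) by move: IHn; lia.
have [v ->] := fib_prefix_le (leq0n n); by rewrite count_cat.
Qed.

Lemma nth_fib_prefix n t : t < size (fib_prefix n) -> nth true (fib_prefix n) t = fibonacci_word t.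
Proof.
move=> tn; rewrite /fibonacci_word; have [le|/ltnW le] := leqP n t.
  by have [v ->] := fib_prefix_le le; rewrite nth_cat tn.
by have [v ->] := fib_prefix_le le; rewrite nth_cat size_fib_prefix.
Qed.

(** Where the image of letter number [v] begins in the fixed point: each image has one letter, and
    one more if it comes from [true]. *)
Definition fib_start v := v + count id (mkseq fibonacci_word v).

Lemma fib_startS v : fib_start v.+1 = fib_start v + (if fibonacci_word v then 2 else 1).
Proof. by rewrite /fib_start mkseqS -cats1 count_cat /=; case: fibonacci_word => /=; lia. Qed.

Lemma fib_start_block v :
  fibonacci_word (fib_start v) /\ (fibonacci_word v -> ~~ fibonacci_word (fib_start v).+1).
Proof.
have sz : size (fib_subst (mkseq fibonacci_word v)) = fib_start v.
  rewrite /fib_start -{2}(size_mkseq fibonacci_word v).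
  by elim: (mkseq _ _) => //= b u IHu; rewrite size_cat IHu; case: b => /=; lia.
have E : fib_prefix v.+1 = fib_subst (mkseq fibonacci_word v) ++ fib_block (fibonacci_word v)
          ++ fib_subst (drop v.+1 (fib_prefix v)).
  have vs := size_fib_prefix v.
  rewrite {1}/fib_prefix iterS -/(fib_prefix v) -{1}(cat_take_drop v.+1 (fib_prefix v)).
  rewrite fib_subst_cat (take_nth true) // -cats1 fib_subst_cat -catA.
  rewrite nth_fib_prefix // {2}/fib_subst /= cats0.
  congr (fib_subst _ ++ _); apply: (@eq_from_nth _ true).
    by rewrite size_takel ?size_mkseq // ltnW.
  move=> t; rewrite size_takel ?(ltnW vs) // => tv.
  by rewrite nth_take // nth_mkseq // nth_fib_prefix // (ltn_trans tv).
have Esz : size (fib_prefix v.+1) = fib_start v + (size (fib_block (fibonacci_word v))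
   + size (fib_subst (drop v.+1 (fib_prefix v)))) by rewrite E !size_cat sz.
split=> [|bv].
  rewrite -(@nth_fib_prefix v.+1); last by rewrite Esz; case: fibonacci_word => /=; lia.
  by rewrite E nth_cat sz ltnn subnn; case: fibonacci_word.
rewrite -(@nth_fib_prefix v.+1); last by rewrite Esz bv /=; lia.
by rewrite E nth_cat sz ltnNge leqnSn /= subSnn bv.
Qed.

Lemma fib_start_cover t : exists v,
  t = fib_start v \/ fibonacci_word v /\ t = (fib_start v).+1.
Proof.
elim: t => [|t [v [->|[bv ->]]]]; first by exists 0; left.
  have [bv|bv] := boolP (fibonacci_word v); first by exists v; right.
  by exists v.+1; left; rewrite fib_startS (negPf bv) addn1.
by exists v.+1; left; rewrite fib_startS bv addn2.
Qed.

Lemma fib_false t : ~~ fibonacci_word t -> 0 < t /\ fibonacci_word t.-1.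
Proof.
have [v [->|[bv ->]]] := fib_start_cover t; have [b1 b2] := fib_start_block v.
  by rewrite b1.
by [].
Qed.

Lemma fib_true t : fibonacci_word t -> exists v, t = fib_start v.
Proof.
have [v [->|[bv ->]]] := fib_start_cover t; first by exists v.
by have [b1 /(_ bv)/negPf->] := fib_start_block v.
Qed.

Lemma fib_start_next v : fibonacci_word (fib_start v).+1 = ~~ fibonacci_word v.
Proof.
have [b1 b2] := fib_start_block v; have [bv|bv] := boolP (fibonacci_word v).
  exact: negbTE (b2 bv).
by have [] := fib_start_block v.+1; rewrite fib_startS (negPf bv) addn1.
Qed.

Lemma fib_start_mono v v' : v < v' -> fib_start v + (v' - v) <= fib_start v'.
Proof.
move=> lt; rewrite -(subnK (ltnW lt)); elim: (v' - v) => [|c IHc]; first by rewrite subnn addn0.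
by rewrite addSn fib_startS; case: fibonacci_word; lia.
Qed.

Lemma fib_not_false2 t : ~~ fibonacci_word t -> fibonacci_word t.+1.
Proof. by move=> bt; apply/negPn/negP => /fib_false[_ /=]; apply/negP. Qed.

Lemma fib_not_const3 t : ~ (fibonacci_word t = fibonacci_word t.+1 /\
  fibonacci_word t.+1 = fibonacci_word t.+2).
Proof.
case=> E1 E2; have [bt|/[dup] bt /fib_not_false2] := boolP (fibonacci_word t); last first.
  by rewrite -E1 (negPf bt).
have [v tv] := fib_true bt.
have bv : ~~ fibonacci_word v by rewrite -fib_start_next -tv -E1.
have t1 : t.+1 = fib_start v.+1 by rewrite fib_startS (negPf bv) addn1 tv.
have := fib_not_false2 bv; rewrite -[fibonacci_word v.+1]negbK -fib_start_next -t1.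
by rewrite -E2 -E1 bt.
Qed.

(** Desubstitution pulls a period [n] over [4 * n - 1] letters back to a smaller period [n'] over
    [4 * n' - 1] letters. One letter less than a fourth power is assumed because taking differences
    of a word loses one letter. *)
Lemma fibonacci_power n N : 0 < n ->
  ~ (forall t, t < 3 * n - 1 -> fibonacci_word (N + t) = fibonacci_word (N + t + n)).
Proof.
elim/ltn_ind: n N => n IHn N n0 per.
have [n1|n1] : n = 1 \/ 1 < n by lia.
  apply: (@fib_not_const3 N); have := per 0; have := per 1.
  by rewrite n1 !addn0 !addn1 => -> // ->.
(* A [false] is preceded by [true], so the repetition extends one letter to the left and can be
   shifted there. *)
wlog bN : N per / fibonacci_word N.
  move=> H; have [bN|bN] := boolP (fibonacci_word N); first exact: (H N).
  have [N0 bN1] := fib_false bN.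
  have bNn : ~~ fibonacci_word (N + n) by have := per 0; rewrite addn0 => <- //; lia.
  have [_ bNn1] := fib_false bNn.
  apply: (H N.-1) => // t tn; case: t tn => [|t] tn.
    by rewrite addn0 bN1 (_ : N.-1 + n = (N + n).-1) ?bNn1 //; lia.
  by have := per t; rewrite (_ : N.-1 + t.+1 = N + t); [apply; lia | lia].
have [v Nv] := fib_true bN.
have bNn : fibonacci_word (N + n) by have := per 0; rewrite addn0 => <- //; lia.
have [v' Nv'] := fib_true bNn.
have vv' : v < v'.
  rewrite ltnNge; apply/negP; rewrite leq_eqVlt => /orP[/eqP E|/fib_start_mono]; last lia.
  by move: Nv'; rewrite E -Nv; lia.
pose n' := v' - v; have v'E : v' = v + n' by rewrite subnKC // ltnW.
have n'0 : 0 < n' by rewrite subn_gt0.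
(* Equality would give blocks of length one throughout, hence two adjacent [false]. *)
have nn' : n' < n.
  have := fib_start_mono vv'; rewrite -/n' -Nv -Nv' leq_add2l leq_eqVlt => /orP[/eqP E|//].
  have step c : c <= n' -> fib_start (v + c) = N + c.
    move=> cn; have [c0|c0] : c = 0 \/ 0 < c by lia.
      by rewrite c0 !addn0.
    have h1 := @fib_start_mono v (v + c) ltac:(lia).
    have [cn'|cn'] : c = n' \/ c < n' by lia.
      by rewrite cn' -v'E -Nv' E.
    have h2 := @fib_start_mono (v + c) v' ltac:(lia).
    by move: h1 h2; rewrite -Nv -Nv'; lia.
  have s1 := step 1 ltac:(lia); have s2 := step 2 ltac:(lia).
  have f0 : ~~ fibonacci_word v.
    by apply/negP => bv; move: s1; rewrite addn1 fib_startS bv -Nv; lia.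
  have := fib_not_false2 f0 => bv1.
  have s1' : fib_start v.+1 = N.+1 by rewrite -addn1 s1 addn1.
  by move: s2; rewrite addn2 fib_startS bv1 s1'; lia.
(* Two adjacent blocks have at least three letters; this keeps the last compared letter within the
   range of the period. *)
have gap c : fib_start (v + c).+2 >= fib_start (v + c) + 3.
  rewrite !fib_startS; have := @fib_not_false2 (v + c).
  by case: (fibonacci_word (v + c)) => [_|/(_ isT)->]; [case: fibonacci_word; lia|lia].
apply: (IHn n' nn' v n'0).
have inv t : t <= 3 * n' - 1 ->
    (forall u, u <= t -> fib_start (v + u + n') = fib_start (v + u) + n) /\
    (forall u, u < t -> fibonacci_word (v + u) = fibonacci_word (v + u + n')).
  elim: t => [|t IHt] tn.
    by split=> // u; rewrite leqn0 => /eqP->; rewrite addn0 -v'E -Nv' -Nv.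
  have [|E1 E2] := IHt; first lia.
  suff bt : fibonacci_word (v + t) = fibonacci_word (v + t + n').
    split=> u; rewrite ?ltnS leq_eqVlt => /orP[/eqP->//|]; [|exact: E1|exact: E2].
    have := E1 t (leqnn _); rewrite [v + t.+1]addnS (addSn (v + t) n') !fib_startS -bt; case: ifP; lia.
  (* The letter after the start of a block is the negation of the letter the block comes from, so
     the comparison moves to the long word. *)
  apply: negb_inj; rewrite -!fib_start_next E1 //.
  have mono u u' : u <= u' -> fib_start (v + u) + (u' - u) <= fib_start (v + u').
    rewrite leq_eqVlt => /orP[/eqP->|uu']; first by rewrite subnn addn0.
    by have := @fib_start_mono (v + u) (v + u') ltac:(lia); rewrite subnDl.
  have Nn' : fib_start (v + n') = N + n by rewrite -v'E -Nv'.
  pose p := fib_start (v + t) - N.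
  have pN : fib_start (v + t) = N + p.
    by rewrite subnKC //; have := mono 0 t isT; rewrite addn0 -Nv; lia.
  clearbody p; suff p3 : p + 3 <= 3 * n by have := per p.+1 ltac:(lia); rewrite pN addnS addSn.
  have [t1|t1] := ltnP t n'.
    by have := mono t n' ltac:(lia); rewrite Nn' pN; lia.
  have [t2|t2] := ltnP t (2 * n').
    have := E1 (t - n') ltac:(lia); rewrite -addnA subnK // pN.
    by have := mono (t - n') n' ltac:(lia); rewrite Nn'; lia.
  have := E1 (t - n') ltac:(lia); rewrite -addnA subnK // pN.
  have := E1 (t - 2 * n') ltac:(lia); rewrite -addnA (_ : t - 2 * n' + n' = t - n'); last lia.
  have := gap (t - 2 * n'); have := mono (t - 2 * n').+2 n' ltac:(lia).
  by rewrite !addnS Nn'; lia.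
by have [_ H] := inv _ (leqnn _).
Qed.

(** * Binary words *)

Section Binary.

Variables (i j k m : nat).
Implicit Types (w : nat -> bool) (s : {perm 'I_m.+2}).

Definition bit_letter (b : bool) : 'I_m.+2 := inord b.

Lemma bit_letter_val b : bit_letter b = b :> nat.
Proof. by rewrite inordK //; case: b. Qed.

Lemma bit_letter_inj : injective bit_letter.
Proof. by move=> b c /(congr1 val); rewrite /= !bit_letter_val; case: b; case: c. Qed.

Definition not_dvd l : seq bool := [:: ~~ (l %| i); ~~ (l %| j); ~~ (l %| k)].

(* The orbit length [l] of a permutation whose powers i, j and k act on some pair of letters
   as the identity or as the transposition. *)
Definition halving l := [&& 0 < l, l %| 2 * i, l %| 2 * j & l %| 2 * k].

(** If l divides 2x but not x, the 2-adic valuation of x is one below that of l. So a vector with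
    some [true] marks the exponents of least 2-adic valuation, whatever the length is. *)
Lemma halving_not_dvd l l' : halving l -> halving l' ->
  has id (not_dvd l) -> has id (not_dvd l') -> not_dvd l = not_dvd l'.
Proof.
have imp a b x y : 0 < a -> a %| 2 * x -> b %| 2 * x -> a %| 2 * y -> b %| 2 * y ->
    ~~ (a %| x) -> ~~ (b %| y) -> ~~ (b %| x).
  move=> a0 /dvdnP[c xc] _ /dvdnP[c' yc'] /dvdnP[d' yd'] ax bY; apply/negP => /dvdnP[d xd].
  have co : odd c.
    apply: contraR ax => /even_halfK c2; apply/dvdnP; exists c./2.
    by move: xc; rewrite -{1}c2 -!mul2n -mulnA => /eqP; rewrite eqn_pmul2l // => /eqP.
  have do' : odd d'.
    apply: contraR bY => /even_halfK c2; apply/dvdnP; exists d'./2.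
    by move: yd'; rewrite -{1}c2 -!mul2n -mulnA => /eqP; rewrite eqn_pmul2l // => /eqP.
  have : a * (c * d') = a * (2 * (d * c')).
    by transitivity (c * a * d'); [lia | rewrite -xc xd; transitivity (2 * d * (d' * b)); [lia | rewrite -yd' yc'; lia]].
  move/eqP; rewrite eqn_pmul2l // => /eqP/(congr1 odd).
  by rewrite !oddM co do'.
have get x l0 : halving l0 -> x \in [:: i; j; k] -> l0 %| 2 * x.
  by case/and4P=> _ h1 h2 h3; rewrite !inE => /or3P[] /eqP->.
have hasP' l0 : has id (not_dvd l0) -> exists2 y, y \in [:: i; j; k] & ~~ (l0 %| y).
  rewrite /= orbF => /or3P[] h; [exists i | exists j | exists k] => //; rewrite !inE eqxx ?orbT //.
move=> hl hl' /hasP'[y yI yl] /hasP'[y' yI' yl'].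
have [l0 l'0] : 0 < l /\ 0 < l' by case/and4P: hl => -> _ _ _; case/and4P: hl' => ->.
have E x : x \in [:: i; j; k] -> ~~ (l %| x) = ~~ (l' %| x).
  move=> xI; apply/idP/idP => h.
    by apply: (imp l l' x y') => //; apply: get.
  by apply: (imp l' l x y) => //; apply: get.
by rewrite /not_dvd !E // !inE eqxx ?orbT.
Qed.

Lemma halving_type l : halving l ->
  mod_type i j k l = eq_type false (~~ (l %| i)) (~~ (l %| j)) (~~ (l %| k)).
Proof.
case/and4P=> l0 di dj dk.
have key x y : l %| 2 * x -> l %| 2 * y ->
    (x %% l == y %% l) = (~~ (l %| x) == ~~ (l %| y)).
  have half z : l %| 2 * z -> ~~ (l %| z) -> 2 * (z %% l) = l.
    move=> d; rewrite /dvdn => z0; have zl := ltn_pmod z l0.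
    move: d; rewrite {1}(divn_eq z l) mulnDr dvdn_addr; last by rewrite mulnA dvdn_mull.
    by case/dvdnP=> -[|[|c]] E; move: E z0 zl; clear; nia.
  move=> dx dy; have hx := half x dx; have hy := half y dy.
  have [xl|xl] := boolP (l %| x); have [yl|yl] := boolP (l %| y); rewrite ?eqxx.
  - by move: xl yl; rewrite /dvdn => /eqP-> /eqP->.
  - by move: xl yl; rewrite /dvdn => /eqP-> y0; rewrite eq_sym (negPf y0).
  - by move: yl xl; rewrite /dvdn => /eqP-> x0; rewrite (negPf x0).
  - by rewrite -(eqn_pmul2l (isT : 0 < 2)) hx // hy // eqxx.
have z0 : l %| 2 * 0 by rewrite muln0 dvdn0.
by rewrite /mod_type /eq_type !key // dvdn0.
Qed.

(** Each block of a binary instance equals the first or its complement. If the first block contains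
    both letters, the powers act on this pair of letters, which makes the orbit length [halving]. *)
Lemma binary_occurs w s N n : 0 < n -> occurs i j k (bit_letter \o w) s N n n ->
  exists e1 e2 e3,
  [/\ forall t, t < n -> [/\ w (N + n + t) = w (N + t) (+) e1,
        w (N + 2 * n + t) = w (N + t) (+) e2 & w (N + 3 * n + t) = w (N + t) (+) e3],
      types i j k m.+2 (eq_type false e1 e2 e3) &
      (forall t, t < n -> w (N + t) = w N) \/
      exists l, [/\ halving l, l <= m.+2 & not_dvd l = [:: e1; e2; e3]]].
Proof.
move=> n0 occ.
pose e c := w N (+) w (N + c * n).
have occ0 := occ 0 n0; rewrite !addn0 /= in occ0.
have ty : types i j k m.+2 (eq_type false (e 1) (e 2) (e 3)).
  have := types_perm s (bit_letter (w N)) i j k; case: occ0 => <- <- <-.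
  rewrite (eq_type_inj _ _ _ _ bit_letter_inj) /e mul1n.
  by rewrite /eq_type; case: (w N); do 3!case: (w (N + _)).
have [/forallP cst|/forallPn/=[u]] := boolP [forall t : 'I_n, w (N + t) == w N].
  have cst' t : t < n -> w (N + t) = w N by move=> tn; apply/eqP: (cst (Ordinal tn)).
  exists (e 1), (e 2), (e 3); split=> //; last by left.
  move=> t tn; have [] := occ t tn; rewrite /= cst' //; case: occ0 => <- <- <-.
  do 3!move/bit_letter_inj->.
  by rewrite /e mul1n; case: (w N); do 3!case: (w (N + _)).
move=> wu; set l := orb s (bit_letter false).
have un := ltn_ord u; have occu := occ u un.
have key x b b' : (s ^+ x)%g (bit_letter (w N)) = bit_letter b ->
    (s ^+ x)%g (bit_letter (w (N + u))) = bit_letter b' ->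
    [/\ b' = w (N + u) (+) (w N (+) b), (l %| x) = ~~ (w N (+) b) & l %| 2 * x].
  move=> E E'; have bb : b != b'.
    apply: contraNneq wu => bb; rewrite bb -E' in E.
    by apply/eqP/bit_letter_inj/(@perm_inj _ (s ^+ x)%g).
  have b'E : b' = w (N + u) (+) (w N (+) b) by case: (b) (b') (w N) (w (N + u)) wu bb => [] [] [] [].
  have act c : (s ^+ x)%g (bit_letter c) = bit_letter (c (+) (w N (+) b)).
    have [->|cN] := eqVneq c (w N); first by rewrite E; congr bit_letter; case: (w N); case: (b).
    have -> : c = w (N + u) by case: (c) (w N) (w (N + u)) wu cN => [] [] [].
    by rewrite E' b'E.
  have dv y : (l %| y) = ((s ^+ y)%g (bit_letter false) == bit_letter false).
    by rewrite -[X in _ == X]perm1 -(expg0 s) eq_perm_mod mod0n.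
  split=> //; first by rewrite dv act (inj_eq bit_letter_inj); case: (w N (+) b).
  by rewrite dv mulnC mulnC -[2]/(1 + 1) mulnDl mul1n expgD permM !act addbK.
have [E1 E2 E3] := occ0; have [F1 F2 F3] := occu.
have [f1 d1 h1] := key _ _ _ (esym E1) (esym F1).
have [f2 d2 h2] := key _ _ _ (esym E2) (esym F2).
have [f3 d3 h3] := key _ _ _ (esym E3) (esym F3).
exists (e 1), (e 2), (e 3); split=> //; last first.
  right; exists l; split; last by rewrite /not_dvd d1 d2 d3 !negbK /e mul1n.
    by rewrite /halving h1 h2 h3 orb_gt0.
  exact: orb_le.
move=> t tn; have [] := occ t tn; rewrite /= /e mul1n.
have [->|tN] := eqVneq (w (N + t)) (w N).
  case: occ0 => <- <- <-; do 3!move/bit_letter_inj->.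
  by case: (w N); do 3!case: (w (N + _)).
have -> : w (N + t) = w (N + u) by case: (w (N + t)) (w N) (w (N + u)) wu tN => [] [] [].
by case: occu => /= <- <- <-; do 3!move/bit_letter_inj->.
Qed.

End Binary.

(** Without these, the types on two letters are aaaa, aaab, abab and abbb. *)
Definition ty_G3 := [:: ty_aaba; ty_aabb; ty_abaa; ty_abba].

Definition binary_A := [:: 0; 1; 0; 0; 1; 1; 0; 0; 1; 0].
Definition binary_B := [:: 0; 1; 0; 0; 1; 1; 0; 1; 1; 0].
(** What remains possible once some [halving] length yields aaab or abbb: an instance whose first
    block is not constant never shows abab. *)
Definition binary_adm (cols : seq column) :=
  if all (fun c => column_type c \notin ty_G3) cols then
    if all (fun c => entry c 0 == entry (head (0, 0, 0, 0) cols) 0) cols then true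
    else all (fun c => column_type c \in [:: ty_aaaa; ty_aaab; ty_abbb]) cols
  else false.

Lemma binary_certificate : certificate binary_A binary_B 10 4 0 25 7 binary_adm.
Proof. by vm_compute. Qed.

Section BinaryAvoidable.

Variables (i j k m : nat).
Hypothesis tyN : forall tau, tau \in ty_G3 -> ~~ types i j k m.+2 tau.

Lemma binary_diff e1 e2 e3 : types i j k m.+2 (eq_type false e1 e2 e3) ->
  [:: e1; e2; e3] \in [:: [:: false; false; false]; [:: false; false; true];
                         [:: true; false; true]; [:: true; true; true]].
Proof.
move=> ty; have N tau : tau \in ty_G3 -> eq_type false e1 e2 e3 <> tau.
  by move=> tG E; case/negP: (tyN tG); rewrite -E.
have := N ty_aaba isT; have := N ty_aabb isT; have := N ty_abaa isT; have := N ty_abba isT.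
by case: (e1) (e2) (e3) => [] [] [].
Qed.

(** Only vectors (e, 0, e) survive, since constant blocks of another type would give three equal
    neighbours. Shifting by [n] then adds [e] throughout, and the differences, which form the
    Fibonacci word, have period [n] on [4 * n - 1] letters. *)
Lemma fibonacci_avoidable :
  (forall l, halving i j k l -> l <= m.+2 ->
     not_dvd i j k l \in [:: [:: false; false; false]; [:: true; false; true]]) ->
  avoidable i j k m.+2.
Proof.
move=> hl; pose w t := odd (count fibonacci_word (iota 0 t)).
have wS t : w t.+1 = w t (+) fibonacci_word t.
  by rewrite /w -addn1 iotaD count_cat /= add0n addn0 oddD; case: fibonacci_word.
apply/avoidable_occurs; exists (@bit_letter m \o w) => s N n n0 /(binary_occurs n0).
case=> e1 [e2 [e3 [E ty half]]].
have const3 p : w p = w p.+1 -> w p.+1 = w p.+2 -> False.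
  rewrite !wS => h1 h2; have f1 : ~~ fibonacci_word p by case: (w p) h1; case: fibonacci_word.
  by have := fib_not_false2 f1; move: h2; case: (w p (+) _); case: fibonacci_word.
have {hl ty half} : e2 = false /\ e1 = e3.
  have := binary_diff ty; case: half => [cst|[l [hll lm El]]] e123; last first.
    by have := hl l hll lm; rewrite El !inE => /orP[]/eqP[-> -> ->].
  have c0 t : t < n -> w (N + t) = w N by apply: cst.
  have c1 t : t < n -> w (N + n + t) = w N (+) e1 by move=> tn; have [-> _ _] := E t tn; rewrite c0.
  have c2 t : t < n -> w (N + 2 * n + t) = w N (+) e2 by move=> tn; have [_ -> _] := E t tn; rewrite c0.
  have c3 t : t < n -> w (N + 3 * n + t) = w N (+) e3 by move=> tn; have [_ _ ->] := E t tn; rewrite c0.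
  have b123 b N' : (forall c t, c < 3 -> t < n -> w (N' + c * n + t) = b) -> False.
    move=> H; have H' u : u < 3 * n -> w (N' + u) = b.
      move=> un; rewrite (divn_eq u n) addnA H ?ltn_mod //.
      by rewrite ltn_divLR.
    have := H' 0; have := H' 1; have := H' 2; rewrite addn0 addn1 addn2.
    move=> h2 h1 h0; have n3' : 2 < 3 * n by rewrite (leq_mul2l 3 1).
    by apply: (const3 N'); rewrite ?h0 ?h1 ?h2 // (ltn_trans _ n3').
  move: e123; rewrite !inE => /or4P[] /eqP[e1E e2E e3E]; rewrite ?e1E ?e2E ?e3E //; exfalso.
    apply: (b123 (w N) N) => c t; case: c => [|[|[|//]]] _ tn.
    - by rewrite mul0n addn0 c0.
    - by rewrite mul1n c1 // e1E addbF.
    - by rewrite c2 // e2E addbF.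
  apply: (b123 (~~ w N) (N + n)) => c t; case: c => [|[|[|//]]] _ tn.
  - by rewrite mul0n addn0 c1 // e1E addbT.
  - by rewrite -(addnA N) -mulSn c2 // e2E addbT.
  - by rewrite -(addnA N) -mulSn c3 // e3E addbT.
case=> e20 e13; subst e2 e3; apply: (@fibonacci_power n N n0) => t tn.
have shift u : u < 3 * n -> w (N + u + n) = w (N + u) (+) e1.
  move=> un; have rn : u %% n < n by rewrite ltn_mod.
  have [E1 E2 E3] := E _ rn; have : u %/ n < 3 by rewrite ltn_divLR.
  rewrite {-1}(divn_eq u n); case: (u %/ n) => [|[|[|//]]] _.
  - by rewrite mul0n add0n -addnA [_ + n]addnC addnA E1.
  - rewrite mul1n (_ : N + (n + u %% n) + n = N + 2 * n + u %% n); last lia.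
    by rewrite [N + (n + _)]addnA E2 E1 addbK addbF.
  - rewrite (_ : N + (2 * n + u %% n) + n = N + 3 * n + u %% n); last lia.
    by rewrite [N + (2 * n + _)]addnA E3 E2 addbF.
have fE p : fibonacci_word p = w p (+) w p.+1 by rewrite wS addKb.
have h1 : w (N + t + n) = w (N + t) (+) e1 by apply: shift; lia.
have h2 : w (N + t.+1 + n) = w (N + t.+1) (+) e1 by apply: shift; lia.
move: h2; rewrite !fE addnS addSn h1 => ->.
by case: (w (N + t)); case: (w (N + t).+1); case: (e1).
Qed.

(** All nontrivial halving lengths yield one vector. The Fibonacci sums suit abab or no such vector,
    the certified morphic word suits aaab and abbb. *)
Lemma binary_avoidable : avoidable i j k m.+2.
Proof.
pose bad l := halving i j k l &&
  ((not_dvd i j k l == [:: false; false; true]) || (not_dvd i j k l == [:: true; true; true])).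
have [/hasP[l lm /andP[hl /orP lb]]|/hasPn nb] := boolP (has bad (iota 1 m.+2)); last first.
  apply: fibonacci_avoidable => l hl lm; have l0 : 0 < l by case/andP: hl.
  have /nb : l \in iota 1 m.+2 by rewrite mem_iota; lia.
  rewrite /bad hl /=; have : types i j k m.+2 (eq_type false (~~ (l %| i)) (~~ (l %| j)) (~~ (l %| k))).
    by apply/hasP; exists l; rewrite ?halving_type // mem_iota; lia.
  move/binary_diff; rewrite -[[:: _; _; _]]/(not_dvd i j k l) !inE => /or4P[] ->; rewrite ?orbT //.
apply/avoidable_occurs; pose W := morphic_word binary_A binary_B 10.
have W2 t : W t < 2 by apply: morphic_word_lt.
pose w t := W t == 1; exists (@bit_letter m \o w) => s N n n0 /(binary_occurs n0).
case=> e1 [e2 [e3 [E ty half]]].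
have WE t : W t = w t by rewrite /w; case: (W t) (W2 t) => [|[]].
have isoE p e : (forall t, t < n -> w (p + t) = w (N + t) (+) e) -> iso W N p n.
  move=> H x y xn yn; rewrite !WE !H //.
  by case: (w (N + x)); case: (w (N + y)); case: (e).
have i1 := isoE (N + n) e1 (fun t tn => let: And3 h _ _ := E t tn in h).
have i2 := isoE (N + 2 * n) e2 (fun t tn => let: And3 _ h _ := E t tn in h).
have i3 := isoE (N + 3 * n) e3 (fun t tn => let: And3 _ _ h := E t tn in h).
have colT c : c \in columns W N n 0 -> column_type c = eq_type false e1 e2 e3.
  case/mapP=> t; rewrite mem_iota add0n addn0 /= => tn ->.
  have [h1 h2 h3] := E t tn; rewrite /column_type /entry /= !WE h1 h2 h3.
  by case: (w (N + t)); case: (e1); case: (e2); case: (e3).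
have e123 := binary_diff ty.
have {half} half : ~~ all (fun c => entry c 0 == entry (head (0, 0, 0, 0) (columns W N n 0)) 0)
    (columns W N n 0) ->
    eq_type false e1 e2 e3 \in [:: ty_aaaa; ty_aaab; ty_abbb].
  case: half => [cst /allPn[c] /mapP[t]|[l' [hl' lm' El']] _].
    rewrite mem_iota add0n addn0 /= => tn ->; case: (n) n0 => // n' _.
    by rewrite /= !WE addn0 cst ?eqxx.
  have [e0|e0] := boolP (has id (not_dvd i j k l')).
    have d0 : has id (not_dvd i j k l) by case: lb => /eqP->.
    by have := halving_not_dvd hl hl' d0 e0; rewrite El'; case: lb => /eqP-> [<- <- <-].
  by move: e0; rewrite El' /= orbF !negb_or => /and3P[/negbTE-> /negbTE-> /negbTE->].
suff adm : binary_adm (columns W N n 0).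
  by have := certificateP binary_certificate n0 i1 i2 i3; rewrite adm.
rewrite /binary_adm; case: allP => [_|[]]; last first.
  by move=> c /colT ->; apply/negP => /tyN; rewrite ty.
case: ifPn => // /half h; apply/allP => c /colT->; exact: h.
Qed.

End BinaryAvoidable.

(** * Avoidable alphabets *)

Definition free (T : pred (seq bool)) (G : seq (seq bool)) := all (fun tau => ~~ T tau) G.

Definition certs := [:: cert0; cert1; cert2; cert3; cert4; cert5; cert6; cert7; cert8; cert9;
  cert10; cert11; cert12; cert13; cert14; cert15; cert16; cert17; cert18; cert19;
  cert20; cert21; cert22; cert23; cert24; cert25; cert26; cert27; cert28; cert29].

Definition certified m T := has (fun c => (cc c <= m) && free T (cert_types c)) certs.

Lemma certified_avoidable i j k m : certified m (types i j k m) -> avoidable i j k m.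
Proof.
have : foldr (fun c => and (cert_ok c)) True certs.
  split; first exact: cert0_ok.
  split; first exact: cert1_ok.
  split; first exact: cert2_ok.
  split; first exact: cert3_ok.
  split; first exact: cert4_ok.
  split; first exact: cert5_ok.
  split; first exact: cert6_ok.
  split; first exact: cert7_ok.
  split; first exact: cert8_ok.
  split; first exact: cert9_ok.
  split; first exact: cert10_ok.
  split; first exact: cert11_ok.
  split; first exact: cert12_ok.
  split; first exact: cert13_ok.
  split; first exact: cert14_ok.
  split; first exact: cert15_ok.
  split; first exact: cert16_ok.
  split; first exact: cert17_ok.
  split; first exact: cert18_ok.
  split; first exact: cert19_ok.
  split; first exact: cert20_ok.
  split; first exact: cert21_ok.
  split; first exact: cert22_ok.
  split; first exact: cert23_ok.
  split; first exact: cert24_ok.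
  split; first exact: cert25_ok.
  split; first exact: cert26_ok.
  split; first exact: cert27_ok.
  split; first exact: cert28_ok.
  split; first exact: cert29_ok.
  by [].
rewrite /certified; elim: certs => //= c L IHL [ok okL] /orP[/andP[cm /allP fr]|/(IHL okL)] //.
exact: cert_avoidable ok cm fr.
Qed.

Definition ty_toeplitz := map toeplitz_types
  [:: [:: true; true; false]; [:: false; false; true]; [:: true; true; true; false]].
Definition ty_loopless := [:: ty_abac; ty_abcb].
Definition ty_braid := [:: ty_aaba; ty_abac; ty_abba; ty_abcc].
Definition ty_braid_rev := [:: ty_aabc; ty_abaa; ty_abba; ty_abcb].

Definition spared4 (sq : bool) T :=
  [|| free T ty_G3, has (free T) ty_toeplitz | ~~ sq && free T ty_loopless].

(** Antitone in [T] and free of [m], so bad alphabets stay bad when enlarged. No certificate uses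
    more than five letters, whence the constant 5. *)
Definition spared (sq pr : bool) T :=
  [|| certified 5 T, spared4 sq T | ~~ pr && (free T ty_braid || free T ty_braid_rev)].

(* In these two exceptional cases the loopless, respectively braided, words do not help: every such
   word contains an instance ([square_meets], [spaced_meets]). *)
Definition square_mod i j k := all (types i j k 4) [:: ty_abab; ty_abca; ty_abcd].
Definition progression_mod60 i j k := all (progression_mod i j k) [:: 3; 4; 5].

(** If abcd is missing, [cert29] applies from five letters on; demanding it also forces [m > 3]. *)
Definition bad i j k m := types i j k m ty_abcd &&
  ~~ spared (square_mod i j k) (progression_mod60 i j k) (types i j k m).

(* [12 = lcm (1, 2, 3, 4)]: the residues determine [T_m] for [m <= 4]. *)
Definition residues := [seq (x, y) | x <- iota 0 12, y <- [seq (y, z) | y <- iota 0 12, z <- iota 0 12]].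
(** Either a construction applies or [m = 4] is bad. At [m = 3] the flag is set because the loopless
    induction starts with four letters; [false] for the progression flag makes the badness test the
    strictest one. *)
Definition settled_at m t := let: (i, (j, k)) := t in let T := types i j k m in
  let sq := square_mod i j k in
  if certified m T then true else if free T ty_G3 then true else
  if m == 2 then false else if spared4 ((m == 3) || sq) T then true else
  (m == 4) && T ty_abcd && ~~ spared sq false T.

Lemma settled_small : all (fun m => all (settled_at m) residues) [:: 2; 3; 4].
Proof. by vm_compute. Qed.

Lemma types_mod i j k m d : (forall l, 0 < l <= m -> l %| d) ->
  types (i %% d) (j %% d) (k %% d) m =1 types i j k m.
Proof.
move=> dv tau; apply: eq_in_has => l; rewrite mem_iota add1n ltnS => /dv ld.
by rewrite /mod_type !(modn_dvdm _ ld).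
Qed.

Lemma eq_free T T' : T =1 T' -> free T =1 free T'.
Proof. by move=> E G; apply: eq_all => tau; rewrite E. Qed.

Lemma eq_certified T T' m : T =1 T' -> certified m T = certified m T'.
Proof. by move=> E; apply: eq_has => c; rewrite (eq_free E). Qed.

Lemma eq_spared4 sq T T' : T =1 T' -> spared4 sq T = spared4 sq T'.
Proof. by move=> E; rewrite /spared4 !(eq_free E) (eq_has (eq_free E)). Qed.

Lemma eq_spared sq pr T T' : T =1 T' -> spared sq pr T = spared sq pr T'.
Proof. by move=> E; rewrite /spared !(eq_free E) (eq_certified _ E) (eq_spared4 _ E). Qed.

Lemma spared_progression sq pr T : spared sq pr T -> spared sq false T.
Proof. by case/or3P=> [h|h|/andP[_ h]]; rewrite /spared h ?orbT. Qed.

Lemma free_sub (T T' : pred (seq bool)) G : {subset T <= T'} -> free T' G -> free T G.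
Proof. by move=> sTT; apply: sub_all => tau; apply: contra => /sTT. Qed.

Lemma spared_sub sq pr (T T' : pred (seq bool)) : {subset T <= T'} ->
  spared sq pr T' -> spared sq pr T.
Proof.
move=> TT; have fr G : free T' G -> free T G := free_sub TT.
have hfr s : has (free T') s -> has (free T) s by apply: sub_has => G; apply: fr.
case/or3P=> [h|/or3P[h|h|/andP[f h]]|/andP[f /orP[]h]].
- apply/or3P/Or31; apply: sub_has h => c /andP[-> h]; exact: fr h.
- by apply/or3P/Or32; rewrite /spared4 (fr _ h).
- by apply/or3P/Or32; rewrite /spared4 (hfr _ h) orbT.
- by apply/or3P/Or32; rewrite /spared4 f (fr _ h) !orbT.
- by apply/or3P/Or33; rewrite f (fr _ h).
- by apply/or3P/Or33; rewrite f (fr _ h) orbT.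
Qed.

Section Avoid.

Variables i j k : nat.
Notation T := (types i j k).

Lemma freeP m G : free (T m) G -> forall tau, tau \in G -> ~~ T m tau.
Proof. by move/allP. Qed.

Lemma free_types m m' G : m <= m' -> free (T m') G -> free (T m) G.
Proof. by move=> mm; apply: free_sub => tau; apply: types_mono. Qed.

Lemma bad_le m m' : m <= m' -> bad i j k m -> bad i j k m'.
Proof.
move=> mm /andP[Tm sp]; rewrite /bad (types_mono mm Tm); apply: contra sp.
by apply: spared_sub => tau; apply: types_mono.
Qed.

(** Induction on [m]. If abca or abcd is missing a loopless certificate applies, and if abab is
    missing a new letter alternates with any avoiding word; otherwise it alternates with a loopless
    word over one letter less. Having all three types at four letters is [square_mod]. *)
Lemma ty_loopless_avoidable m : 3 < m -> ~~ square_mod i j k -> free (T m) ty_loopless ->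
  (forall m', 1 < m' < m -> avoidable i j k m') -> loopless_avoidable i j k m.
Proof.
elim: m => // m IHm m3 nsq fr av; have nT := freeP fr.
have [t1|t1] := boolP (T m.+1 ty_abca); last first.
  have cl : cert_loopless cert5 by vm_compute.
  apply: (cert_loopless_avoidable cert5_ok cl) => [|tau]; first exact: ltnW.
  by rewrite !inE => /or3P[]/eqP->; rewrite // nT.
have [t2|t2] := boolP (T m.+1 ty_abab); last first.
  apply: loopless_of_avoidable; last by apply: av; lia.
  by move=> tau; rewrite !inE => /or3P[]/eqP->; rewrite // nT.
have [t3|t3] := boolP (T m.+1 ty_abcd); last first.
  have cl : cert_loopless cert27 by vm_compute.
  apply: (cert_loopless_avoidable cert27_ok cl) => // tau.
  by rewrite !inE => /or3P[]/eqP->; rewrite // nT.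
have m4 : 3 < m.
  have [m3'|//] : m = 3 \/ 3 < m by move: m3; clear; lia.
  by rewrite m3' in t1 t2 t3; case/negP: nsq; rewrite /square_mod /= t1 t2 t3.
apply: (loopless_step nT); apply: IHm => // [|m' m'm]; first exact: free_types fr.
by apply: av; move: m'm; clear; lia.
Qed.

Lemma spared4_avoidable m (sq : bool) : 2 < m -> (3 < m -> square_mod i j k -> sq) -> (m <= 3 -> sq) ->
  (forall m', 1 < m' < m -> avoidable i j k m') ->
  spared4 sq (T m) -> avoidable i j k m.
Proof.
case: m => [|[|m]] // m2 sq4 sq3 av /or3P[fr|/hasP[G]|/andP[nsq fr]].
- exact: binary_avoidable (freeP fr).
- have av' : avoidable i j k m.+1 by apply: av; lia.
  by rewrite !inE => /or3P[]/eqP-> /freeP fr; apply: toeplitz_avoidable fr av';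
    [exact: toeplitz_ok_aab | exact: toeplitz_ok_bba | exact: toeplitz_ok_aaab].
have m3 : 3 < m.+2 by rewrite ltnNge; apply: contra nsq => /sq3->.
apply/loopless_avoidableW/ty_loopless_avoidable => //; exact: contra (sq4 m3) nsq.
Qed.

Theorem not_bad_avoidable m : 1 < m -> ~~ bad i j k m -> avoidable i j k m.
Proof.
elim/ltn_ind: m => m IHm m1 nb.
have {}IHm m' : 1 < m' < m -> avoidable i j k m'.
  by case/andP=> m'1 m'm; apply: IHm => //; apply: contra nb; apply: bad_le; apply: ltnW.
have sqm := @types_mod i j k 4 12 ltac:(by case=> [|[|[|[|[]]]]]).
have sq12 : square_mod (i %% 12) (j %% 12) (k %% 12) = square_mod i j k.
  by apply: eq_all => tau; rewrite sqm.
have small : m <= 4 -> settled_at m (i %% 12, (j %% 12, k %% 12)).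
  move=> m4; have := settled_small; move/allP => /(_ m).
  rewrite !inE; have -> : [|| m == 2, m == 3 | m == 4] by move: m1 m4; clear; lia.
  move=> /(_ isT)/allP; apply; apply: allpairs_f; first by rewrite mem_iota ltn_mod.
  by apply: allpairs_f; rewrite mem_iota ltn_mod.
have [m4|m4] := leqP m 4.
  have TE : types (i %% 12) (j %% 12) (k %% 12) m =1 T m.
    apply: types_mod => l /andP[l0 lm]; have : l <= 4 by apply: leq_trans lm m4.
    by case: l l0 {lm} => [|[|[|[|[]]]]].
  have := small m4; rewrite /settled_at sq12 (eq_certified _ TE) !(eq_free TE).
  case: ifP => [h _|_]; first exact: certified_avoidable h.
  case: ifP => [h _|_]; first by case: (m) m1 h => [|[|m']] // _ h; apply: binary_avoidable (freeP h).
  case: ifP => // m2; rewrite (eq_spared4 _ TE); case: ifP => [h _|_].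
    apply: spared4_avoidable h => //; first by move: m1 m2; clear; lia.
      by move=> _ ->; rewrite orbT.
    by move=> m3; rewrite (_ : m == 3) //; move: m1 m2 m3; clear; lia.
  rewrite TE (eq_spared _ _ TE) => /andP[/andP[_ Td] sp]; case/negP: nb.
  by rewrite /bad Td; apply: contra sp; apply: spared_progression.
have [Td|Td] := boolP (T m ty_abcd); last first.
  by apply: (cert_avoidable cert29_ok) => // tau; rewrite inE => /eqP->.
move: nb; rewrite /bad Td /= negbK => /or3P[h|h|/andP[npr h]].
- apply: certified_avoidable; apply: sub_has h => c /andP[c5 ->]; rewrite andbT.
  exact: leq_trans c5 m4.
- apply: spared4_avoidable h => //; first by move: m4; clear; lia.
  by rewrite leqNgt (ltnW m4).
have [d d345 npd] : exists2 d, d \in [:: 3; 4; 5] & ~~ progression_mod i j k d.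
  by apply/allPn.
have [x [xsp xav]] := unbraided_word m4 d345 npd.
apply/avoidable_occurs; case/orP: h => /freeP fr.
  by exists (braid x); apply: braid_avoids.
by exists (braid_rev x); apply: braid_rev_avoids.
Qed.

End Avoid.

(** * Unavoidable alphabets *)

(** In the six bits of a type, 0, 1, 3 compare the first three letters and 3, 4, 5 the last
    three. *)
Definition prefix3 (tau : seq bool) := [:: nth false tau 0; nth false tau 1; nth false tau 3].
Definition suffix3 (tau : seq bool) := [:: nth false tau 3; nth false tau 4; nth false tau 5].

(** The order matters: a bad [m] admits aaaa and abcd, and in the exceptional cases also abab and
    abca, so dropping two or four leading types shrinks the search. *)
Definition all_types := [:: ty_aaaa; ty_abcd; ty_abab; ty_abca; ty_aaab; ty_aaba; ty_aabb; ty_aabc; ty_abaa;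
  ty_abac; ty_abba; ty_abbb; ty_abbc; ty_abcb; ty_abcc].

Fixpoint sublists (X : seq (seq bool)) :=
  if X is tau :: X' then let L := sublists X' in L ++ map (cons tau) L else [:: [::]].

Definition ty_aaa := [:: true; true; true].
Definition ty_aab := [:: true; false; false].
Definition ty_aba := [:: false; true; false].
Definition ty_abb := [:: false; false; true].
Definition ty_abc := [:: false; false; false].

(* Strong connectivity of the graph whose vertices are the three-letter types and whose edges are
   the types in [X], stated through cuts. *)
Definition recurrent (X : seq (seq bool)) :=
  if all (fun tau => has (fun tau' => prefix3 tau' == suffix3 tau) X) X then
  all (fun U => 
    if has (fun tau => prefix3 tau \in U) X then
      if all (fun tau => prefix3 tau \in U) X then true
      else has (fun tau => if prefix3 tau \in U then suffix3 tau \notin U else false) X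
    else true) (sublists [:: ty_aaa; ty_aab; ty_aba; ty_abb; ty_abc])
  else false.

(** With x, y, z successive letters of a shorter word and a fixed letter a, the shapes below are:
    period three, xxyyzz, aaxaay, xxayya and xxxyyy. *)
Definition ty_period3 := [:: ty_aaba; ty_abaa; ty_abba; ty_abca].
Definition ty_doubled := [:: ty_aabb; ty_abba; ty_abbc].
Definition ty_aax := [:: ty_aaba; ty_abaa; ty_abbc].
Definition ty_axx := [:: ty_aabc; ty_abcc; ty_abba].
Definition ty_tripled := [:: ty_aaab; ty_aabb; ty_abbb].

Definition rigid_types (sq pr : bool) :=
  [:: [:: ty_abab]; ty_period3; ty_doubled; ty_aax; ty_axx; ty_tripled]
  ++ (if sq then [:: ty_loopless] else [::]) ++ (if pr then [:: ty_braid; ty_braid_rev] else [::]).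

(** The types recurring in an avoiding word are disjoint from [T_m]; so if the complement of [X] is
    spared, then [T_m], being smaller, is spared too. *)
Definition rigid sq pr X :=
  if spared sq pr (fun tau => tau \notin X) then true else
  if recurrent X then has (fun Y => all (mem Y) X) (rigid_types sq pr) else true.

Lemma rigid_recurrent : all (fun sp : bool * bool =>
    all (rigid sp.1 sp.2) (sublists (drop (if sp.1 || sp.2 then 4 else 2) all_types)))
  [:: (false, false); (true, false); (false, true); (true, true)].
Proof. by vm_compute. Qed.

Lemma recurrent_rigid sq pr X :
  X \in sublists (drop (if sq || pr then 4 else 2) all_types) -> rigid sq pr X.
Proof.
have /allP/(_ (sq, pr)) := rigid_recurrent.
have -> : (sq, pr) \in [:: (false, false); (true, false); (false, true); (true, true)].
  by case: sq; case: pr.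
by move=> /(_ isT)/allP H Xs; apply: (H X Xs).
Qed.

Lemma sublists_mask X b : mask b X \in sublists X.
Proof.
elim: X b => [|tau X IHX] [|[] b] //=; rewrite mem_cat ?IHX ?map_f ?orbT //.
by have := IHX nil; rewrite mask0s => ->.
Qed.

Lemma eq_type_all (U : eqType) (a b c d : U) : eq_type a b c d \in all_types.
Proof.
rewrite /eq_type; case: (a =P b) => ab; case: (a =P c) => ac; case: (a =P d) => ad;
  case: (b =P c) => bc; case: (b =P d) => bd; case: (c =P d) => cd;
  first [by [] | by exfalso; congruence].
Qed.

(** * Recurring window types *)

Section Windows.

Variables (m : nat) (w : nat -> 'I_m).

Definition window t := eq_type (w t) (w t.+1) (w t.+2) (w t.+3).

Lemma window_succ t : prefix3 (window t.+1) = suffix3 (window t).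
Proof. by []. Qed.

(* [X] collects the types that occur infinitely often. *)
Lemma recurrent_windows : exists N X, [/\ X \in sublists all_types, recurrent X,
  forall tau, tau \in X -> exists t, window (N + t) = tau & forall t, window (N + t) \in X].
Proof.
have tail L : exists N b, forall tau, tau \in L ->
    if tau \in mask b L then forall n, exists2 t, n <= t & window t = tau
    else forall t, N <= t -> window t <> tau.
  elim: L => [|tau L [N [b IHL]]]; first by exists 0, nil.
  have [io|] := classic (forall n, exists2 t, n <= t & window t = tau).
    exists N, (true :: b) => tau'; rewrite inE mask_cons inE.
    by case: eqP => [->|_ /IHL].
  move=> /not_all_ex_not[N' N'P]; exists (maxn N N'), (false :: b) => tau'.
  rewrite inE mask_cons /=; case: eqP => [->|_ /= /IHL]; last first.
    by case: ifP => // _ H t; rewrite geq_max => /andP[/H].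
  case: ifP => [tL _|_ _ t]; last first.
    by rewrite geq_max => /andP[_ Nt] E; apply: N'P; exists t.
  by have := IHL tau (mem_mask tL); rewrite tL.
have [N [b Nb]] := tail all_types; exists N, (mask b all_types).
have inX t : window (N + t) \in mask b all_types.
  have := Nb (window (N + t)) (eq_type_all _ _ _ _); case: ifP => // _ /(_ (N + t)).
  by rewrite leq_addr => /(_ isT).
have io tau n : tau \in mask b all_types -> exists2 t, n <= t & window (N + t) = tau.
  move=> tX; have := Nb tau (mem_mask tX); rewrite tX => /(_ (N + n))[t nt <-].
  by exists (t - N); rewrite ?subnKC //; lia.
split=> //; first exact: sublists_mask; last by move=> tau /(io _ 0)[t _ <-]; exists t.
rewrite /recurrent; set X := mask b _ in inX io *.
case: allP => [_|[]]; last first.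
  move=> tau /(io _ 0)[t _ <-]; apply/hasP; exists (window (N + t).+1); last exact/eqP/window_succ.
  by rewrite -addnS.
apply/allP => U _; case: hasP => // -[tau tX tU]; case: ifPn => // /allPn[tau' tX' tU'].
have [t _ Et] := io _ 0 tX; have [t' tt' Et'] := io _ t tX'.
(* On the way from a window with prefix in [U] to a later one with prefix outside [U], some step
   leaves [U]. *)
subst tau tau'; rewrite -(subnKC tt') in tU'; elim: (t' - t) tU' => [|d IHd] dU.
  by rewrite addn0 tU in dU.
have [dU'|/IHd//] := boolP (prefix3 (window (N + (t + d))) \in U).
apply/hasP; exists (window (N + (t + d))); first exact: inX.
by rewrite dU' -window_succ -addnS -addnS.
Qed.

End Windows.

Section Unavoided.

Variables (i j k m : nat).
Implicit Types (A : {set 'I_m}) (w y z : nat -> 'I_m) (s : {perm 'I_m}).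

(** The support of the permutation lies in [A], so that letters set aside outside [A] stay fixed
    when an occurrence is lifted. *)
Definition meets A w := exists s N n, [/\ perm_on A s, 0 < n & occurs i j k w s N n n].

Lemma meets_window A w t : (forall u, w u \in A) -> types i j k #|A| (window w t) -> meets A w.
Proof.
move=> wA /hasP[l]; rewrite mem_iota add1n ltnS => l0A /eqP/esym ty.
have [s sA [E1 E2 E3]] := realize_type l0A (wA _) (wA _) (wA _) (wA _) ty.
by exists s, t, 1; split=> // -[|//] _; rewrite !addn0 addn1 addn2 addn3 E1 E2 E3.
Qed.

Lemma meets_shift A w N0 : meets A (fun t => w (N0 + t)) -> meets A w.
Proof.
case=> s [N [n [sA n0 occ]]]; exists s, (N0 + N), n; split=> // t tn.
by have := occ t tn; rewrite !addnA.
Qed.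

Lemma meets_periodic A w p : 0 < p -> (forall t, w (t + p) = w t) -> meets A w.
Proof.
move=> p0 per; exists 1%g, 0, p; split=> // [|t _]; first exact: perm_on1.
rewrite !add0n !expg1n !perm1 -[p + t]addnC per (_ : 2 * p + t = t + p + p); last lia.
by rewrite (_ : 3 * p + t = t + p + p + p) ?per //; lia.
Qed.

Lemma meets_lift A (B : {set 'I_m}) w y N0 p (f : nat -> option 'I_m) : 0 < p -> A \subset B ->
  (forall c a, f c = Some a -> a \notin A) ->
  (forall t c, c < p -> w (N0 + (p * t + c)) = if f c is Some a then a else y t) ->
  meets A y -> meets B w.
Proof.
move=> p0 AB fA wE [s [N [n [sA n0 occ]]]].
exists s, (N0 + p * N), (p * n); rewrite muln_gt0 p0; split=> // [|t tpn].
  exact: subset_trans sA AB.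
have sfix c a e : f c = Some a -> (s ^+ e)%g a = a.
  move/fA => aA; elim: e => [|e IHe]; first by rewrite expg0 perm1.
  by rewrite expgSr permM IHe (out_perm sA).
have cp := ltn_pmod t p0; have qn : t %/ p < n by rewrite ltn_divLR // mulnC.
have E x : w (N0 + p * N + p * x + t) = if f (t %% p) is Some a then a else y (N + x + t %/ p).
  by rewrite -wE // -!addnA; congr w; rewrite {1}(divn_eq t p); lia.
have [h1 h2 h3] := occ _ qn.
have E0 := E 0; have E1 := E n; have E2 := E (2 * n); have E3 := E (3 * n).
rewrite muln0 !addn0 in E0; rewrite !(mulnCA _ p) E0 E1 E2 E3.
by case fc: (f _) => [a|//]; rewrite !(sfix _ _ _ fc).
Qed.

End Unavoided.

Lemma square_mod_types i j k : square_mod i j k -> 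
  [/\ types i j k 2 ty_abab, types i j k 3 ty_abca & types i j k 4 ty_abcd].
Proof.
have sqm := @types_mod i j k 4 12 ltac:(by case=> [|[|[|[|[]]]]]).
have T2 := @types_mod i j k 2 12 ltac:(by case=> [|[|[]]]).
have T3 := @types_mod i j k 3 12 ltac:(by case=> [|[|[|[]]]]).
have : all (fun t => let: (i, (j, k)) := t in
   square_mod i j k ==> [&& types i j k 2 ty_abab, types i j k 3 ty_abca & types i j k 4 ty_abcd])
   residues by vm_compute.
have sq12 : square_mod (i %% 12) (j %% 12) (k %% 12) = square_mod i j k.
  by apply: eq_all => tau; rewrite sqm.
move/allP => /(_ (i %% 12, (j %% 12, k %% 12))); rewrite sq12 T2 T3 sqm => h sq.
apply/and3P; move: h; rewrite sq; apply.
by apply: allpairs_f; [|apply: allpairs_f]; rewrite mem_iota ltn_mod.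
Qed.

Lemma uniq_leq_card (T : finType) (A : {set T}) (u : seq T) :
  uniq u -> {subset u <= A} -> size u <= #|A|.
Proof. by move=> /card_uniqP <- sA; apply: subset_leq_card; apply/subsetP. Qed.

(** * Instances in words without equal neighbours *)

Section Loopless.

Variables (i j k m : nat).

(** Descent on [A]. Without instances, abab, abca and abcd cannot occur, as they are realised on
    two, three and four letters. Then every other position carries one fixed letter, and the letters
    between form a loopless word without it, whose instance lifts. *)
Lemma square_meets (A : {set 'I_m}) y : square_mod i j k ->
  (forall t, y t \in A) -> (forall t, y t != y t.+1) -> meets i j k A y.
Proof.
move=> /square_mod_types[T2 T3 T4]; have [n] := ubnP #|A|.
elim: n A y => // n IHn A y An yA yy; apply: NNPP => nm.
have nT t : ~~ types i j k #|A| (window y t) by apply/negP => /(meets_window yA).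
have nty t tau u : types i j k (size u) tau -> uniq (map y u) -> window y t <> tau.
  move=> ty uu E; have := nT t; rewrite E; case/negP; apply: types_mono ty.
  by rewrite -(size_map y); apply: uniq_leq_card => // x /mapP[t' _ ->].
have C t : y t = y t.+2 -> y t.+1 != y t.+3.
  move=> e1; apply/negP => /eqP e2.
  apply: (nty t _ [:: t; t.+1] T2) => //=; first by rewrite inE yy.
  rewrite /window /eq_type -e1 -e2 !eqxx.
  by rewrite ![y t.+1 == _]eq_sym (negPf (yy t)).
have E t : y t != y t.+2 -> y t.+1 = y t.+3.
  move=> e1; apply/eqP/negPn/negP => e2.
  have [e3|e3] := eqVneq (y t) (y t.+3).
    apply: (nty t _ [:: t; t.+1; t.+2] T3) => //=; rewrite ?inE ?negb_or ?yy ?e1 //.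
    by rewrite /window /eq_type -e3 !eqxx ![_ == y t]eq_sym (negPf (yy t)) (negPf e1) (negPf (yy _)).
  apply: (nty t _ [:: t; t.+1; t.+2; t.+3] T4) => //=; rewrite ?inE ?negb_or ?yy ?e1 ?e2 ?e3 //.
  by rewrite /window /eq_type !(negPf (yy _)) (negPf e1) (negPf e2) (negPf e3).
have [N0 N0P] : exists N0, y N0 = y N0.+2.
  by have [e|/E e] := eqVneq (y 0) (y 2); [exists 0 | exists 1].
have alt t : y (N0 + 2 * t) = y N0 /\ y (N0 + 2 * t) = y (N0 + 2 * t).+2.
  elim: t => [|t [IH1 IH2]]; first by rewrite addn0.
  by rewrite mulnS addnCA add2n -IH2; split=> //; rewrite -(E _ (C _ IH2)).
apply: nm; apply: (@meets_lift i j k m (A :\ y N0) A y (fun t => y (N0 + 2 * t).+1) N0 2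
  (fun c => if c == 0 then Some (y N0) else None)) => //; first exact: subsetDl.
- by case=> //= a [<-]; rewrite !inE eqxx.
- by move=> t [|[|//]] _ /=; rewrite ?addn0 ?addn1 ?addnS; have [] := alt t.
apply: IHn => [|t|t]; first by have := cardsD1 (y N0) A; rewrite yA; move: An; clear; lia.
  by rewrite !inE yA andbT; have [<- _] := alt t; rewrite eq_sym yy.
by have [_ /C] := alt t; rewrite mulnS addnCA add2n.
Qed.

(** Outside [square_mod] a bad [m0] admits abac or abcb besides abcd. Excluding abac makes equality
    at distance two persist to the next position, excluding abcb makes inequality persist; what is
    left has period 2 or 3. *)
Lemma loopless_meets (A : {set 'I_m}) y m0 : bad i j k m0 -> m0 <= #|A| ->
  (forall t, y t \in A) -> (forall t, y t != y t.+1) -> meets i j k A y.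
Proof.
move=> /andP[Td]; rewrite negb_or negb_or => /and3P[_ + _] mA yA yy.
have [sq _|nsq] := boolP (square_mod i j k); first exact: square_meets.
rewrite !negb_or => /and3P[_ _ /allPn[tau tauI]]; rewrite negbK => Ttau.
apply: NNPP => nm.
have nT t : ~~ types i j k m0 (window y t).
  by apply/negP => /(types_mono mA)/(meets_window yA).
have step t : y t != y t.+2 -> y t.+1 != y t.+3 -> y t = y t.+3.
  move=> e1 e2; apply/eqP/negPn/negP => e3; have := nT t.
  by rewrite /window /eq_type !(negPf (yy _)) (negPf e1) (negPf e2) (negPf e3) Td.
have per2 N0 : (forall t, y (N0 + t) = y (N0 + t).+2) -> False.
  move=> P; apply: nm; apply: (@meets_shift _ _ _ _ _ _ N0); apply: (@meets_periodic _ _ _ _ _ _ 2) => // t.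
  by rewrite addn2 !addnS -P.
have per3 N0 : (forall t, y (N0 + t) = y (N0 + t).+3) -> False.
  move=> P; apply: nm; apply: (@meets_shift _ _ _ _ _ _ N0); apply: (@meets_periodic _ _ _ _ _ _ 3) => // t.
  by rewrite addn3 !addnS -P.
move: tauI Ttau; rewrite !inE => /orP[]/eqP-> Ttau.
  have C t : y t = y t.+2 -> y t.+1 = y t.+3.
    move=> e1; apply/eqP/negPn/negP => e2; have := nT t; rewrite /window /eq_type -e1 eqxx.
    have n3 : y t != y t.+3 by rewrite e1 yy.
    by rewrite (negPf (yy t)) [y t.+1 == y t]eq_sym (negPf e2) (negPf (yy t)) (negPf n3) Ttau.
  have [[N0 N0P]|nC] := classic (exists N0, y N0 = y N0.+2).
    by apply: (per2 N0); elim=> [|t IHt]; rewrite ?addn0 // addnS; apply: C.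
  have nC' t : y t != y t.+2 by apply/eqP => e; apply: nC; exists t.
  by apply: (per3 0) => t; apply: step.
have E t : y t != y t.+2 -> y t.+1 != y t.+3.
  move=> e1; apply/eqP => e2; have := nT t; rewrite /window /eq_type -e2 eqxx.
  have n3 : y t != y t.+3 by rewrite -e2 yy.
  by rewrite (negPf (yy t)) (negPf e1) (negPf (yy t.+1)) [_ == y t.+1]eq_sym (negPf (yy t.+1)) Ttau.
have [[N0 N0P]|nE] := classic (exists N0, y N0 != y N0.+2).
  have nE t : y (N0 + t) != y (N0 + t).+2 by elim: t => [|t IHt]; rewrite ?addn0 // addnS; apply: E.
  by apply: (per3 N0) => t; apply: step => //; rewrite -addnS nE.
apply: (per2 0) => t; apply/eqP/negPn/negP => e; case: nE; by exists t.
Qed.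

End Loopless.

Lemma perm_onX (T : finType) (A : {set T}) (s : {perm T}) n : perm_on A s -> perm_on A (s ^+ n)%g.
Proof.
by move=> sA; elim: n => [|n IHn]; rewrite ?expg0 ?perm_on1 // expgS; apply: perm_onM.
Qed.

(** * Instances in spaced words *)

Section Spaced.

Variables (i j k m : nat).

(** On [d] distinct letters repeated cyclically take the [u]-th power of their cycle, [u] inverse to
    [i] modulo [d]: its powers i, j, k shift by 1, 2, 3. *)
Lemma cyclic_progression (A : {set 'I_m}) (y : nat -> 'I_m) N d L :
  1 < d -> progression_mod i j k d -> uniq [seq y (N + t) | t <- iota 0 d] ->
  (forall t, y t \in A) -> (forall t, t + d < L -> y (N + t + d) = y (N + t)) ->
  exists2 s : {perm 'I_m}, perm_on A s & forall t,
    [/\ t + 1 < L -> (s ^+ i)%g (y (N + t)) = y (N + t + 1),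
        t + 2 < L -> (s ^+ j)%g (y (N + t)) = y (N + t + 2) &
        t + 3 < L -> (s ^+ k)%g (y (N + t)) = y (N + t + 3)].
Proof.
move=> d1 /and3P[/eqP j2 /eqP k3 co] uy yA per.
set Y := [seq _ | t <- _] in uy; have sY : size Y = d by rewrite size_map size_iota.
have yE t : t < L -> y (N + t) = nth (y 0) Y (t %% d).
  elim/ltn_ind: t => t IHt tL; have [td|td] := ltnP t d.
    by rewrite modn_small // (nth_map 0) ?size_iota // nth_iota.
  have := per (t - d); rewrite -addnA subnK // => -> //; rewrite IHt; try lia.
  by congr nth; rewrite -{2}(subnK td) modnDr.
have [c cY cE] := cycle_perm uy.
have d0 := ltnW d1; have i0 : 0 < i.
  by rewrite lt0n; apply: contraTneq co => ->; rewrite /coprime gcdn0; apply: contraTneq d1 => ->.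
have /(coprimeP _ i0)[[u v] /= uv] : coprime i d by rewrite coprime_sym.
have YA : [set x in Y] \subset A.
  by apply/subsetP => x; rewrite inE => /mapP[t _ ->].
exists (c ^+ u)%g; first exact: subset_trans (perm_onX u cY) YA.
have key e t : t + e < L -> (c ^+ (u * (e * i)))%g (y (N + t)) = y (N + t + e).
  move=> teL; rewrite -addnA !yE //; last by apply: leq_ltn_trans teL; apply: leq_addr.
  rewrite cE ?sY ?ltn_mod // modnDml; congr nth.
  have -> : u * (e * i) = e + e * v * d.
    by rewrite mulnCA (_ : u * i = 1 + v * d) ?mulnDr ?muln1 ?mulnA //; lia.
  by rewrite addnA [_ + _ * d]addnC modnMDl.
have mods x e : x = e * i %[mod d] -> forall t, t + e < L ->
    (c ^+ u ^+ x)%g (y (N + t)) = y (N + t + e).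
  move=> xe t teL; rewrite -expgM -(key e t teL) !yE; last by apply: leq_ltn_trans teL; apply: leq_addr.
  rewrite !cE ?sY ?ltn_mod //; congr nth; apply/eqP.
  by rewrite eqn_modDl -modnMmr xe modnMmr.
move=> t; split; [apply: mods; rewrite ?mul1n // | exact: mods | exact: mods].
Qed.

Lemma uniq_window (T : eqType) (y : nat -> T) N d :
  (forall a b, a < b < d -> y (N + a) != y (N + b)) -> uniq [seq y (N + t) | t <- iota 0 d].
Proof.
move=> H; rewrite map_inj_in_uniq ?iota_uniq // => a b; rewrite !mem_iota !add0n => /= ad bd E.
case: (ltngtP a b) => // ab; first by have := H a b; rewrite ab bd E eqxx => /(_ isT).
by have := H b a; rewrite ab ad E eqxx => /(_ isT).
Qed.

(** A window of [p + 2] letters is cyclic of period [p] if two successive letters return at distance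
    [p], of period [p + 1] if one returns at that distance, of period [p + 2] if all letters differ.
    Excluding these, returns at distance [p] happen at every other position. *)
Lemma alternating_returns (T : eqType) (y : nat -> T) p : 1 < p ->
  (forall t e, 0 < e < p -> y t != y (t + e)) ->
  (forall N d, p <= d <= p + 2 -> uniq [seq y (N + t) | t <- iota 0 d] ->
     ~ (forall t, t + d < p + 2 -> y (N + t + d) = y (N + t))) ->
  forall N, y N != y (N + p.+1) /\ (y N == y (N + p)) = (y N.+1 != y (N.+1 + p)).
Proof.
move=> p1 yd ncyc N.
have uniqP d : (forall a b, a < b < d -> p <= b - a -> y (N + a) != y (N + b)) ->
    uniq [seq y (N + t) | t <- iota 0 d].
  move=> H; apply: uniq_window => a b ab; have [lt|ge] := ltnP (b - a) p; last exact: H.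
  have := yd (N + a) (b - a); rewrite -addnA subnKC; last by case/andP: ab => /ltnW.
  by apply; rewrite subn_gt0 lt; case/andP: ab => ->.
have far : y N != y (N + p.+1).
  have [e|e] := eqVneq (y N) (y (N + p)).
    by rewrite e addnS -addn1; apply: yd.
  apply/eqP => e'; apply: (ncyc N p.+1); first by lia.
    apply: uniqP => a b ab pab; have [-> ->] : a = 0 /\ b = p by lia.
    by rewrite addn0.
  by case=> [|t] tp; [rewrite addn0 -e' | exfalso; lia].
split=> //; have [e|e] := eqVneq (y N) (y (N + p)); have [e'|e'] := eqVneq (y N.+1) (y (N.+1 + p)) => //.
  exfalso; apply: (ncyc N p); first by lia.
    by apply: uniqP => a b ab pab; exfalso; lia.
  move=> t tp; have [->|->] : t = 0 \/ t = 1 by lia.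
    by rewrite addn0 e.
  by rewrite addn1 e'.
exfalso; apply: (ncyc N (p + 2)); first by lia.
  apply: uniqP => a b ab pab.
  have [[-> ->]|[[-> ->]|[-> ->]]] : (a = 0 /\ b = p) \/ (a = 0 /\ b = p.+1) \/ (a = 1 /\ b = p.+1) by lia.
  - by rewrite addn0.
  - by rewrite addn0.
  - by rewrite addn1 addnS -addSn.
by move=> t tp; exfalso; lia.
Qed.

Hypothesis pr60 : progression_mod60 i j k.

Let pr d : 3 <= d <= 6 -> progression_mod i j k d.
Proof.
case/and4P: pr60 => p3 p4 p5 _ d36.
have [->|[->|[->|->]]] : d = 3 \/ d = 4 \/ d = 5 \/ d = 6 by lia.
- by [].
- by [].
- by [].
(* Modulus 6 combines modulus 3 with the parity contained in modulus 4. *)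
case/and3P: p3 p4 => /eqP j3 /eqP k3 co3 /and3P[/eqP j4 /eqP k4 co4].
apply/and3P; split.
- by lia.
- by lia.
have E6 : coprime 6 i = coprime 2 i && coprime 3 i by rewrite -coprimeMl.
have E4 : coprime 4 i = coprime 2 i && coprime 2 i by rewrite -coprimeMl.
by rewrite E6 co3 andbT; move: co4; rewrite E4 andbb.
Qed.

Lemma parity_progression : [/\ odd i, ~~ odd j & odd k].
Proof.
have /and3P[/eqP j4 /eqP k4 co4] := pr (isT : 3 <= 4 <= 6).
have E4 : coprime 4 i = coprime 2 i && coprime 2 i by rewrite -coprimeMl.
have oi : odd i by move: co4; rewrite E4 andbb coprime2n.
by split=> //; lia.
Qed.

(** Descent on [A], reversing [spread]. Without instances of period 1, every other letter of [x]
    returns at distance 3; without instances of period 2, every other letter of the subsequence [z]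
    of these returns at distance 4. So [x] is a spaced word [y] interleaved with two alternating
    separators, and an occurrence in [y] lifts to one of period [4 * n']. *)
Theorem spaced_meets (A : {set 'I_m}) x : (forall t, x t \in A) -> spaced x ->
  exists s N n, [/\ perm_on A s, 0 < n & occurs i j k x s N n n.+1].
Proof.
have [n] := ubnP #|A|; elim: n A x => // n IHn A x An xA xsp; apply: NNPP => nm.
have no s N n' : perm_on A s -> 0 < n' -> ~ occurs i j k x s N n' n'.+1.
  by move=> sA n0 occ; apply: nm; exists s, N, n'.
have xd t e : 0 < e < 3 -> x t != x (t + e).
  by have [x1 x2] := xsp t; case: e => [|[|[|]]] //; rewrite ?addn1 ?addn2.
have U := alternating_returns (p := 3) isT xd.
have {}U N : x N != x (N + 4) /\ (x N == x (N + 3)) = (x N.+1 != x (N.+1 + 3)).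
  apply: U => N' d d35 ud per.
  have d36 : 3 <= d <= 6 by lia.
  have d1 : 1 < d by lia.
  have [s sA sE] := cyclic_progression d1 (pr d36) ud xA per.
  apply: (no s N' 1 sA isT) => t t2; have [h1 h2 h3] := sE t.
  by rewrite h1 ?h2 ?h3; try lia; split; congr x; lia.
have [N0 N0P] : exists N0, x N0 == x (N0 + 3).
  by have [e|e] := boolP (x 0 == x (0 + 3)); [exists 0 | exists 1; have [_] := U 0; rewrite (negPf e) => /esym/negPn].
have {U} U t : [/\ x (N0 + 2 * t) == x (N0 + 2 * t + 3), x (N0 + 2 * t).+1 != x ((N0 + 2 * t).+1 + 3) &
    x (N0 + 2 * t) != x (N0 + 2 * t + 4)].
  have [u1 u2] := U (N0 + 2 * t); have [u3 u4] := U (N0 + 2 * t).+1.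
  suff e : x (N0 + 2 * t) == x (N0 + 2 * t + 3) by rewrite e u1 -u2 e.
  elim: t {u1 u2 u3 u4} => [|t IHt]; first by rewrite addn0.
  have [_ u2] := U (N0 + 2 * t); have [_ u4] := U (N0 + 2 * t).+1.
  rewrite IHt in u2; rewrite (negPf (esym u2)) in u4.
  by rewrite mulnS addnCA !addSn add0n; apply: negbNE; rewrite -u4.
pose z t := x (N0 + 2 * t).
have zE t : x (N0 + 2 * t + 3) = z t by have [/eqP] := U t.
have zd t e : 0 < e < 4 -> z t != z (t + e).
  case: e => [|[|[|[|//]]]] // _.
  - by rewrite /z mulnDr addnA; apply: xd.
  - by rewrite /z mulnDr addnA; have [_ _] := U t.
  - rewrite -zE (_ : z (t + 3) = x ((N0 + 2 * t.+1).+1 + 3)); last by congr x; lia.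
    by have [_ + _] := U t.+1; congr (x _ != _); lia.
have zA t : z t \in A by apply: xA.
have V := alternating_returns (p := 4) isT zd.
have {}V N : z N != z (N + 5) /\ (z N == z (N + 4)) = (z N.+1 != z (N.+1 + 4)).
  apply: V => N' d d46 ud per.
  have d36 : 3 <= d <= 6 by lia.
  have d1 : 1 < d by lia.
  have [s sA sE] := cyclic_progression d1 (pr d36) ud zA per.
  apply: (no s (N0 + 2 * N'.+1) 2 sA isT) => t t3.
  have [u u3 uE] : exists2 u, u < 3 & forall c, x (N0 + 2 * N'.+1 + c * 2 + t) = z (N' + u + c).
    case: t t3 => [|[|[|//]]] _; [exists 1 | exists 0 | exists 2] => // c.
    - by congr x; lia.
    - by rewrite -zE; congr x; lia.
    - by congr x; lia.
  have [h1 h2 h3] := sE u.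
  have u0 := uE 0; rewrite !addn0 in u0.
  rewrite (_ : _ + 2 + t = N0 + 2 * N'.+1 + 1 * 2 + t); last lia.
  by rewrite !uE u0 h1 ?h2 ?h3; try lia.
have [M0 M0P] : exists M0, z M0 == z (M0 + 4).
  by have [e|e] := boolP (z 0 == z (0 + 4)); [exists 0 | exists 1; have [_] := V 0; rewrite (negPf e) => /esym/negPn].
have {}V r : [/\ z (M0 + 2 * r) == z (M0 + 2 * r + 4) & z (M0 + 2 * r).+1 != z ((M0 + 2 * r).+1 + 4)].
  have [_ u2] := V (M0 + 2 * r).
  suff e : z (M0 + 2 * r) == z (M0 + 2 * r + 4) by rewrite e -u2 e.
  elim: r {u2} => [|r IHr]; first by rewrite addn0.
  have [_ u2] := V (M0 + 2 * r); have [_ u4] := V (M0 + 2 * r).+1.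
  rewrite IHr in u2; rewrite (negPf (esym u2)) in u4.
  by rewrite mulnS addnCA !addSn add0n; apply: negbNE; rewrite -u4.
pose P r := z (M0 + 2 * r); pose y r := z (M0 + 2 * r).+1.
have Pper r r' : odd r = odd r' -> P r = P r'.
  have P2 r0 : P r0 = P (odd r0).
    have PSS r1 : P r1.+2 = P r1.
      by have [/eqP e _] := V r1; rewrite /P e; congr z; lia.
    have Pd c b : P (b + c.*2) = P b by elim: c => [|c IHc]; rewrite ?addn0 // doubleS !addnS PSS.
    by rewrite -{1}(odd_double_half r0) Pd.
  by move=> rr; rewrite P2 (P2 r') rr.
have yP r r' : y r != P r'.
  have [e|e] := boolP (odd r' == odd r).
    rewrite (Pper r' r (eqP e)) eq_sym /P /y -[(_ + _).+1]addn1; exact: zd.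
  rewrite (Pper r' r.+1); last by move: e => /=; case: odd; case: odd.
  by rewrite /P /y mulnS addnCA addSn -[(_ + _).+2]addn1; apply: zd.
have PP r : P r != P r.+1 by rewrite /P mulnS addnCA (addnC 2); apply: zd.
have ysp : spaced y.
  move=> r; split; first by rewrite /y mulnS addnCA (addnC 2) -addSn; apply: zd.
  by have [_] := V r; rewrite /y; congr (_ != z _); lia.
have y_in r : y r \in A :\ P 0 :\ P 1 by rewrite !inE !yP zA.
have cA : #|A :\ P 0 :\ P 1| < n.
  have PA r : P r \in A by exact: zA.
  have P10 : P 1 \in A :\ P 0 by rewrite !inE PA andbT eq_sym PP.
  have := cardsD1 (P 0) A; have := cardsD1 (P 1) (A :\ P 0).
  by rewrite P10 PA; move: An; clear; lia.
have [s [N' [n' [sA n'0 occ]]]] := IHn _ y cA y_in ysp.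
(* A shift by an odd number of blocks exchanges the separators, so their transposition is built into
   the permutation; this fits because i and k are odd and j is even. *)
pose s' : {perm 'I_m} := if odd n' then (s * tperm (P 0%N) (P 1%N))%g else s.
have sA' : perm_on A s'.
  have sAA : perm_on A s by apply: subset_trans sA _; apply/subsetP => a; rewrite !inE => /and3P[].
  rewrite /s'; case: ifP => _ //; apply: perm_onM => //.
  apply: subset_trans (tperm_on _ _) _; apply/subsetP => a; rewrite !inE => /orP[]/eqP->; exact: zA.
have P01 r : P r = if odd r then P 1 else P 0.
  by case: ifPn => h; apply: Pper; rewrite ?h // (negPf h).
have fixP r : s (P r) = P r.
  by apply: (out_perm sA); rewrite P01; case: ifP => _; rewrite !inE eqxx ?andbF.
have s'P e r : (s' ^+ e)%g (P r) = P (r + e * n').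
  elim: e r => [|e IHe] r; first by rewrite mul0n addn0 expg0 perm1.
  have sPr : s' (P r) = P (r + n').
    rewrite /s'; case: ifPn => on; last by rewrite fixP; apply: Pper; rewrite oddD (negPf on) addbF.
    by rewrite permM fixP (P01 (r + n')) (P01 r) oddD on addbT; case: (odd r); rewrite ?tpermL ?tpermR.
  by rewrite expgS permM sPr IHe mulSn addnA.
have s'y e r : (s' ^+ e)%g (y r) = (s ^+ e)%g (y r).
  elim: e => [|e IHe]; first by rewrite !expg0.
  rewrite !expgSr !permM IHe /s'; case: ifP => // _; rewrite permM tpermD // eq_sym.
    by have := perm_closed (y r) (perm_onX e.+1 sA); rewrite y_in expgSr permM !inE => /and3P[].
  by have := perm_closed (y r) (perm_onX e.+1 sA); rewrite y_in expgSr permM !inE => /and3P[].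
have [oi oj ok] := parity_progression.
pose B := N0 + 2 * M0.
have xB r c : c < 4 -> x (B + (4 * r.+1 + c)) = if c is 1 then y r else if c is 2 then y r.+1 else P r.+1.
  case: c => [|[|[|[|//]]]] _.
  - by congr x; rewrite /B; lia.
  - by rewrite /y -zE; congr x; rewrite /B; lia.
  - by congr x; rewrite /B; lia.
  - by rewrite /P -zE; congr x; rewrite /B; lia.
apply: (no s' (B + 4 * N'.+1) (4 * n') sA'); first by rewrite muln_gt0.
move=> t tn; have c4 := ltn_pmod t (isT : 0 < 4).
have tE := divn_eq t 4; set u := t %/ 4 in tE; set c := t %% 4 in c4 tE.
have un : u <= n' by move: tE tn; clear; lia.
have cu : 0 < c -> u < n' by move: tE tn; clear; lia.
have E e : x (B + 4 * N'.+1 + e * (4 * n') + t) = x (B + (4 * (N' + e * n' + u).+1 + c)).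
  by congr x; rewrite tE; lia.
have E0 := E 0; have E1 := E 1; have E2 := E 2; have E3 := E 3.
rewrite !mul0n !addn0 in E0; rewrite !mul1n in E1.
rewrite E0 E1 E2 E3 !xB //.
have Pcase : [/\ P (N' + n' + u).+1 = (s' ^+ i)%g (P (N' + u).+1),
    P (N' + 2 * n' + u).+1 = (s' ^+ j)%g (P (N' + u).+1) &
    P (N' + 3 * n' + u).+1 = (s' ^+ k)%g (P (N' + u).+1)].
  by rewrite !s'P; split; apply: Pper; rewrite ?(oddD, oddM) /= ?(oddD, oddM) ?oi ?ok ?(negPf oj);
    case: (odd N'); case: (odd n'); case: (odd u).
have yocc v : v <= n' -> [/\ y (N' + n' + v) = (s' ^+ i)%g (y (N' + v)),
    y (N' + 2 * n' + v) = (s' ^+ j)%g (y (N' + v)) & y (N' + 3 * n' + v) = (s' ^+ k)%g (y (N' + v))].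
  by move=> vn; rewrite !s'y; apply: occ.
case: (c) c4 cu => [|[|[|[|//]]]] _ cu //; first exact: yocc.
by rewrite -!addnS; apply: yocc; apply: cu.
Qed.

End Spaced.

Section Cyclic.

Variables (m : nat) (w : nat -> 'I_m) (X : seq (seq bool)).
Hypothesis wX : forall t, window w t \in X.

(** In the graph given by [X] the three-letter types follow each other in the cyclic order [L], so
    the position modulo [size L] fixes the prefix of the window. *)
Definition rotates (L : seq (seq bool)) := 
  uniq L && all (fun tau => (prefix3 tau \in L) &&
                   (suffix3 tau == nth [::] L ((index (prefix3 tau) L).+1 %% size L))) X.

Lemma rotating_windows L : rotates L -> exists N0, forall t c, c < size L ->
  window w (N0 + (size L * t + c)) \in [seq tau <- X | prefix3 tau == nth [::] L c].
Proof.
case/andP=> uL /allP XL; pose r t := index (prefix3 (window w t)) L.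
have rL t : r t < size L by rewrite index_mem; case/andP: (XL _ (wX t)).
have L0 : 0 < size L := leq_ltn_trans (leq0n _) (rL 0).
have rS t : r t.+1 = (r t).+1 %% size L.
  have /andP[_ /eqP E] := XL _ (wX t).
  by rewrite /r window_succ E index_uniq // ltn_mod.
have rE t : r t = (r 0 + t) %% size L.
  elim: t => [|t IHt]; first by rewrite addn0 modn_small.
  by rewrite rS IHt -addn1 modnDml addn1 addnS.
exists (size L - r 0) => t c cL; rewrite mem_filter wX andbT; apply/eqP.
set u := _ + _; have ru : r u = c.
  rewrite rE /u addnA subnKC ?(ltnW (rL 0)) // addnA -mulnS mulnC modnMDl.
  by rewrite modn_small.
have /andP[+ _] := XL _ (wX u); move/(nth_index [::]) => <-.
by rewrite -/(r u) ru.
Qed.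

End Cyclic.

(** * Instances in the rigid shapes *)

Section Rigid.

Variables (i j k m : nat) (w : nat -> 'I_m.+1).
Hypothesis bad_m : bad i j k m.

Lemma window_bits t (U : eqType) (a b c d : U) : window w t = eq_type a b c d ->
  [/\ (w t == w (t + 1)) = (a == b), (w t == w (t + 2)) = (a == c) &
      (w t == w (t + 3)) = (a == d)] /\
  [/\ (w (t + 1) == w (t + 2)) = (b == c), (w (t + 1) == w (t + 3)) = (b == d) &
      (w (t + 2) == w (t + 3)) = (c == d)].
Proof. by rewrite addn1 addn2 addn3; case. Qed.

(** The letters in fixed positions are spared: at least [m] letters remain in [A], and badness of
    [m] yields an instance in the loopless word [y]. *)
Lemma meets_blocks (A : {set 'I_m.+1}) y N0 p (f : nat -> option 'I_m.+1) : 0 < p -> m <= #|A| ->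
  (forall c a, f c = Some a -> a \notin A) ->
  (forall t c, c < p -> w (N0 + (p * t + c)) = if f c is Some a then a else y t) ->
  (forall t, y t \in A) -> (forall t, y t != y t.+1) -> meets i j k [set: _] w.
Proof.
move=> p0 mA fA wE yA yy; apply: (meets_lift p0 (subsetT A) fA wE).
exact: loopless_meets bad_m mA yA yy.
Qed.

Lemma meets_uniform y N0 p : 0 < p ->
  (forall t c, c < p -> w (N0 + (p * t + c)) = y t) ->
  (forall t, y t != y t.+1) -> meets i j k [set: _] w.
Proof.
move=> p0 wE yy; apply: (@meets_blocks [set: _] y N0 p (fun=> None)) => // [|t].
  by rewrite cardsT card_ord leqnSn.
by rewrite inE.
Qed.

Lemma card_setTD1 (a : 'I_m.+1) : m <= #|[set: 'I_m.+1] :\ a|.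
Proof. by have := cardsD1 a [set: 'I_m.+1]; rewrite in_setT cardsT card_ord add1n => -[<-]. Qed.

Notation windows_in Y := (forall t, window w t \in Y).

Lemma meets_doubled : windows_in ty_doubled -> meets i j k [set: _] w.
Proof.
move=> wY; have [//|N0 H] := rotating_windows wY (L := [:: ty_aab; ty_abb]).
have {}H t : window w (N0 + 2 * t) = ty_aabb.
  by have := H t 0 isT; rewrite addn0 inE => /eqP.
apply: (@meets_uniform (fun t => w (N0 + 2 * t)) N0 2) => // [t [|[|//]] _|t].
- by rewrite addn0.
- by rewrite addnA; have [[/eqP/esym]] := window_bits (H t).
have [[_ /negbT]] := window_bits (H t).
by rewrite mulnSr addnA.
Qed.

Lemma meets_tripled : windows_in ty_tripled -> meets i j k [set: _] w.
Proof.
move=> wY; have [//|N0 H] := rotating_windows wY (L := [:: ty_aaa; ty_aab; ty_abb]).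
have {}H t : window w (N0 + 3 * t) = ty_aaab.
  by have := H t 0 isT; rewrite addn0 inE => /eqP.
apply: (@meets_uniform (fun t => w (N0 + 3 * t)) N0 3) => // [t c c3|t].
  have [[/eqP e1 /eqP e2 _] _] := window_bits (H t).
  by case: c c3 => [|[|[|//]]] _; rewrite addnA ?addn0.
have [[_ _ /negbT]] := window_bits (H t).
by rewrite mulnSr addnA.
Qed.

Lemma meets_aax : windows_in ty_aax -> meets i j k [set: _] w.
Proof.
move=> wY; have [//|N0 H] := rotating_windows wY (L := [:: ty_aab; ty_aba; ty_abb]).
have H0 t : window w (N0 + 3 * t) = ty_aaba.
  by have := H t 0 isT; rewrite addn0 inE => /eqP.
have H2 t : window w (N0 + 3 * t + 2) = ty_abbc.
  by have := H t 2 isT; rewrite addnA inE => /eqP.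
have a0 t : w (N0 + 3 * t) = w N0.
  elim: t => [|t IHt]; first by rewrite addn0.
  by rewrite mulnSr addnA -IHt; have [[_ _ /eqP/esym]] := window_bits (H0 t).
apply: (@meets_blocks ([set: _] :\ w N0) (fun t => w (N0 + 3 * t + 2)) N0 3
  (fun c => if c < 2 then Some (w N0) else None)) => //.
- exact: card_setTD1.
- by move=> c a; case: ifP => // _ [<-]; rewrite !inE eqxx.
- move=> t c c3; have [[/eqP e1 _ _] _] := window_bits (H0 t).
  by case: c c3 => [|[|[|//]]] _ /=; rewrite addnA ?addn0 // -?e1.
- move=> t; rewrite !inE andbT eq_sym -(a0 t).
  by have [[_ /negbT]] := window_bits (H0 t).
move=> t; have [[_ _ /negbT h] _] := window_bits (H2 t); move: h; congr (_ != w _); lia.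
Qed.

Lemma meets_axx : windows_in ty_axx -> meets i j k [set: _] w.
Proof.
move=> wY; have [//|N0 H] := rotating_windows wY (L := [:: ty_aab; ty_abc; ty_abb]).
have H0 t : window w (N0 + 3 * t) = ty_aabc.
  by have := H t 0 isT; rewrite addn0 inE => /eqP.
have H2 t : window w (N0 + 3 * t + 2) = ty_abba.
  by have := H t 2 isT; rewrite addnA inE => /eqP.
have a0 t : w (N0 + 3 * t + 2) = w (N0 + 2).
  elim: t => [|t IHt]; first by rewrite addn0.
  rewrite -IHt; have [[_ _ /eqP->] _] := window_bits (H2 t).
  by congr w; lia.
apply: (@meets_blocks ([set: _] :\ w (N0 + 2)) (fun t => w (N0 + 3 * t)) N0 3
  (fun c => if c < 2 then None else Some (w (N0 + 2)))) => //.
- exact: card_setTD1.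
- by move=> c a; case: ifP => // _ [<-]; rewrite !inE eqxx.
- move=> t c c3; have [[/eqP e1 _ _] _] := window_bits (H0 t).
  by case: c c3 => [|[|[|//]]] _ /=; rewrite addnA ?addn0 // -?e1.
- move=> t; rewrite !inE andbT -(a0 t).
  by have [[_ /negbT]] := window_bits (H0 t).
move=> t; have [[_ _ /negbT]] := window_bits (H0 t).
by rewrite mulnSr addnA.
Qed.

Lemma meets_loopless : square_mod i j k -> windows_in ty_loopless -> meets i j k [set: _] w.
Proof.
move=> sq wY; apply: (square_meets sq) => t; first by rewrite inE.
by have := wY t; rewrite !inE => /orP[] /eqP/window_bits[[/negbT]]; rewrite addn1.
Qed.

Lemma meets_period p : 0 < p < 4 -> (forall t, w t = w (t + p)) -> meets i j k [set: _] w.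
Proof. by case/andP=> p0 _ per; apply: (meets_periodic _ _ _ _ p0) => t; rewrite -per. Qed.

Lemma meets_abab : windows_in [:: ty_abab] -> meets i j k [set: _] w.
Proof.
move=> wY; apply: (@meets_period 2) => // t.
by have := wY t; rewrite inE => /eqP/window_bits[[_ /eqP]].
Qed.

Lemma meets_period3 : windows_in ty_period3 -> meets i j k [set: _] w.
Proof.
move=> wY; apply: (@meets_period 3) => // t.
by have := wY t; rewrite !inE => /or4P[]/eqP/window_bits[[_ _ /eqP]].
Qed.

Section Braids.

Hypothesis pr60 : progression_mod60 i j k.

(** A block reads [z t] and [z t.+1], so [4 * n] columns of [w] draw on [n.+1] columns of [z], which
    is what [spaced_meets] provides. *)
Lemma meets_braid_blocks z N0 (f : nat -> nat) : spaced z -> (forall c, f c <= 1) ->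
  (forall t c, c < 4 -> w (N0 + (4 * t + c)) = z (t + f c)) -> meets i j k [set: _] w.
Proof.
move=> zsp f1 wE.
have [s [N [n [sA n0 occ]]]] := spaced_meets pr60 (fun t => in_setT (z t)) zsp.
exists s, (N0 + 4 * N), (4 * n); rewrite muln_gt0 n0; split=> // t tn.
have c4 := ltn_pmod t (isT : 0 < 4); have tE := divn_eq t 4.
have un : t %/ 4 + f (t %% 4) < n.+1.
  have := f1 (t %% 4); have : t %/ 4 < n by rewrite ltn_divLR // mulnC.
  by lia.
have E e : w (N0 + 4 * N + e * (4 * n) + t) = z (N + e * n + (t %/ 4 + f (t %% 4))).
  by rewrite [N + e * n + _]addnA -wE //; congr w; rewrite {1}tE; lia.
have E0 := E 0; have E1 := E 1; have E2 := E 2; have E3 := E 3.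
rewrite !mul0n !addn0 in E0; rewrite !mul1n in E1.
by rewrite E0 E1 E2 E3; apply: occ.
Qed.

Lemma meets_braid : windows_in ty_braid -> meets i j k [set: _] w.
Proof.
move=> wY; have [//|N0 H] := rotating_windows wY (L := [:: ty_aab; ty_aba; ty_abc; ty_abb]).
have H0 t : window w (N0 + 4 * t) = ty_aaba.
  by have := H t 0 isT; rewrite addn0 inE => /eqP.
have H1 t : window w (N0 + 4 * t + 1) = ty_abac.
  by have := H t 1 isT; rewrite addnA inE => /eqP.
have H2 t : window w (N0 + 4 * t + 2) = ty_abcc.
  by have := H t 2 isT; rewrite addnA inE => /eqP.
have H3 t : window w (N0 + 4 * t + 3) = ty_abba.
  by have := H t 3 isT; rewrite addnA inE => /eqP.
pose z t := w (N0 + 4 * t).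
have z0 t : w (N0 + 4 * t + 1) = z t by have [[/eqP/esym]] := window_bits (H0 t).
have z3 t : w (N0 + 4 * t + 3) = z t by have [[_ _ /eqP/esym]] := window_bits (H0 t).
have z2 t : w (N0 + 4 * t.+1 + 2) = z t.
  by rewrite -z3; have [[_ _ /eqP->] _] := window_bits (H3 t); congr w; lia.
have zS t : z t != z t.+1.
  rewrite -z0 /z; have [[_ _ /negbT h] _] := window_bits (H1 t).
  by rewrite (_ : N0 + 4 * t.+1 = N0 + 4 * t + 1 + 3) //; lia.
apply: (@meets_braid_blocks z (N0 + 4) (fun c => if c == 2 then 0 else 1)).
- move=> t; split=> //; rewrite -z2 /z.
  have [[_ /negbT h] _] := window_bits (H2 t.+1).
  by rewrite (_ : N0 + 4 * t.+2 = N0 + 4 * t.+1 + 2 + 2) //; lia.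
- by move=> c; case: ifP.
move=> t c c4; rewrite (_ : N0 + 4 + _ = N0 + 4 * t.+1 + c); last lia.
by case: c c4 => [|[|[|[|//]]]] _ /=; rewrite ?addn0 ?(addn1 t) ?z0 ?z2 ?z3.
Qed.

Lemma meets_braid_rev : windows_in ty_braid_rev -> meets i j k [set: _] w.
Proof.
move=> wY; have [//|N0 H] := rotating_windows wY (L := [:: ty_aba; ty_abb; ty_aab; ty_abc]).
have H0 t : window w (N0 + 4 * t) = ty_abaa.
  by have := H t 0 isT; rewrite addn0 inE => /eqP.
have H1 t : window w (N0 + 4 * t + 1) = ty_abba.
  by have := H t 1 isT; rewrite addnA inE => /eqP.
have H2 t : window w (N0 + 4 * t + 2) = ty_aabc.
  by have := H t 2 isT; rewrite addnA inE => /eqP.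
pose z t := w (N0 + 4 * t).
have z1 t : w (N0 + 4 * t + 1) = z t.+1.
  by have [[_ _ /eqP->] _] := window_bits (H1 t); congr w; lia.
have z2 t : w (N0 + 4 * t + 2) = z t by have [[_ /eqP/esym]] := window_bits (H0 t).
have z3 t : w (N0 + 4 * t + 3) = z t by have [[_ _ /eqP/esym]] := window_bits (H0 t).
apply: (@meets_braid_blocks z N0 (fun c => if c == 1 then 1 else 0)).
- move=> t; have [[_ /negbT h1 /negbT h2] _] := window_bits (H2 t); rewrite z2 in h1 h2.
  rewrite (_ : N0 + 4 * t + 2 + 2 = N0 + 4 * t.+1) in h1; last lia.
  rewrite (_ : N0 + 4 * t + 2 + 3 = N0 + 4 * t.+1 + 1) ?z1 in h2; last lia.
  by split.
- by move=> c; case: ifP.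
move=> t c c4; rewrite addnA; case: c c4 => [|[|[|[|//]]]] _ /=; rewrite ?addn0 ?(addn1 t) //.
Qed.

End Braids.

Lemma rigid_meets Y : Y \in rigid_types (square_mod i j k) (progression_mod60 i j k) ->
  windows_in Y -> meets i j k [set: _] w.
Proof.
rewrite /rigid_types !mem_cat => /orP[].
  rewrite !inE => /or4P[/eqP->|/eqP->|/eqP->|/or3P[]/eqP->]; move=> wY.
  - exact: meets_abab.
  - exact: meets_period3.
  - exact: meets_doubled.
  - exact: meets_aax.
  - exact: meets_axx.
  - exact: meets_tripled.
case/orP; case: ifP => // h; rewrite !inE; first by move/eqP->; apply: meets_loopless.
by case/orP=> /eqP->; [apply: meets_braid | apply: meets_braid_rev].
Qed.

End Rigid.

(** * Bad alphabets admit no avoiding word *)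

Lemma types_abcd_gt3 i j k m : types i j k m ty_abcd -> 3 < m.
Proof.
move=> Td; rewrite ltnNge; apply/negP => m3.
have dv l : 0 < l <= 3 -> l %| 12 by case: l => [|[|[|[|]]]].
have := types_mono m3 Td; rewrite -(types_mod _ _ _ dv).
have /allP : all (fun t => let: (i, (j, k)) := t in ~~ types i j k 3 ty_abcd) residues.
  by vm_compute.
move=> /(_ (i %% 12, (j %% 12, k %% 12))) H; apply/negP; apply: H.
by apply: allpairs_f; [|apply: allpairs_f]; rewrite mem_iota ltn_mod.
Qed.

Lemma progression_types i j k : progression_mod60 i j k ->
  types i j k 2 ty_abab /\ types i j k 3 ty_abca.
Proof.
move=> pr; have [oi oj ok] := parity_progression pr.
have /and3P[/eqP j3 /eqP k3 co3] : progression_mod i j k 3 by case/and3P: pr.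
have i3 : i %% 3 = 1 \/ i %% 3 = 2.
  have : ~~ (3 %| i) by rewrite -prime_coprime.
  by rewrite /dvdn; have := ltn_pmod i (isT : 0 < 3); case: (i %% 3) => [|[|[|]]] //; auto.
split; apply/hasP; [exists 2 | exists 3] => //.
  by rewrite /mod_type !modn2 oi ok (negPf oj).
have -> : mod_type i j k 3 = eq_type 0 (i %% 3) (2 * (i %% 3) %% 3) 0.
  by rewrite /mod_type j3 k3 modnMmr modnMr.
by case: i3 => ->.
Qed.

Lemma bad_has_types i j k m : bad i j k m -> 
  [&& types i j k m ty_aaaa, types i j k m ty_abcd &
   square_mod i j k || progression_mod60 i j k ==>
     types i j k m ty_abab && types i j k m ty_abca].
Proof.
case/andP=> Td _; have m3 := types_abcd_gt3 Td; rewrite Td.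
apply/and3P; split=> //.
  by apply/hasP; exists 1; [rewrite mem_iota; lia | rewrite /mod_type !modn1].
apply/implyP; case/orP => [/and4P[Tb Tc _ _]|/progression_types[Tb Tc]].
  by rewrite !(types_mono m3).
by rewrite (types_mono _ Tb) ?(types_mono _ Tc) // ltnW // ltnW.
Qed.

Theorem bad_unavoidable i j k m : bad i j k m -> unavoidable i j k m.+1.
Proof.
move=> bad_m /avoidable_occurs[w w_av].
have [N [X [Xs rec Xw wX]]] := recurrent_windows w.
pose w' t := w (N + t).
have nm : ~ meets i j k [set: _] w'.
  by case=> s [N' [n [_ n0 occ]]]; apply: (@w_av s (N + N') n n0) => t tn;
     have := occ t tn; rewrite /w' !addnA.
have ww t : window w' t = window w (N + t) by rewrite /window /w' !addnS.
have XT tau : tau \in X -> ~~ types i j k m tau.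
  case/Xw=> t <-; rewrite -ww; apply/negP => ty; apply: nm.
  apply: (meets_window (t := t)) => [u|]; first by rewrite inE.
  by apply: types_mono ty; rewrite cardsT card_ord leqnSn.
have drop1 tau L : X \in sublists (tau :: L) -> types i j k m tau -> X \in sublists L.
  rewrite /= mem_cat => /orP[//|/mapP[X' _ XE] ty].
  by have := XT tau; rewrite XE inE eqxx ty => /(_ isT).
have /and3P[Ta Td Tbc] := bad_has_types bad_m.
have Xd := drop1 _ _ (drop1 _ _ Xs Ta) Td.
have : rigid (square_mod i j k) (progression_mod60 i j k) X.
  apply: recurrent_rigid; case: (_ || _) Tbc => [/andP[Tb Tc]|_]; last exact: Xd.
  exact: drop1 (drop1 _ _ Xd Tb) Tc.
rewrite /rigid; case: ifP => [sp _|_].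
  have /andP[_ /negP[]] := bad_m; apply: spared_sub sp => tau ty.
  by rewrite unfold_in; apply: contraL ty => /XT.
rewrite rec => /hasP[Y Yr /allP XY]; apply: nm; apply: (rigid_meets bad_m Yr) => t.
by apply: XY; rewrite ww.
Qed.

(** * Computability *)

(** Stated for functions of lists, so that arguments can be added and dropped without dependent
    types. *)
Definition computes n (F : seq nat -> nat) := exists e : mu_rec n, forall v : n.-tuple nat, evals e v (F v).

Lemma eq_computes n F G : (forall v, size v = n -> F v = G v) -> computes n F -> computes n G.
Proof. by move=> FG [e eF]; exists e => v; rewrite -FG ?size_tuple. Qed.

Lemma computes_proj n i : i < n -> computes n (fun v => nth 0 v i).
Proof.
move=> lti; exists (Proj (Ordinal lti)) => v.
by rewrite -[i]/(val (Ordinal lti)) -tnth_nth; apply: evals_proj.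
Qed.

Lemma computes_comp m n F (g : nat -> seq nat -> nat) : computes m F ->
  (forall i, i < m -> computes n (g i)) -> computes n (fun v => F (mkseq (g^~ v) m)).
Proof.
case=> e eF gE; have [d dE] : exists d : 'I_m -> mu_rec n, forall i v, evals (d i) v (g i v).
  by apply: (@fin_all_exists _ _ (fun i d => forall v : n.-tuple nat, evals d v (g (val i) v))) => i; exact: gE (ltn_ord i).
exists (Comp e d) => v; have sz : size (mkseq (g^~ v) m) == m by rewrite size_mkseq.
apply: (@evals_comp _ _ _ _ _ (Tuple sz)); last exact: eF.
by move=> i; rewrite (tnth_nth 0) /= nth_mkseq.
Qed.

Lemma computes_succ1 : computes 1 (fun v => (head 0 v).+1).
Proof.
exists Succ => v; have -> : v = [tuple head 0 v]; last exact: evals_succ.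
by apply: val_inj; case: v => [[|x []]].
Qed.

Lemma mkseq_cons (T : Type) (f : nat -> T) n : mkseq f n.+1 = f 0 :: mkseq (fun i => f i.+1) n.
Proof. by rewrite /mkseq /= (iotaDl 1 0) -map_comp. Qed.

Lemma computes_const n c : computes n (fun=> c).
Proof.
elim: c => [|c IHc].
  by apply: (@computes_comp 0 n (fun=> 0) (fun _ _ => 0)) => //; exists Zero => v; rewrite (tuple0 v); apply: evals_zero.
exact: (computes_comp (g := fun _ _ => c) computes_succ1).
Qed.

Lemma computes_succ n f : computes n f -> computes n (fun v => (f v).+1).
Proof.
by move=> cf; apply: (computes_comp (g := fun=> f) computes_succ1).
Qed.

Lemma computes_cons n a F : computes n a -> computes n.+1 F -> computes n (fun v => F (a v :: v)).
Proof.
move=> ca cF; have := computes_comp (g := fun i => if i is i'.+1 then nth 0 ^~ i' else a) cF.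
move=> H; apply: eq_computes (H n _) => [v sv|[_ //|i lti]]; last exact: computes_proj.
by rewrite mkseq_cons -{1}sv mkseq_nth.
Qed.

Lemma computes_behead n F : computes n F -> computes n.+1 (fun v => F (behead v)).
Proof.
move=> cF; have := computes_comp (g := fun i => nth 0 ^~ i.+1) cF.
move=> H; apply: eq_computes (H n.+1 _) => [[|a v] // [sv]|i lti]; last exact: computes_proj.
by congr F; rewrite -{2}(mkseq_nth 0 v) sv.
Qed.

Lemma computes_rec n a F G : computes n a -> computes n F -> computes n.+2 G ->
  computes n (fun v => nat_rect (fun=> nat) (F v) (fun x r => G [:: x, r & v]) (a v)).
Proof.
move=> ca [f fF] [g gG]; pose R u := nat_rect (fun=> nat) (F (behead u)) (fun x r => G [:: x, r & behead u]) (head 0 u).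
apply: (computes_cons (F := R) ca); exists (PRec f g) => u; rewrite (tuple_eta u) /R /=.
set v := behead_tuple u; rewrite -[behead u]/(val v).
elim: (thead u) => [|x IHx] /=; first by apply: evals_prec0; apply: fF.
by apply: evals_precS IHx _; apply: (gG [tuple of [:: x, _ & v]]).
Qed.

Definition computesb n (b : seq nat -> bool) := computes n b.

Lemma computes_if n c f g : computesb n c -> computes n f -> computes n g ->
  computes n (fun v => if c v then f v else g v).
Proof.
move=> cc cf cg; apply: eq_computes (computes_rec cc cg (computes_behead (computes_behead cf))) => v _.
by case: (c v).
Qed.

(** Any function of finitely many computable bits is a tree of conditionals; thus [spared] with all
    its tables needs no arithmetic encoding. *)
Lemma computes_bits n (bs : seq (seq nat -> bool)) (h : seq bool -> nat) :
  foldr (fun b P => computesb n b /\ P) True bs -> computes n (fun v => h [seq b v | b <- bs]).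
Proof.
elim: bs h => [|b bs IHbs] h /=; first by move=> _; apply: computes_const.
case=> cb cbs; have ct := IHbs (fun u => h (true :: u)) cbs; have cf := IHbs (fun u => h (false :: u)) cbs.
by apply: eq_computes (computes_if cb ct cf) => v _; case: (b v).
Qed.

Lemma computes_pred n f : computes n f -> computes n (fun v => (f v).-1).
Proof.
move=> cf; have c0 := computes_const n 0; have c1 : computes n.+2 (nth 0 ^~ 0) by apply: computes_proj.
by apply: eq_computes (computes_rec cf c0 c1) => v _; case: (f v).
Qed.

Lemma computes_add n f g : computes n f -> computes n g -> computes n (fun v => f v + g v).
Proof.
move=> cf cg; have c1 := computes_succ (@computes_proj n.+2 1 isT).
by apply: eq_computes (computes_rec cg cf c1) => v _; elim: (g v) => [|x /= ->]; rewrite ?addn0 ?addnS.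
Qed.

Lemma computes_sub n f g : computes n f -> computes n g -> computes n (fun v => f v - g v).
Proof.
move=> cf cg; have c1 := computes_pred (@computes_proj n.+2 1 isT).
by apply: eq_computes (computes_rec cg cf c1) => v _; elim: (g v) => [|x /= ->]; rewrite ?subn0 ?subnS.
Qed.

Lemma computesb_eq n f g : computes n f -> computes n g -> computesb n (fun v => f v == g v).
Proof.
move=> cf cg; have cd := computes_add (computes_sub cf cg) (computes_sub cg cf).
apply: eq_computes (computes_rec cd (computes_const n 1) (computes_const n.+2 0)) => v _.
have -> : (f v == g v) = (f v - g v + (g v - f v) == 0) by rewrite addn_eq0 !subn_eq0 -eqn_leq.
by case: (_ + _).
Qed.

Lemma computes_mod n f g : computes n f -> computes n g -> computes n (fun v => f v %% g v).
Proof.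
move=> cf cg; have c1 := computes_succ (@computes_proj n.+2 1 isT).
have ceq := computesb_eq c1 (computes_behead (computes_behead cg)).
apply: eq_computes (computes_rec cf (computes_const n 0) (computes_if ceq (computes_const _ 0) c1)) => v _ /=.
have [->|g0] := posnP (g v); first by rewrite modn0; elim: (f v) => //= x ->.
elim: (f v) => [|x /= ->]; first by rewrite mod0n.
have xg := ltn_pmod x g0.
have -> : x.+1 %% g v = (x %% g v).+1 %% g v by rewrite -(addn1 x) -(addn1 (x %% _)) modnDml.
by case: eqVneq => [->|e]; rewrite ?modnn // [RHS]modn_small // ltn_neqAle e.
Qed.

Lemma computesb_has n f (b : seq nat -> bool) : computes n f -> computesb n.+1 b ->
  computesb n (fun v => has (fun l => b (l :: v)) (iota 1 (f v))).
Proof.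
move=> cf cb; have cr : computesb n.+2 (fun w => nth 0 w 1 == 1).
  by apply: computesb_eq; [apply: computes_proj | apply: computes_const].
have cb2 : computes n.+2 (fun w => b ((head 0 w).+1 :: behead (behead w))).
  have := computes_comp (g := fun i => if i is i'.+1 then nth 0 ^~ i'.+2 else fun w => (nth 0 w 0).+1) cb.
  move=> H; apply: eq_computes (H n.+2 _) => [[|x [|y v]] // [sv]|[|i] lti].
  - by rewrite mkseq_cons /= -{2}(mkseq_nth 0 v); case: sv => ->.
  - exact/computes_succ/computes_proj.
  - exact: computes_proj.
apply: eq_computes (computes_rec cf (computes_const n 0) (computes_if cr (computes_const _ 1) cb2)) => v _ /=.
have hS x : has (fun l => b (l :: v)) (iota 1 x.+1) =
    has (fun l => b (l :: v)) (iota 1 x) || b (x.+1 :: v).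
  by rewrite -[in LHS](addn1 x) iotaD has_cat /= orbF add1n.
by elim: (f v) => [|x IHx] //; rewrite hS [LHS]/= IHx; case: has.
Qed.

Lemma computes_count n f (b : seq nat -> bool) : computes n f -> computesb n.+1 b ->
  computes n (fun v => count (fun l => b (l :: v)) (iota 0 (f v))).
Proof.
move=> cf cb; have cb2 : computes n.+2 (fun w => b (head 0 w :: behead (behead w))).
  have := computes_comp (g := fun i => if i is i'.+1 then nth 0 ^~ i'.+2 else nth 0 ^~ 0) cb.
  move=> H; apply: eq_computes (H n.+2 _) => [[|x [|y v]] // [sv]|[|i] lti].
  - by rewrite mkseq_cons /= -{2}(mkseq_nth 0 v); case: sv => ->.
  - exact: computes_proj.
  - exact: computes_proj.
have c1 := @computes_proj n.+2 1 isT.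
apply: eq_computes (computes_rec cf (computes_const n 0) (computes_add c1 cb2)) => v _ /=.
have hS x : count (fun l => b (l :: v)) (iota 0 x.+1) =
    count (fun l => b (l :: v)) (iota 0 x) + b (x :: v).
  by rewrite -[in LHS](addn1 x) iotaD count_cat /= addn0 add0n.
by elim: (f v) => [|x IHx] //; rewrite hS [LHS]/= IHx.
Qed.

(** * Deciding badness *)

Section ComputesBad.

Variables (n : nat) (fi fj fk : seq nat -> nat).
Hypotheses (ci : computes n fi) (cj : computes n fj) (ck : computes n fk).

Lemma computesb_types fm tau : computes n fm ->
  computesb n (fun v => types (fi v) (fj v) (fk v) (fm v) tau).
Proof.
move=> cm; pose l w := nth 0 w 0; have cl : computes n.+1 l by apply: computes_proj.
have c0 := computes_mod (computes_const n.+1 0) cl.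
have c1 := computes_mod (computes_behead ci) cl.
have c2 := computes_mod (computes_behead cj) cl.
have c3 := computes_mod (computes_behead ck) cl.
apply: (computesb_has (b := fun w => mod_type (fi (behead w)) (fj (behead w)) (fk (behead w)) (l w) == tau) cm).
apply: (computes_bits (bs := [:: _; _; _; _; _; _]) (fun u => u == tau)) => /=.
by do 6!(split; first by apply: computesb_eq; [exact: c0 || exact: c1 || exact: c2 || exact: c3 ..]).
Qed.

Lemma computes_mulc c f : computes n f -> computes n (fun v => c * f v).
Proof.
move=> cf; elim: c => [|c IHc]; first exact: computes_const.
exact: computes_add cf IHc.
Qed.

(** Coprimality is tested as non-divisibility by a prime; modulus 4 uses the prime 2. *)
Lemma computesb_progression d p : prime p -> (forall x, coprime d x = coprime p x) ->
  computesb n (fun v => progression_mod (fi v) (fj v) (fk v) d).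
Proof.
move=> pp dp; have cd := computes_const n d; have cp := computes_const n p.
have b1 := computesb_eq (computes_mod cj cd) (computes_mod (computes_mulc 2 ci) cd).
have b2 := computesb_eq (computes_mod ck cd) (computes_mod (computes_mulc 3 ci) cd).
have b3 := computesb_eq (computes_mod ci cp) (computes_const n 0).
apply: eq_computes (computes_bits (bs := [:: _; _; _])
  (fun u => [&& nth false u 0, nth false u 1 & ~~ nth false u 2]) (conj b1 (conj b2 (conj b3 I)))) => v _ /=.
by rewrite /progression_mod dp prime_coprime.
Qed.

Lemma computesb_bad fm : computes n fm -> computesb n (fun v => bad (fi v) (fj v) (fk v) (fm v)).
Proof.
move=> cm; have ct := computesb_types _ cm; have ct4 := computesb_types _ (computes_const n 4).
have csq : computesb n (fun v => square_mod (fi v) (fj v) (fk v)).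
  exact: (computes_bits (bs := [:: _; _; _]) (fun u => all id u)
    (conj (ct4 _) (conj (ct4 _) (conj (ct4 _) I)))).
have cpr : computesb n (fun v => progression_mod60 (fi v) (fj v) (fk v)).
  have c3 := @computesb_progression 3 3 isT (fun=> erefl).
  have c5 := @computesb_progression 5 5 isT (fun=> erefl).
  have c4 : computesb n (fun v => progression_mod (fi v) (fj v) (fk v) 4).
    by apply: (@computesb_progression 4 2) => // x; rewrite -[RHS]andbb -coprimeMl.
  exact: (computes_bits (bs := [:: _; _; _]) (fun u => all id u) (conj c3 (conj c4 (conj c5 I)))).
(* [bad] becomes a function of seventeen bits: two exceptional flags and membership of the fifteen
   types. *)
pose h u := let T tau := nth false (drop 2 u) (index tau all_types) in
  T ty_abcd && ~~ spared (nth false u 0) (nth false u 1) T.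
pose bs := [:: (fun v => square_mod (fi v) (fj v) (fk v)), (fun v => progression_mod60 (fi v) (fj v) (fk v))
  & map (fun tau v => types (fi v) (fj v) (fk v) (fm v) tau) all_types].
have cbs : foldr (fun b P => computesb n b /\ P) True bs.
  by split=> //; split=> //; elim: all_types => //= tau L; split.
apply: eq_computes (computes_bits h cbs) => v _.
have hE a b L : h [:: a, b & L] = let T tau := nth false L (index tau all_types) in
    T ty_abcd && ~~ spared a b T by rewrite /h /= drop0.
rewrite /bs 2!map_cons hE -map_comp.
have E tau : nth false [seq types (fi v) (fj v) (fk v) (fm v) tau | tau <- all_types] (index tau all_types)
     = types (fi v) (fj v) (fk v) (fm v) tau.
  have [tI|tN] := boolP (tau \in all_types).
    by rewrite (nth_map [::]) ?index_mem // nth_index.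
  have sz : size all_types <= index tau all_types by rewrite leqNgt index_mem.
  rewrite nth_default; last by rewrite size_map; exact: sz.
  apply/esym/negbTE/hasPn => l _.
  by apply: contraNneq tN => <-; apply: eq_type_all.
by rewrite /bad; cbv zeta; rewrite (eq_spared _ _ E) E.
Qed.

End ComputesBad.

(** Moduli beyond [i + j + k] leave the exponents unreduced, so types and badness are constant from
    [B] on. As bad alphabets form an up-set, counting the others below [B] gives the least bad
    one. *)
Definition least_bad i j k : option nat :=
  let B := (i + j + k).+1 in
  if bad i j k B then Some (count (fun m => ~~ bad i j k m) (iota 0 B)) else None.

Lemma computable_least_bad : computable3 least_bad.
Proof.
have c i : i < 3 -> computes 3 (fun v => nth 0 v i) by apply: computes_proj.
have ci := c 0 isT; have cj := c 1 isT; have ck := c 2 isT.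
have cB := computes_succ (computes_add (computes_add ci cj) ck).
have cb := computesb_bad ci cj ck cB.
have cb' := computesb_bad (computes_behead ci) (computes_behead cj) (computes_behead ck)
  (@computes_proj 4 0 isT).
have cnb : computesb 4 (fun w => ~~ bad (nth 0 (behead w) 0) (nth 0 (behead w) 1) (nth 0 (behead w) 2) (nth 0 w 0)).
  exact: (computes_bits (bs := [:: _]) (fun u => ~~ nth false u 0) (conj cb' I)).
have [e eP] := computes_if cb (computes_succ (computes_count cB cnb)) (computes_const 3 0).
exists e => i j k; have := eP [tuple i; j; k]; rewrite /= /least_bad; case: ifP => //.
Qed.

Lemma types_stable i j k m tau : types i j k m tau -> types i j k (i + j + k).+1 tau.
Proof.
have [lm|/ltnW lm] := leqP m (i + j + k).+1; first exact: types_mono.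
case/hasP=> l; rewrite mem_iota => lm' /eqP<-; apply/hasP.
have [lB|lB] := leqP l (i + j + k).+1; first by exists l; rewrite // mem_iota; lia.
exists (i + j + k).+1; first by rewrite mem_iota; lia.
by rewrite /mod_type !modn_small //; lia.
Qed.

Lemma bad_stable i j k m : bad i j k m -> bad i j k (i + j + k).+1.
Proof.
have [lm|/ltnW lm] := leqP m (i + j + k).+1; first exact: bad_le.
have E : types i j k m =1 types i j k (i + j + k).+1.
  by move=> tau; apply/idP/idP => [/types_stable|/(types_mono lm)].
by rewrite /bad E (eq_spared _ _ E).
Qed.

Lemma least_badP i j k : if least_bad i j k is Some s then 0 < s /\ forall m, bad i j k m = (s <= m)
  else forall m, ~~ bad i j k m.
Proof.
rewrite /least_bad; set B := (i + j + k).+1; have [bB|nB] := boolP (bad i j k B); last first.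
  by move=> m; apply: contra nB; apply: bad_stable.
set s := count _ _; have exb : exists m, bad i j k m by exists B.
case: (ex_minnP exb) => m0 b0 min0; have m0B := min0 B bB.
suff -> : s = m0.
  split=> [|m]; last by apply/idP/idP => [/min0|le]; last exact: bad_le le b0.
  by case/andP: b0 => /types_abcd_gt3 m3 _; apply: leq_trans m3.
rewrite /s -(subnKC m0B) iotaD count_cat add0n.
have -> : count (fun m => ~~ bad i j k m) (iota 0 m0) = m0.
  rewrite -[RHS](size_iota 0 m0); apply/eqP; rewrite -all_count; apply/allP => m.
  by rewrite mem_iota => /= mm; apply/negP => /min0; rewrite leqNgt mm.
apply/eqP; rewrite -[X in _ == X]addn0 eqn_add2l eqn0Ngt -has_count; apply/hasPn => m.
by rewrite mem_iota => /andP[mm _]; rewrite negbK; apply: bad_le b0.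
Qed.

Theorem theorem3 :
  exists sigma : nat -> nat -> nat -> option nat,
    computable3 sigma /\
    forall i j k : nat,
      match sigma i j k with
      | Some s =>
          [/\ 1 <= s,
              forall m : nat, 2 <= m <= s - 1 -> avoidable i j k m
            & forall m : nat, s + 1 <= m -> unavoidable i j k m]
      | None => forall m : nat, 2 <= m -> avoidable i j k m
      end.
Proof.
exists least_bad; split=> [|i j k]; first exact: computable_least_bad.
have := least_badP i j k; case: least_bad => [s [s0 badE]|nb m m2]; last first.
  exact: not_bad_avoidable.
split=> // m ms.
  by apply: not_bad_avoidable; [case/andP: ms | rewrite badE -ltnNge; lia].
by case: m ms => [|m] sm; [lia | apply: bad_unavoidable; rewrite badE; lia].
Qed.
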